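(* Let $G^+$, $\sigma_1,\sigma_2,\sigma_3$ and the rank-4 structure $\mathcal{R}$ (Roli's cube) in $\mathbb{E}^4$ be as defined in the context. Then: (a) The $4$-polytope $\mathcal{R}$ is abstractly chiral of type $\{8,3,3\}$. Its symmetry group $\Gamma(\mathcal{R})\simeq G^+=\langle\sigma_1,\sigma_2,\sigma_3\rangle$ has order $192$ and the presentation $$\langle\sigma_1,\sigma_2,\sigma_3 \mid \sigma_1^8=\sigma_2^3=\sigma_3^3=(\sigma_1\sigma_2)^2=(\sigma_2\sigma_3)^2=(\sigma_1\sigma_2\sigma_3)^2=1,\ (\sigma_1^{-3}\sigma_2)^2=1,\ (\sigma_1^{-1}\sigma_3)^4=1\rangle .$$ (b) $\mathcal{R}$ is faithfully realized as a geometrically chiral polytope in $\mathbb{E}^4$.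
   Context: Conventions. Matrices act on row vectors of $\mathbb{E}^4$ from the right, so products are read left to right. Let $b_1,\dots,b_4$ be the standard basis. $\mathcal{P}$ is the $4$-cube with vertex set $\{\pm1\}^4$; its symmetry group $G$ is the group of all $4\times4$ signed permutation matrices (order $384$), and $G^+$ is its rotation subgroup, consisting of the signed permutation matrices of determinant $+1$. Define elements of $G^+$ by - $\sigma_1$: $b_1\mapsto -b_4,\ b_2\mapsto b_1,\ b_3\mapsto b_2,\ b_4\mapsto b_3$; - $\sigma_2$: $b_1\mapsto b_2,\ b_2\mapsto b_4,\ b_4\mapsto b_1,\ b_3\mapsto b_3$; - $\sigma_3$: $b_2\mapsto b_4,\ b_4\mapsto b_3,\ b_3\mapsto b_2,\ b_1\mapsto b_1$. The structure $\mathcal{M}$. Let $v=(1,1,1,1)$, and let $\mathcal{C}$ be the octagon with successive vertices $v,v\sigma_1,\dots,v\sigma_1^7$, successive vertices (cyclically) being joined by edges of $\mathcal{P}$; it is a Petrie polygon of $\mathcal{P}$. $\mathcal{M}$ is the rank-3 structure with vertices the $16$ points of $\{\pm1\}^4$, edges the $24$ images under $\langle\sigma_1,\sigma_2\rangle$ of the edge joining $v$ to $v\sigma_1^{-1}=(-1,1,1,1)$, and $2$-faces the $6$ images of $\mathcal{C}$ under $\langle\sigma_1,\sigma_2\rangle$. Roli's cube $\mathcal{R}$. Its proper faces are as follows. - Rank $0$: the $16$ vertices of $\mathcal{P}$ (stabilizer of the base vertex $v$ in $G^+$: $\langle\sigma_2,\sigma_3\rangle$, order $12$). - Rank $1$: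 the $32$ edges of $\mathcal{P}$ (stabilizer of the base edge $\{v,(-1,1,1,1)\}$: $\langle\sigma_1\sigma_2,\sigma_3\rangle$, order $6$). - Rank $2$: the $12$ images of $\mathcal{C}$ under $G^+$, i.e. one of the two $G^+$-orbits of Petrie polygons of $\mathcal{P}$ (stabilizer of $\mathcal{C}$: $\langle\sigma_1,\sigma_2\sigma_3\rangle$, order $16$). - Rank $3$: the $4$ images of $\mathcal{M}$ under $G^+$ (stabilizer of $\mathcal{M}$: $\langle\sigma_1,\sigma_2\rangle$, order $48$). Incidence is containment (a facet, i.e. an image of $\mathcal{M}$, is incident with exactly the vertices, edges and octagons belonging to it); formal faces of ranks $-1$ and $4$ are added. Abstract polytopes. An abstract $n$-polytope is a ranked poset with least face of rank $-1$ and greatest face of rank $n$, whose flags (maximal chains) all have $n+2$ elements, that is strongly flag-connected and satisfies the diamond condition. Two flags are adjacent if they differ in exactly one face. A $4$-polytope has type $\{8,3,3\}$ if its $2$-faces are octagons, in each facet every vertex lies on three $2$-faces, and each edge lies on three facets. $\Gamma(\mathcal{R})$ is the automorphism group of $\mathcal{R}$. A polytope is (abstractly) chiral if its automorphism group has exactly two orbits on flags, with adjacent flags always in different orbits. It is geometrically chiral, as realized in $\mathbb{E}^4$, if the same holds with the automorphism group replaced by the group of Euclidean isometries preserving the realization. The realization is faithful if the vertices of the abstract polytope correspond to distinct points and distinct faces of each rank $j\ge1$ are represented by distinct families of realized $(j-1)$-faces. *)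

(* Defs.v *)
From HB Require Import structures.
From mathcomp Require Import all_boot all_order all_algebra all_fingroup.
From mathcomp Require Import boolp classical_sets cardinality reals.

Set Implicit Arguments.
Unset Strict Implicit.
Unset Printing Implicit Defensive.

Import Order.TTheory GRing.Theory Num.Theory.

Local Open Scope classical_set_scope.
Local Open Scope card_scope.
Local Open Scope ring_scope.

Definition is_subgroup (G : groupType) (H : set G) : Prop :=
  H 1%g /\ forall x y : G, H x -> H y -> H (x * y^-1)%g.

Definition gen_subgroup (G : groupType) (S : set G) : set G :=
  smallest (@is_subgroup G) S.

Definition isomorphic (G H : groupType) : Prop :=
  exists phi : G -> H, bijective phi /\ {morph phi : x y / (x * y)%g}.

(* The letter (i, false) is the i-th generator and (i, true) its formal
   inverse. *)
Definition letter (n : nat) : Type := ('I_n * bool)%type.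
Definition word (n : nat) : Type := seq (letter n).

Definition letter_inv n (x : letter n) : letter n := (x.1, ~~ x.2).
Definition word_inv n (w : word n) : word n := rev (map (@letter_inv n) w).
Definition word_exp n (w : word n) (k : nat) : word n := flatten (nseq k w).

(* Equality in the group < x_0, ..., x_(n-1) | r = 1 for r in rels >, i.e. in
   the quotient of the free group by the normal closure of rels. *)
Inductive word_eq n (rels : seq (word n)) : word n -> word n -> Prop :=
| word_eq_refl w : word_eq rels w w
| word_eq_sym w1 w2 : word_eq rels w1 w2 -> word_eq rels w2 w1
| word_eq_trans w1 w2 w3 :
    word_eq rels w1 w2 -> word_eq rels w2 w3 -> word_eq rels w1 w3
| word_eq_cancel u v (x : letter n) :
    word_eq rels (u ++ [:: x; letter_inv x] ++ v) (u ++ v)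
| word_eq_rel u v r : r \in rels -> word_eq rels (u ++ r ++ v) (u ++ v).

Definition word_eval (G : groupType) n (s : 'I_n -> G) (w : word n) : G :=
  (\prod_(x <- w) (if x.2 then (s x.1)^-1 else s x.1))%g.

(* The map sending the i-th abstract generator to [s i] is well defined on the
   presented group, injective and surjective. *)
Definition has_presentation (G : groupType) n (s : 'I_n -> G)
    (rels : seq (word n)) : Prop :=
  (forall g : G, exists w, word_eval s w = g) /\
  (forall w1 w2, word_eval s w1 = word_eval s w2 <-> word_eq rels w1 w2).

Record ranked_poset := RankedPoset {
  face :> Type;
  ple : face -> face -> Prop;
  prank : face -> int }.

Section AbstractPolytopes.
Variable P : ranked_poset.
Implicit Types (F G H : P) (Phi Psi : set P).

Definition plt F G : Prop := ple F G /\ F <> G.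

Definition is_partial_order : Prop :=
  (forall F, ple F F) /\
  (forall F G, ple F G -> ple G F -> F = G) /\
  (forall F G H, ple F G -> ple G H -> ple F H).

Definition chain Phi : Prop :=
  forall F G, Phi F -> Phi G -> ple F G \/ ple G F.

Definition flag Phi : Prop :=
  chain Phi /\ forall Psi, chain Psi -> Phi `<=` Psi -> Psi = Phi.

Definition adjacent Phi Psi : Prop :=
  exists F G, [/\ Phi F, ~ Psi F, Psi G, ~ Phi G & Phi `\ F = Psi `\ G].

Definition strongly_flag_connected : Prop :=
  forall Phi Psi, flag Phi -> flag Psi ->
  exists (k : nat) (c : nat -> set P),
    [/\ c 0%N = Phi, c k = Psi,
        forall i, (i <= k)%N -> flag (c i) /\ Phi `&` Psi `<=` c i
      & forall i, (i < k)%N -> adjacent (c i) (c i.+1)].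

Definition diamond_condition : Prop :=
  forall F G, plt F G -> prank G = prank F + 2 ->
  [set H | plt F H /\ plt H G] #= `I_2.

Definition is_polytope (n : nat) : Prop :=
  [/\ is_partial_order,
      (exists F, prank F = -1 /\ forall G, ple F G) /\
      (exists F, prank F = n%:Z /\ forall G, ple G F),
      (forall F G, plt F G -> prank F < prank G),
      (forall Phi, flag Phi -> Phi #= `I_(n.+2))
    & strongly_flag_connected /\ diamond_condition].

Definition is_polygon (p : nat) F : Prop :=
  prank F = 2 /\
  exists (v e : 'I_p -> P), [/\ injective v, injective e,
    range v = [set G | prank G = 0 /\ ple G F],
    range e = [set G | prank G = 1 /\ ple G F]
  & forall i j, ple (v i) (e j) <-> (i = j \/ i = ordS j)].

Definition schlafli_type (p q r : nat) : Prop :=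
  [/\ (forall F, prank F = 2 -> is_polygon p F),
      (forall V K : P, prank V = 0 -> prank K = 3 -> ple V K ->
         [set F | [/\ prank F = 2, ple V F & ple F K]] #= `I_q)
    & (forall E : P, prank E = 1 -> [set K | prank K = 3 /\ ple E K] #= `I_r)].

Definition is_automorphism (f : P -> P) : Prop :=
  bijective f /\ forall F G, ple (f F) (f G) <-> ple F G.

(* [same] is the relation "in the same orbit" on flags. *)
Definition chiral_for (same : set P -> set P -> Prop) : Prop :=
  (exists Phi1 Phi2, [/\ flag Phi1, flag Phi2, ~ same Phi1 Phi2
     & forall Phi, flag Phi -> same Phi1 Phi \/ same Phi2 Phi]) /\
  (forall Phi Psi, flag Phi -> flag Psi -> adjacent Phi Psi ->
     ~ same Phi Psi).

Definition same_aut_orbit Phi Psi : Prop :=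
  exists f, is_automorphism f /\ f @` Phi = Psi.

Definition abstractly_chiral : Prop := chiral_for same_aut_orbit.

End AbstractPolytopes.

Definition automorphism (P : ranked_poset) : Type :=
  set_type [set f : P -> P | is_automorphism f].

Section AutomorphismGroup.
Variable P : ranked_poset.

HB.instance Definition _ := gen_eqMixin (automorphism P).
HB.instance Definition _ := gen_choiceMixin (automorphism P).

Implicit Types f g h : automorphism P.

Lemma autP f : is_automorphism (val f).
Proof. by have := valP f; rewrite inE. Qed.

Fact aut_one_subproof : is_automorphism (@idfun P).
Proof. by split; [exists idfun | ]. Qed.

Definition aut_one : automorphism P := SigSub (mem_set aut_one_subproof).

Fact aut_mul_subproof f g : is_automorphism (val g \o val f).
Proof.
have [bf lf] := autP f; have [bg lg] := autP g.
by split=> [|F G]; [exact: bij_comp | rewrite /= lg lf].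
Qed.

(* Products are read from left to right: f is applied first. *)
Definition aut_mul f g : automorphism P :=
  SigSub (mem_set (aut_mul_subproof f g)).

Fact aut_inv_exists f :
  exists g : P -> P, [/\ cancel (val f) g, cancel g (val f) & is_automorphism g].
Proof.
have [[g fK gK] lf] := autP f; exists g; split=> //; split.
  by exists (val f).
by move=> F G; rewrite -lf !gK.
Qed.

Definition aut_inv f : automorphism P :=
  SigSub (mem_set (let: And3 _ _ h := projT2 (cid (aut_inv_exists f)) in h)).

Fact aut_mulA : associative aut_mul.
Proof. by move=> f g h; apply/val_inj. Qed.

Fact aut_mul1 : left_id aut_one aut_mul.
Proof. by move=> f; apply/val_inj. Qed.

Fact aut_mulr1 : right_id aut_one aut_mul.
Proof. by move=> f; apply/val_inj. Qed.

Fact aut_mulV : left_inverse aut_one aut_inv aut_mul.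
Proof.
move=> f; apply/val_inj/funext => F /=.
by case: (projT2 (cid (aut_inv_exists f))) => _ gK _; exact: gK.
Qed.

Fact aut_mulrV : right_inverse aut_one aut_inv aut_mul.
Proof.
move=> f; apply/val_inj/funext => F /=.
by case: (projT2 (cid (aut_inv_exists f))) => fK _ _; exact: fK.
Qed.

HB.instance Definition _ := isGroup.Build (automorphism P)
  aut_mulA aut_mul1 aut_mulr1 aut_mulV aut_mulrV.

End AutomorphismGroup.

Section Realizations.
Variables (R : realType) (m : nat).

Definition euclid_dist (x y : 'rV[R]_m) : R :=
  Num.sqrt (\sum_(i < m) (x 0 i - y 0 i) ^+ 2).

Definition euclid_isometry (f : 'rV[R]_m -> 'rV[R]_m) : Prop :=
  forall x y, euclid_dist (f x) (f y) = euclid_dist x y.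

(* Points, families of points, families of families of points, ... *)
Fixpoint rface (j : nat) : Type :=
  if j is k.+1 then set (rface k) else 'rV[R]_m.

Fixpoint rface_map (f : 'rV[R]_m -> 'rV[R]_m) (j : nat) :
    rface j -> rface j :=
  if j is k.+1 then fun A => [set rface_map f B | B in A] else f.

Variable P : ranked_poset.
(* Only the values of [beta] on faces of rank 0 matter. *)
Variable beta : P -> 'rV[R]_m.

(* A face of rank j.+1 is represented by the family of its realized faces of
   rank j. *)
Fixpoint realize (j : nat) : P -> rface j :=
  if j is k.+1 then
    fun F => [set realize k G | G in [set G | prank G = k%:Z /\ ple G F]]
  else beta.

Definition faithful_realization : Prop :=
  forall (j : nat) (F G : P), prank F = j%:Z -> prank G = j%:Z ->
    realize j F = realize j G -> F = G.

Definition realized (A : set P) (j : nat) : rface j.+1 :=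
  [set realize j F | F in [set F | A F /\ prank F = j%:Z]].

Definition maps_realized (f : 'rV[R]_m -> 'rV[R]_m) (A B : set P) : Prop :=
  forall j : nat, rface_map f (@realized A j) = @realized B j.

Definition geometric_symmetry (f : 'rV[R]_m -> 'rV[R]_m) : Prop :=
  euclid_isometry f /\ maps_realized f setT setT.

Definition same_geometric_orbit (Phi Psi : set P) : Prop :=
  exists f, geometric_symmetry f /\ maps_realized f Phi Psi.

Definition geometrically_chiral : Prop := chiral_for same_geometric_orbit.

End Realizations.

Section RotationGroup.
Variable R : realType.

Definition signed_perm_mx (s : 'S_4) (e : 'I_4 -> bool) : 'M[R]_4 :=
  \matrix_(i, j) ((-1) ^+ e i *+ (j == s i)).

Definition is_signed_perm_mx (A : 'M[R]_4) : Prop :=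
  exists (s : 'S_4) (e : 'I_4 -> bool), A = signed_perm_mx s e.

Definition Gplus : set 'M[R]_4 :=
  [set A | is_signed_perm_mx A /\ \det A = 1].

Definition rotation : Type := set_type Gplus.

HB.instance Definition _ := Choice.on rotation.

Implicit Types A B : rotation.

Lemma rotationP A : Gplus (val A).
Proof. by have := valP A; rewrite inE. Qed.

Lemma signed_perm_mxM s1 e1 s2 e2 :
  signed_perm_mx s1 e1 *m signed_perm_mx s2 e2 =
  signed_perm_mx (s1 * s2)%g (fun i => e1 i (+) e2 (s1 i)).
Proof.
apply/matrixP => i j; rewrite !mxE (bigD1 (s1 i)) //= big1 ?addr0 => [|k ki].
  by rewrite !mxE eqxx mulr1n mulrnAr -signr_addb permM.
by rewrite !mxE (negPf ki) mulr0n mul0r.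
Qed.

Lemma signed_perm_mx1 : signed_perm_mx 1%g (fun=> false) = 1%:M.
Proof. by apply/matrixP => i j; rewrite !mxE perm1 eq_sym. Qed.

Fact rot_one_subproof : Gplus 1%:M.
Proof.
by split; [exists 1%g, (fun=> false); rewrite signed_perm_mx1 | rewrite det1].
Qed.

Definition rot_one : rotation := SigSub (mem_set rot_one_subproof).

Fact rot_mul_subproof A B : Gplus (val A *m val B).
Proof.
have [[s1 [e1 eA]] dA] := rotationP A; have [[s2 [e2 eB]] dB] := rotationP B.
split; last by rewrite det_mulmx dA dB mulr1.
by rewrite eA eB signed_perm_mxM; do 2 eexists.
Qed.

Definition rot_mul A B : rotation := SigSub (mem_set (rot_mul_subproof A B)).

Lemma rotation_unit A : val A \in unitmx.
Proof. by rewrite unitmxE; have [_ ->] := rotationP A; rewrite unitr1. Qed.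

Fact rot_inv_subproof A : Gplus (invmx (val A)).
Proof.
have [[s [e eA]] dA] := rotationP A.
split; last by rewrite det_inv dA invr1.
exists (s^-1)%g, (fun i => e ((s^-1)%g i)).
rewrite -[LHS]mulmx1 -signed_perm_mx1.
suff -> : signed_perm_mx 1%g (fun=> false) =
    val A *m signed_perm_mx s^-1%g (fun i => e ((s^-1)%g i)).
  by rewrite mulKmx // rotation_unit.
rewrite eA signed_perm_mxM mulgV; congr signed_perm_mx.
by apply/funext => i; rewrite permK addbb.
Qed.

Definition rot_inv A : rotation := SigSub (mem_set (rot_inv_subproof A)).

Fact rot_mulA : associative rot_mul.
Proof. by move=> A B C; apply/val_inj; rewrite /= mulmxA. Qed.

Fact rot_mul1 : left_id rot_one rot_mul.
Proof. by move=> A; apply/val_inj; rewrite /= mul1mx. Qed.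

Fact rot_mulr1 : right_id rot_one rot_mul.
Proof. by move=> A; apply/val_inj; rewrite /= mulmx1. Qed.

Fact rot_mulV : left_inverse rot_one rot_inv rot_mul.
Proof. by move=> A; apply/val_inj; rewrite /= mulVmx ?rotation_unit. Qed.

Fact rot_mulrV : right_inverse rot_one rot_inv rot_mul.
Proof. by move=> A; apply/val_inj; rewrite /= mulmxV ?rotation_unit. Qed.

HB.instance Definition _ := isGroup.Build rotation
  rot_mulA rot_mul1 rot_mulr1 rot_mulV rot_mulrV.

(* The standard basis, indexed from 1 to 4. *)
Definition bvec (k : nat) : 'rV[R]_4 := \row_(j < 4) (j.+1 == k)%:R.

(* The i-th row is the image of the i-th basis vector. *)
Definition mx_of_images (b1 b2 b3 b4 : 'rV[R]_4) : 'M[R]_4 :=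
  \matrix_(i < 4) tnth [tuple b1; b2; b3; b4] i.

Definition sigma1_mx : 'M[R]_4 :=
  mx_of_images (- bvec 4) (bvec 1) (bvec 2) (bvec 3).
Definition sigma2_mx : 'M[R]_4 := mx_of_images (bvec 2) (bvec 4) (bvec 3) (bvec 1).
Definition sigma3_mx : 'M[R]_4 := mx_of_images (bvec 1) (bvec 4) (bvec 2) (bvec 3).

(* Row i has the entry (-1) ^+ e_i in column p_i, and zeros elsewhere. *)
Definition sparse_mx (p e : seq nat) : 'M[R]_4 :=
  \matrix_(i < 4, j < 4) ((-1) ^+ nth 0%N e i *+ (j == nth 0%N p i :> nat)).

Lemma Gplus_sparse (p e : seq nat) :
  perm_eq p (iota 0 4) -> all (leq^~ 1%N) e -> \det (sparse_mx p e) = 1 ->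
  Gplus (sparse_mx p e).
Proof.
move=> pP eP d1; split=> //.
have sp : size p = 4 by rewrite (perm_size pP).
have p4 (i : 'I_4) : (nth 0%N p i < 4)%N.
  have : nth 0%N p i \in iota 0 4 by rewrite -(perm_mem pP) mem_nth ?sp.
  by rewrite mem_iota.
have pI : injective (fun i => Ordinal (p4 i)).
  move=> i j [/eqP]; rewrite nth_uniq ?sp // ?(perm_uniq pP) ?iota_uniq //.
  by move/eqP/val_inj.
exists (perm pI), (fun i => nth 0%N e i == 1%N); apply/matrixP => i j.
rewrite !mxE permE; congr (_ ^+ _ *+ _).
have [ie|ie] := ltnP i (size e); last by rewrite nth_default.
by have := allP eP _ (mem_nth 0%N ie); case: (nth _ _ _) => [|[]].
Qed.

Ltac entries :=
  apply/matrixP => -[] [|[|[|[|//]]]] ? -[] [|[|[|[|//]]]] ?;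
  by rewrite !mxE ?(tnth_nth 0) /= ?mxE /= ?expr1 ?expr0 ?mulr0n ?mulr1n ?oppr0.

Ltac det_sparse :=
  rewrite (expand_det_row _ ord0) !big_ord_recl !big_ord0 /cofactor !mxE /=
    /bump /= ?(mulr0n, mul0r, addr0, add0r).

Ltac Gplus_by :=
  apply: Gplus_sparse => //; do 3 det_sparse;
  rewrite det_mx11 !mxE /= /bump /= ?mulr1n ?expr0 ?mulr1 ?mul1r -?exprD;
  by rewrite -signr_odd.

Lemma sigma1_mxE : sigma1_mx = sparse_mx [:: 3; 0; 1; 2] [:: 1].
Proof. entries. Qed.

Lemma sigma2_mxE : sigma2_mx = sparse_mx [:: 1; 3; 2; 0] [::].
Proof. entries. Qed.

Lemma sigma3_mxE : sigma3_mx = sparse_mx [:: 0; 3; 1; 2] [::].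
Proof. entries. Qed.

Fact sigma1_subproof : Gplus sigma1_mx.
Proof. rewrite sigma1_mxE; Gplus_by. Qed.

Fact sigma2_subproof : Gplus sigma2_mx.
Proof. rewrite sigma2_mxE; Gplus_by. Qed.

Fact sigma3_subproof : Gplus sigma3_mx.
Proof. rewrite sigma3_mxE; Gplus_by. Qed.

Definition sigma1 : rotation := SigSub (mem_set sigma1_subproof).
Definition sigma2 : rotation := SigSub (mem_set sigma2_subproof).
Definition sigma3 : rotation := SigSub (mem_set sigma3_subproof).

Definition sigma (i : 'I_3) : rotation :=
  tnth [tuple sigma1; sigma2; sigma3] i.

End RotationGroup.

Definition roli_relators : seq (word 3) :=
  let x1 : word 3 := [:: (@Ordinal 3 0 isT, false)] in
  let x2 : word 3 := [:: (@Ordinal 3 1 isT, false)] in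
  let x3 : word 3 := [:: (@Ordinal 3 2 isT, false)] in
  [:: word_exp x1 8; word_exp x2 3; word_exp x3 3;
      word_exp (x1 ++ x2) 2; word_exp (x2 ++ x3) 2;
      word_exp (x1 ++ x2 ++ x3) 2;
      word_exp (word_exp (word_inv x1) 3 ++ x2) 2;
      word_exp (word_inv x1 ++ x3) 4].

Section RoliCube.
Variable R : realType.

Local Notation point := 'rV[R]_4.

(* An edge is the set of its two end points. *)
Local Notation segment := (set 'rV[R]_4).

Record polygon := Polygon {
  polygon_vertices : set point;
  polygon_edges : set segment }.

Record cell := Cell {
  cell_vertices : set point;
  cell_edges : set segment;
  cell_polygons : set polygon }.

Implicit Types g : rotation R.

Definition rot_point g (x : point) : point := x *m val g.

Definition rot_segment g (e : segment) : segment := rot_point g @` e.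

Definition rot_polygon g (c : polygon) : polygon :=
  Polygon (rot_point g @` polygon_vertices c)
          (rot_segment g @` polygon_edges c).

Definition rot_cell g (m : cell) : cell :=
  Cell (rot_point g @` cell_vertices m)
       (rot_segment g @` cell_edges m)
       (rot_polygon g @` cell_polygons m).

Definition cube_vertices : set point :=
  [set x | forall j, x 0 j = 1 \/ x 0 j = -1].

Definition cube_edges : set segment :=
  [set e | exists x y : point, [/\ cube_vertices x, cube_vertices y,
     (exists! j, x 0 j <> y 0 j) & e = [set x; y]]].

Definition base_vertex : point := const_mx 1.

Definition base_edge : segment :=
  [set base_vertex; rot_point (sigma1 R)^-1%g base_vertex].

Definition petrie_vertex (k : 'I_8) : point :=
  rot_point (sigma1 R ^+ k)%g base_vertex.

Definition base_octagon : polygon :=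
  Polygon (range petrie_vertex)
          (range (fun k => [set petrie_vertex k; petrie_vertex (ordS k)])).

Definition base_facet : cell :=
  let H := gen_subgroup [set sigma1 R; sigma2 R] in
  Cell cube_vertices
       [set rot_segment g base_edge | g in H]
       [set rot_polygon g base_octagon | g in H].

Definition roli_octagons : set polygon :=
  range (fun g => rot_polygon g base_octagon).

Definition roli_facets : set cell := range (fun g => rot_cell g base_facet).

Inductive roli_face : Type :=
| RoliLeast
| RoliVertex of cube_vertices
| RoliEdge of cube_edges
| RoliOctagon of roli_octagons
| RoliFacet of roli_facets
| RoliGreatest.

Definition roli_rank (F : roli_face) : int :=
  match F with
  | RoliLeast => -1
  | RoliVertex _ => 0
  | RoliEdge _ => 1
  | RoliOctagon _ => 2
  | RoliFacet _ => 3
  | RoliGreatest => 4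
  end.

Definition roli_incident (F G : roli_face) : Prop :=
  match F, G with
  | RoliLeast, _ | _, RoliGreatest => True
  | RoliVertex x, RoliEdge e => val e (val x)
  | RoliVertex x, RoliOctagon c => polygon_vertices (val c) (val x)
  | RoliVertex x, RoliFacet m => cell_vertices (val m) (val x)
  | RoliEdge e, RoliOctagon c => polygon_edges (val c) (val e)
  | RoliEdge e, RoliFacet m => cell_edges (val m) (val e)
  | RoliOctagon c, RoliFacet m => cell_polygons (val m) (val c)
  | _, _ => F = G
  end.

Definition roli_cube : ranked_poset := RankedPoset roli_incident roli_rank.

Definition roli_point (F : roli_cube) : point :=
  if F is RoliVertex x then val x else 0.

End RoliCube.

(* Main.v *)
Require Import Defs.
From mathcomp Require Import all_boot all_order all_algebra all_fingroup.
From mathcomp Require Import boolp classical_sets functions cardinality reals.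
From mathcomp Require Import zify.

(** Everything in the statement reduces to the finite combinatorics of the 66
faces of the cube.

    Faces are coded by numbers, and incidence by a table (polytope_table,
    coding). Once the table is known to describe the cube (roli_coding), the
    axioms of a polytope (coded_is_polytope), the Schlaefli type
    (roli_schlafli) and faithfulness (roli_faithful) are read off the table.
    For strong flag-connectedness, each set K of moves comes with a distance
    function on flags that decreases along some move in K until it reaches the
    chosen flag of its class modulo moves in K (connected_by_descent).

    To identify the table, edges, octagons and facets are shown to be the
    images of sign vectors and of lists of them; orbits of the groups generated
    by two or three of the sigma_i are closures under the action of these
    generators on codes (orbit_eq). A signed permutation matrix is a list of
    four signed axes; the 192 products of generators, together with their
    products with one reflection, exhaust the 384 signed permutations, so a
    matrix of determinant 1 is one of the 192 (rotation_frame).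

    The rotations act on the 384 flags with two orbits. They are separated by
    an automorphism invariant: the walk that changes the vertex, the edge, the
    octagon and the facet of a flag in turn, four times over, is closed for the
    flags of one orbit and not closed for those of the other, and adjacent
    flags behave oppositely (roli_handed_adj). This yields abstract chirality.
    Every automorphism therefore agrees with a rotation on some flag; as an
    automorphism that fixes a flag is trivial (automorphism_fixing_flag), the
    automorphism group is the rotation group. An isometry that preserves the
    realization induces an automorphism, because the realization is faithful
    (symmetry_automorphism), and rotations are isometries; so geometric
    chirality follows from the same invariant.

    For the presentation, coset enumeration over the trivial subgroup gives
    words for the 192 elements such that every edge of the Cayley graph is a
    consequence of the relators (edge_word_eq). Hence every word equals one of
    these words in the presented group, and their values are distinct. *)

Set Implicit Arguments.
Unset Strict Implicit.
Unset Printing Implicit Defensive.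

Import Order.TTheory GRing.Theory Num.Theory.

Local Open Scope classical_set_scope.
Local Open Scope card_scope.

(** * Polytopes coded by numbers *)

(** A flag of a coded poset of rank d: the codes of its d + 2 faces, one on each
level, in increasing order. *)
Definition coded_flag (d n : nat) (le : rel nat) (lev : nat -> nat)
    (t : seq nat) : bool :=
  [&& all (gtn n) t, map lev t == iota 0 d.+2 & pairwise le t].

(** The lists t and u differ in position k and nowhere else. *)
Definition differ_at (t u : seq nat) (k : nat) : bool :=
  (nth 0 t k != nth 0 u k) &&
  all (fun i => (i == k) || (nth 0 t i == nth 0 u i)) (iota 0 (size t)).

Definition coded_adjacent (t u : seq nat) : bool :=
  has (differ_at t u) (iota 0 (size t)).

(** The list w contains the common faces of t and u. *)
Definition agree_where (t u w : seq nat) : bool :=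
  all (fun i => (nth 0 t i == nth 0 u i) ==> (nth 0 w i == nth 0 t i))
      (iota 0 (size t)).

(** An incidence table on the numbers below n that has the properties of an
abstract d-polytope. The level of a face is its rank plus one, so that levels
run from 0 to d + 1. Strong flag-connectedness is stated with paths of coded
flags. *)
Record polytope_table (d n : nat) (le : rel nat) (lev : nat -> nat) : Prop :=
  PolytopeTable {
  tab_refl : forall a, a < n -> le a a;
  tab_lev_lt : forall a b, a < n -> b < n -> le a b -> a != b -> lev a < lev b;
  tab_trans : forall a b c, a < n -> b < n -> c < n ->
    le a b -> le b c -> le a c;
  tab_bot : exists a, [/\ a < n, lev a = 0 & forall b, b < n -> le a b];
  tab_top : exists a, [/\ a < n, lev a = d.+1 & forall b, b < n -> le b a];
  tab_dense : forall a b, a < n -> b < n -> le a b -> (lev a).+1 < lev b ->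
    exists c, [/\ c < n, lev c = (lev a).+1, le a c & le c b];
  tab_diamond : forall a b, a < n -> b < n -> le a b -> lev b = (lev a).+2 ->
    size [seq c <- iota 0 n | [&& lev c == (lev a).+1, le a c & le c b]] = 2;
  tab_connected : forall t u,
    coded_flag d n le lev t -> coded_flag d n le lev u ->
    exists p, [/\ path coded_adjacent t p, last t p = u,
      all (coded_flag d n le lev) p & all (agree_where t u) p] }.

(** The map phi enumerates the faces of P by the numbers below n, in accordance
with the table; antisymmetry of the table makes it injective. *)
Record coding (P : ranked_poset) (n : nat) (le : rel nat) (lev : nat -> nat)
    (phi : nat -> P) : Prop := Coding {
  coding_surj : forall F, exists2 a, a < n & phi a = F;
  coding_le : forall a b, a < n -> b < n -> (ple (phi a) (phi b) <-> le a b);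
  coding_rank : forall a, a < n -> prank (phi a) = ((lev a)%:Z - 1)%R }.

Lemma image_injective (T U : Type) (f : T -> U) :
  injective f -> injective (fun A : set T => f @` A).
Proof.
move=> fI A B e; apply/funext => x.
by rewrite -(image_inj (A := A) fI) -(image_inj (A := B) fI) e.
Qed.

Lemma card_coded_set (T : Type) (f : nat -> T) (s : seq nat) :
  uniq s -> {in s &, injective f} -> f @` [set` s] #= `I_(size s).
Proof.
move=> us fI.
have -> : f @` [set` s] = (fun i => f (nth 0 s i)) @` `I_(size s).
  apply/seteqP; split=> x /=.
    case=> a /= ain <-; exists (index a s); rewrite ?nth_index //=.
    by rewrite index_mem.
  by case=> i /= ilt <-; exists (nth 0 s i); rewrite ?mem_nth.
apply: inj_card_eq => i j; rewrite !inE /= => il jl /fI /eqP.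
by rewrite !mem_nth // nth_uniq // => /(_ isT isT)/eqP.
Qed.

Section CodedPoset.
Variables (d n : nat) (le : rel nat) (lev : nat -> nat).
Hypothesis TBL : polytope_table d n le lev.
Variables (P : ranked_poset) (phi : nat -> P).
Hypothesis COD : coding n le lev phi.

Local Notation cflag := (coded_flag d n le lev).
Let phiS := coding_surj COD.
Let phiL := coding_le COD.
Let phiR := coding_rank COD.

(** The set of faces with codes in t. *)
Definition flag_of (t : seq nat) : set P := phi @` [set` t].

Lemma tab_lev_le a b : a < n -> b < n -> le a b -> lev a <= lev b.
Proof.
move=> an bn ab; have [->//|nab] := eqVneq a b.
exact/ltnW/(tab_lev_lt TBL).
Qed.

Lemma tab_same_lev a b : a < n -> b < n -> le a b -> lev a = lev b -> a = b.
Proof.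
move=> an bn ab eab; apply/eqP; apply: contraT => nab.
by have := tab_lev_lt TBL an bn ab nab; rewrite eab ltnn.
Qed.

Lemma tab_anti a b : a < n -> b < n -> le a b -> le b a -> a = b.
Proof.
move=> an bn ab ba; apply: tab_same_lev => //; apply/eqP.
by rewrite eqn_leq !tab_lev_le.
Qed.

Lemma coding_inj a b : a < n -> b < n -> phi a = phi b -> a = b.
Proof.
move=> an bn eab; apply: tab_anti => //; apply/phiL => //; rewrite eab.
  exact/phiL/(tab_refl TBL).
exact/phiL/(tab_refl TBL).
Qed.

Lemma cflag_lt t a : cflag t -> a \in t -> a < n.
Proof. by case/and3P=> /allP h _ _ /h. Qed.

Lemma cflag_size t : cflag t -> size t = d.+2.
Proof. by case/and3P=> _ /eqP h _; rewrite -(size_map lev) h size_iota. Qed.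

Lemma cflag_lev t i : cflag t -> i < d.+2 -> lev (nth 0 t i) = i.
Proof.
move=> ft il; have st := cflag_size ft; case/and3P: ft => _ /eqP h _.
by rewrite -(nth_map 0 0) ?st // h nth_iota.
Qed.

Lemma cflag_nth_lt t i : cflag t -> i < d.+2 -> nth 0 t i < n.
Proof. by move=> ft il; apply: (cflag_lt ft); rewrite mem_nth ?(cflag_size ft). Qed.

Lemma cflag_memE t a : cflag t -> a \in t -> nth 0 t (lev a) = a /\ lev a < d.+2.
Proof.
move=> ft /(nthP 0)[i il <-]; rewrite (cflag_size ft) in il.
by rewrite cflag_lev.
Qed.

Lemma cflag_le t i j : cflag t -> i <= j -> j < d.+2 ->
  le (nth 0 t i) (nth 0 t j).
Proof.
move=> ft; rewrite leq_eqVlt => /orP[/eqP->|ij] jl.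
  exact/(tab_refl TBL)/cflag_nth_lt.
case/and3P: (ft) => _ _ /(pairwiseP 0); apply=> //; rewrite inE (cflag_size ft) //.
exact: ltn_trans jl.
Qed.

Lemma cflag_total t a b : cflag t -> a \in t -> b \in t -> le a b || le b a.
Proof.
move=> ft /(cflag_memE ft)[ea al] /(cflag_memE ft)[eb bl]; rewrite -ea -eb.
by apply/orP; case: (leqP (lev a) (lev b)) => [?|/ltnW ?];
  [left|right]; exact: cflag_le.
Qed.

Lemma cflag_uniq t : cflag t -> uniq t.
Proof.
by case/and3P=> _ /eqP h _; apply: (@map_uniq _ _ lev); rewrite h iota_uniq.
Qed.

Lemma cflag_eq t u : cflag t -> cflag u ->
  (forall i, i < d.+2 -> nth 0 t i = nth 0 u i) -> t = u.
Proof.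
move=> ft fu tu; apply: (@eq_from_nth _ 0); first by rewrite !cflag_size.
by move=> i; rewrite cflag_size //; exact: tu.
Qed.

Lemma cflag_sub t u : cflag t -> cflag u -> {subset t <= u} -> t = u.
Proof.
move=> ft fu tu; apply: cflag_eq => // i il.
have := tu (nth 0 t i); rewrite mem_nth ?cflag_size // => /(_ isT).
by case/(cflag_memE fu) => + _; rewrite cflag_lev.
Qed.

Lemma flag_of_in t a : a \in t -> flag_of t (phi a).
Proof. by move=> at_; exists a. Qed.

Lemma flag_of_mem t a : cflag t -> a < n -> flag_of t (phi a) -> a \in t.
Proof.
by move=> ft an [b /= bt /coding_inj <-] //; exact: (cflag_lt ft bt).
Qed.

Lemma flag_of_inj t u : cflag t -> cflag u -> flag_of t = flag_of u -> t = u.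
Proof.
move=> ft fu e; apply: cflag_sub => // a at_; apply: flag_of_mem => //.
  exact: cflag_lt at_.
by rewrite -e; exists a.
Qed.

Lemma flag_of_flag t : cflag t -> flag (flag_of t).
Proof.
move=> ft; split=> [_ _ [a /= at_ <-] [b /= bt <-]|Psi cPsi tPsi].
  have an := cflag_lt ft at_; have bn := cflag_lt ft bt.
  by case/orP: (cflag_total ft at_ bt) => h; [left|right]; apply/phiL.
apply/seteqP; split=> // F PsiF; have [b bn eF] := phiS F.
have levb : lev b < d.+2.
  by have [a [an <- atop]] := tab_top TBL; rewrite ltnS tab_lev_le ?atop.
have ct : nth 0 t (lev b) \in t by rewrite mem_nth ?cflag_size.
have cn := cflag_lt ft ct.
exists (nth 0 t (lev b)) => //; rewrite -eF; congr phi.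
have lc : lev (nth 0 t (lev b)) = lev b by rewrite cflag_lev.
have := cPsi _ _ (tPsi _ (flag_of_in ct)) PsiF; rewrite -eF.
by case=> /phiL h; [apply: tab_same_lev|apply/esym/tab_same_lev]; rewrite ?h.
Qed.

(** A maximal chain meets every rank: between an element of the chain and the
next one above it, density would otherwise provide one more element. *)
Lemma flag_levels Phi : flag Phi -> forall k, k < d.+2 ->
  exists a, [/\ a < n, lev a = k & Phi (phi a)].
Proof.
case=> cPhi mPhi.
have comp c : c < n -> (forall x, x < n -> Phi (phi x) -> le x c \/ le c x) ->
    Phi (phi c).
  move=> cn h; (* A maximal chain contains every face comparable with all of its faces. *)
  rewrite -(mPhi (Phi `|` [set phi c])); first by right.
    have lecc : ple (phi c) (phi c) by apply/phiL/(tab_refl TBL).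
    move=> F G [PF|->] [PG|->]; first exact: cPhi.
    - have [x xn xF] := phiS F; rewrite -xF in PF *.
      by case: (h x xn PF) => ?; [left|right]; apply/phiL.
    - have [x xn xF] := phiS G; rewrite -xF in PG *.
      by case: (h x xn PG) => ?; [right|left]; apply/phiL.
    - by left.
  by left.
have [top [topn levtop letop]] := tab_top TBL.
have Ptop : Phi (phi top) by apply: comp => // x xn _; left; exact: letop.
elim=> [_|k IH kd].
  have [a [an la lea]] := tab_bot TBL; exists a; split=> //.
  by apply: comp => // x xn _; right; exact: lea.
have [a [an la Pa]] := IH (ltnW kd).
pose Q j := `[< exists x, [/\ x < n, Phi (phi x), lev x = j & k < j] >].
have [|j /asboolP[b [bn Pb lb kj]] minj] := @ex_minnP Q.
  by exists d.+1; apply/asboolP; exists top.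
have total x y : x < n -> y < n -> Phi (phi x) -> Phi (phi y) ->
    lev x <= lev y -> le x y.
  move=> xn yn Px Py xy; case: (cPhi _ _ Px Py) => /phiL h; first exact: h.
  suff -> : x = y by exact: (tab_refl TBL).
  apply/esym/tab_same_lev => //; first exact: h.
  by apply/eqP; rewrite eqn_leq xy andbT tab_lev_le ?h.
have leab : le a b by apply: total; rewrite // la lb ltnW.
have [ek|nk] := eqVneq j k.+1; first by exists b; rewrite lb ek.
have [|c [cn lc ac cb]] := tab_dense TBL an bn leab.
  by rewrite la lb ltn_neqAle eq_sym nk.
exists c; split=> //; first by rewrite lc la.
apply: comp => // x xn Px; have [xk|xk] := leqP (lev x) k.
  by left; apply: (tab_trans TBL xn an) => //; apply: total; rewrite ?la.
right; apply: (tab_trans TBL cn bn) => //; apply: total; rewrite // lb.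
by apply: minj; apply/asboolP; exists x.
Qed.

Lemma flagP Phi : flag Phi <-> exists2 t, cflag t & Phi = flag_of t.
Proof.
split=> [fPhi|[t ft ->]]; last exact: flag_of_flag.
pose X k a := k < d.+2 -> [/\ a < n, lev a = k & Phi (phi a)].
have [x xP] : exists x : nat -> nat, forall k, X k (x k).
  suff h k : exists a, X k a by have [x xP] := choice h; exists x.
  have [kd|kd] := ltnP k d.+2.
    by have [a aP] := flag_levels fPhi kd; exists a => _.
  by exists 0 => kd'; move: kd; rewrite leqNgt kd'.
pose t := map x (iota 0 d.+2).
have tP a : a \in t -> a < n /\ Phi (phi a).
  case/mapP=> k; rewrite mem_iota /= add0n => kd ->.
  by have [? ? ?] := xP k kd.
have ft : cflag t.
  apply/and3P; split.
  - by apply/allP=> a /tP[].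
  - rewrite -map_comp; apply/eqP/map_id_in => k; rewrite mem_iota /= add0n.
    by move=> kd; have [_ -> _] := xP k kd.
  - rewrite pairwise_map; apply/(pairwiseP 0) => i j; rewrite !inE size_iota.
    move=> il jl ij; rewrite !nth_iota // !add0n.
    have [in_ li Pi] := xP i il; have [jn lj Pj] := xP j jl.
    case: fPhi => cPhi _; case: (cPhi _ _ Pi Pj) => /phiL h; first exact: h.
    by have := tab_lev_le jn in_ (h jn in_); rewrite li lj leqNgt ij.
exists t => //; have [_ mt] := flag_of_flag ft; case: fPhi => cPhi _.
by apply: mt => // F [a /= /tP[_ Pa] <-].
Qed.

Lemma differ_atP t u k : cflag t -> cflag u -> k < d.+2 ->
  reflect (nth 0 t k <> nth 0 u k /\
           forall i, i < d.+2 -> i != k -> nth 0 t i = nth 0 u i)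
          (differ_at t u k).
Proof.
move=> ft fu kd; rewrite /differ_at (cflag_size ft).
apply: (iffP andP) => -[/eqP tuk h]; split=> //.
  move=> i id ik; apply/eqP; have /allP/(_ i) := h.
  by rewrite mem_iota id (negPf ik) => /(_ isT).
apply/allP=> i; rewrite mem_iota /= add0n => id.
by case: eqVneq => //= ik; rewrite h.
Qed.

Lemma adjacent_differ t u : cflag t -> cflag u ->
  adjacent (flag_of t) (flag_of u) -> exists2 k, k < d.+2 & differ_at t u k.
Proof.
move=> ft fu [_ [_ [[a /= at_ <-] nua [b /= bu <-] ntb e]]].
have [ea la] := cflag_memE ft at_; exists (lev a) => //.
apply/differ_atP => //; split=> [h|i id ik].
  by apply: nua; exists a => //=; rewrite -ea h mem_nth ?cflag_size.
have : (flag_of t `\ phi a) (phi (nth 0 t i)).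
  split; first by exists (nth 0 t i) => //=; rewrite mem_nth ?cflag_size.
  move=> /= /coding_inj; rewrite cflag_nth_lt // (cflag_lt ft at_).
  by move=> /(_ isT isT) h; case/eqP: ik; rewrite -h cflag_lev.
rewrite e => -[/flag_of_mem]; rewrite cflag_nth_lt // => /(_ fu isT).
by case/(cflag_memE fu) => + _ _; rewrite cflag_lev.
Qed.

Lemma differ_adjacent t u k : cflag t -> cflag u -> k < d.+2 ->
  differ_at t u k -> adjacent (flag_of t) (flag_of u).
Proof.
move=> ft fu kd /(differ_atP ft fu kd)[ntu tu].
have half v w : cflag v -> cflag w -> nth 0 v k <> nth 0 w k ->
    (forall i, i < d.+2 -> i != k -> nth 0 v i = nth 0 w i) ->
    ~ flag_of w (phi (nth 0 v k)) /\
    flag_of v `\ phi (nth 0 v k) `<=` flag_of w `\ phi (nth 0 w k).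
  move=> fv fw nvw vw; split.
    move/flag_of_mem; rewrite cflag_nth_lt // => /(_ fw isT).
    by case/(cflag_memE fw) => + _; rewrite cflag_lev // => /esym.
  move=> _ [[a /= av <-] nak]; have [ea la] := cflag_memE fv av.
  have ak : lev a != k by apply: contra_not_neq nak => <-; rewrite ea.
  have eaw : nth 0 w (lev a) = a by rewrite -vw.
  split; first by exists a => //=; rewrite -eaw mem_nth ?cflag_size.
  move=> /= /coding_inj; rewrite cflag_nth_lt // (cflag_lt fv av).
  by move=> /(_ isT isT) h; case/eqP: ak; rewrite h cflag_lev.
have [nt st] := half t u ft fu ntu tu.
have [nu su] := half u t fu ft (nesym ntu) (fun i il ik => esym (tu i il ik)).
exists (phi (nth 0 t k)), (phi (nth 0 u k)); split=> //.
- by exists (nth 0 t k) => //=; rewrite mem_nth ?cflag_size.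
- by exists (nth 0 u k) => //=; rewrite mem_nth ?cflag_size.
- by apply/seteqP.
Qed.

Lemma coded_is_partial_order : is_partial_order P.
Proof.
split=> [F|]; first by have [a an <-] := phiS F; apply/phiL/(tab_refl TBL).
split=> [F G|F G H]; have [a an <-] := phiS F; have [b bn <-] := phiS G.
  move=> /phiL ab /phiL ba; congr phi; apply: tab_anti => //.
    exact: ab.
  exact: ba.
have [c cn <-] := phiS H => /phiL ab /phiL bc; apply/phiL => //.
exact: (tab_trans TBL an bn cn (ab an bn) (bc bn cn)).
Qed.

Lemma coded_strongly_flag_connected : strongly_flag_connected P.
Proof.
move=> Phi Psi /flagP[t ft ->] /flagP[u fu ->].
have [p [tp pu fp ap]] := tab_connected TBL ft fu.
exists (size p), (fun i => flag_of (nth t (t :: p) i)); split=> //.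
- by rewrite -pu (last_nth t).
- move=> i ip.
  have : nth t (t :: p) i \in t :: p by rewrite mem_nth ?ltnS.
  set w := nth _ _ _ => wp.
  have fw : cflag w.
    by move: wp; rewrite inE => /predU1P[->//|/(allP fp)].
  split; first exact: flag_of_flag.
  move=> _ [[a /= at_ <-]] /flag_of_mem; rewrite (cflag_lt ft at_).
  move=> /(_ fu isT) au; have [eat la] := cflag_memE ft at_.
  have [eau _] := cflag_memE fu au.
  exists a => //=; suff <- : nth 0 w (lev a) = a by rewrite mem_nth ?cflag_size.
  move: wp; rewrite inE => /predU1P[->//|/(allP ap)/allP/(_ (lev a))].
  rewrite mem_iota (cflag_size ft) la eat eau eqxx => /(_ isT)/eqP.
  by [].
- move=> i ip; have /(pathP t)/(_ _ ip) := tp; rewrite /coded_adjacent.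
  have fi j : j <= size p -> cflag (nth t (t :: p) j).
    move=> jp; have : nth t (t :: p) j \in t :: p by rewrite mem_nth ?ltnS.
    by rewrite inE => /predU1P[->//|/(allP fp)].
  case/hasP=> k; rewrite mem_iota /= add0n => kd tk.
  rewrite (cflag_size (fi i (ltnW ip))) in kd.
  exact: (differ_adjacent (fi i (ltnW ip)) (fi i.+1 ip) kd).
Qed.

Lemma coded_diamond : diamond_condition P.
Proof.
move=> F G [FG nFG]; have [a an eF] := phiS F; have [b bn eG] := phiS G.
subst F G; rewrite !phiR // => rab; move/phiL: FG => /(_ an bn) ab.
have lab : lev b = (lev a).+2 by move: rab; lia.
rewrite -(tab_diamond TBL an bn ab lab).
set s := filter _ _; have sP c : c \in s ->
    [/\ c < n, lev c = (lev a).+1, le a c & le c b].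
  by rewrite mem_filter mem_iota => /andP[/and3P[/eqP -> -> ->]].
suff -> : [set H | plt (phi a) H /\ plt H (phi b)] = phi @` [set` s].
  apply: card_coded_set; first by rewrite filter_uniq ?iota_uniq.
  by move=> x y /sP[xn _ _ _] /sP[yn _ _ _]; exact: coding_inj.
apply/seteqP; split=> [H|_ [c /= /sP[cn lc ac cb] <-]].
  have [c cn <-] := phiS H => -[[/phiL ac nac] [/phiL cb ncb]].
  have {ac}ac := ac an cn; have {cb}cb := cb cn bn.
  exists c => //=; rewrite mem_filter mem_iota cn ac cb !andbT eqn_leq.
  have /(tab_lev_lt TBL an cn ac) -> : a != c by apply/eqP => e; rewrite e in nac.
  rewrite andbT -ltnS -lab (tab_lev_lt TBL cn bn cb) //.
  by apply/eqP => e; rewrite e in ncb.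
split; split; try exact/phiL.
  by move=> /(coding_inj an cn) e; move: lc; rewrite -e; lia.
by move=> /(coding_inj cn bn) e; move: lc; rewrite e; lia.
Qed.

Theorem coded_is_polytope : is_polytope P d.
Proof.
split.
- exact: coded_is_partial_order.
- split.
    have [a [an la lea]] := tab_bot TBL; exists (phi a); rewrite phiR // la.
    by split=> // G; have [b bn <-] := phiS G; apply/phiL => //; exact: lea.
  have [a [an la lea]] := tab_top TBL; exists (phi a); rewrite phiR // la.
  split; first by lia.
  by move=> G; have [b bn <-] := phiS G; apply/phiL => //; exact: lea.
- move=> F G; have [a an <-] := phiS F; have [b bn <-] := phiS G.
  move=> [/phiL ab nab]; rewrite !phiR //.
  have := tab_lev_lt TBL an bn (ab an bn).
  suff nab' : a != b by move=> /(_ nab'); lia.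
  by apply/eqP => e; rewrite e in nab.
- move=> Phi /flagP[t ft ->]; rewrite -(cflag_size ft).
  apply: card_coded_set (cflag_uniq ft) _ => a b at_ bt.
  exact: coding_inj (cflag_lt ft at_) (cflag_lt ft bt).
- split; [exact: coded_strongly_flag_connected | exact: coded_diamond].
Qed.

End CodedPoset.

(** * Automorphisms of coded polytopes *)

Section CodedAutomorphisms.
Variables (d n : nat) (le : rel nat) (lev : nat -> nat).
Hypothesis TBL : polytope_table d n le lev.
Variables (P : ranked_poset) (phi : nat -> P).
Hypothesis COD : coding n le lev phi.

Local Notation cflag := (coded_flag d n le lev).

Lemma cflag_ends t u : cflag t -> cflag u ->
  nth 0 t 0 = nth 0 u 0 /\ nth 0 t d.+1 = nth 0 u d.+1.
Proof.
have [a [an la lea]] := tab_bot TBL; have [b [bn lb leb]] := tab_top TBL.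
suff h v : cflag v -> nth 0 v 0 = a /\ nth 0 v d.+1 = b.
  by move=> /h[-> ->] /h[-> ->].
move=> fv; have v0n := cflag_nth_lt fv (ltn0Sn _).
have v1n := cflag_nth_lt fv (ltnSn d.+1).
split; first by apply/esym/(tab_same_lev TBL an v0n (lea _ v0n)); rewrite (cflag_lev fv).
by apply/(tab_same_lev TBL v1n bn (leb _ v1n)); rewrite (cflag_lev fv).
Qed.

Lemma differ_range t u k : cflag t -> cflag u -> k < d.+2 ->
  differ_at t u k -> 0 < k <= d.
Proof.
move=> ft fu kd /(differ_atP ft fu kd)[ntu _].
have [e0 e1] := cflag_ends ft fu.
rewrite lt0n -ltnS ltn_neqAle -ltnS kd andbT -negb_or; apply/negP.
by case/orP=> /eqP ek; move: ntu; rewrite ek.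
Qed.

(** By the diamond property a flag has only one adjacent flag for each rank. *)
Lemma differ_unique t u w k : cflag t -> cflag u -> cflag w -> k < d.+2 ->
  differ_at t u k -> differ_at t w k -> u = w.
Proof.
move=> ft fu fw kd dtu; have kr := differ_range ft fu kd dtu.
move: dtu => /(differ_atP ft fu kd)[ntu tu].
move=> /(differ_atP ft fw kd)[ntw tw].
have nthn v i : cflag v -> i < d.+2 -> nth 0 v i < n := @cflag_nth_lt _ _ _ _ v i.
suff uwk : nth 0 u k = nth 0 w k.
  apply: (cflag_eq fu fw) => i id; have [->//|ik] := eqVneq i k.
  by rewrite -tu // tw.
case: k kd kr ntu tu ntw tw => [//|k] kd kr ntu tu ntw tw.
have kd2 : k.+2 < d.+2 by [].
have kd0 : k < d.+2 by exact: ltnW.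
set a := nth 0 t k; set b := nth 0 t k.+2.
have an : a < n by exact: nthn. have bn : b < n by exact: nthn.
have la : lev a = k by rewrite (cflag_lev ft).
have lab : lev b = (lev a).+2 by rewrite !(cflag_lev ft).
have := tab_diamond TBL an bn (cflag_le TBL ft (leqW (leqnSn k)) kd2) lab.
set s := filter _ _ => ss.
have mid v : cflag v -> nth 0 v k = a -> nth 0 v k.+2 = b -> nth 0 v k.+1 \in s.
  move=> fv va vb; rewrite mem_filter mem_iota nthn // la (cflag_lev fv) // eqxx.
  by rewrite -va -vb !(cflag_le TBL fv).
have us : uniq s by rewrite filter_uniq ?iota_uniq.
have ks : k != k.+1 by rewrite neq_ltn ltnSn.
have ks2 : k.+2 != k.+1 by rewrite neq_ltn ltnSn orbT.
have := mid u fu (esym (tu _ kd0 ks)) (esym (tu _ kd2 ks2)).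
have := mid w fw (esym (tw _ kd0 ks)) (esym (tw _ kd2 ks2)).
have := mid t ft erefl erefl.
move: ss us; case: s {mid} => [|x [|y []]] //= _ _; rewrite !inE.
by move=> /orP[]/eqP tx /orP[]/eqP wx /orP[]/eqP ux;
  move: ntu ntw; rewrite tx wx ux.
Qed.

Lemma face_map_codes (f : P -> P) : exists p : nat -> nat,
  forall a, a < n -> p a < n /\ f (phi a) = phi (p a).
Proof.
suff h a : exists b, a < n -> b < n /\ f (phi a) = phi b.
  by have [p pP] := choice h; exists p.
by have [b bn <-] := coding_surj COD (f (phi a)); exists b.
Qed.

Section OneAutomorphism.
Variables (f : P -> P) (p : nat -> nat).
Hypothesis fA : is_automorphism f.
Hypothesis fp : forall a, a < n -> p a < n /\ f (phi a) = phi (p a).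

Lemma automorphism_codes_le a b : a < n -> b < n -> le (p a) (p b) = le a b.
Proof.
move=> an bn; have [pan ea] := fp an; have [pbn eb] := fp bn.
have [_ fle] := fA; have := fle (phi a) (phi b); rewrite ea eb => e.
apply/idP/idP => [/(coding_le COD pan pbn)/e|/(coding_le COD an bn)/e] h.
  exact/(coding_le COD an bn).
exact/(coding_le COD pan pbn).
Qed.

Lemma automorphism_codes_inj a b : a < n -> b < n -> p a = p b -> a = b.
Proof.
move=> an bn e; apply: (coding_inj TBL COD an bn).
have [[g fK _] _] := fA; apply: (can_inj fK).
by have [_ ->] := fp an; have [_ ->] := fp bn; rewrite e.
Qed.

(** Automorphisms preserve levels: along a flag, the levels of the images form a
strictly increasing sequence of d + 2 numbers below d + 2. *)
Lemma automorphism_cflag t : cflag t -> cflag (map p t).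
Proof.
move=> ft; pose g i := lev (p (nth 0 t i)).
have nthn i : i < d.+2 -> nth 0 t i < n := @cflag_nth_lt _ _ _ _ t i ft.
have pn i : i < d.+2 -> p (nth 0 t i) < n by move=> /nthn/fp[].
have lepp i j : i <= j -> j < d.+2 -> le (p (nth 0 t i)) (p (nth 0 t j)).
  move=> ij jd; have id := leq_ltn_trans ij jd.
  by rewrite automorphism_codes_le ?nthn //; apply: (cflag_le TBL ft).
have gm i j : i < j -> j < d.+2 -> g i < g j.
  move=> ij jd; have id := ltn_trans ij jd.
  apply: (tab_lev_lt TBL); rewrite ?pn ?lepp // 1?ltnW //; apply/eqP.
  move=> /automorphism_codes_inj; rewrite !nthn // => /(_ isT isT) e.
  by move: ij; rewrite -(cflag_lev ft id) -(cflag_lev ft jd) e ltnn.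
have gb i : i < d.+2 -> g i <= d.+1.
  have [top [tn lt let_]] := tab_top TBL => id; rewrite -lt.
  by apply: (tab_lev_le TBL (pn _ id) tn); exact/let_/pn.
have gi i : i < d.+2 -> i <= g i.
  elim: i => // i IH id; apply: leq_ltn_trans (IH (ltnW id)) _; exact: gm.
have gi' i : i < d.+2 -> g i <= i.
  move=> id; rewrite -(leq_add2r (d.+1 - i)) subnKC //.
  suff h k : i + k < d.+2 -> g i + k <= g (i + k).
    have e : i + (d.+1 - i) = d.+1 by rewrite subnKC.
    by apply: leq_trans (h _ _) (gb _ _); rewrite e.
  elim: k => [|k IH]; first by rewrite !addn0.
  rewrite !addnS => h; apply: leq_ltn_trans (IH (ltnW h)) _; exact: gm.
apply/and3P; split.
- by apply/allP=> _ /mapP[a /(cflag_lt ft)/fp[pan _] ->].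
- apply/eqP; apply: (@eq_from_nth _ 0).
    by rewrite !size_map (cflag_size ft) size_iota.
  move=> i; rewrite !size_map (cflag_size ft) => id.
  rewrite -map_comp (nth_map 0) ?(cflag_size ft) // nth_iota // add0n.
  by apply/eqP; rewrite eqn_leq gi' ?gi.
- rewrite pairwise_map; apply/(pairwiseP 0) => i j.
  by rewrite !inE (cflag_size ft) => id jd ij; apply: lepp => //; exact: ltnW.
Qed.

Lemma automorphism_flag_of t : cflag t ->
  f @` flag_of phi t = flag_of phi (map p t).
Proof.
move=> ft; apply/seteqP; split=> [_ [_ [a /= at_ <-] <-]|_ [/= _ /mapP[a at_ ->] <-]].
  by have [_ ->] := fp (cflag_lt ft at_); apply/flag_of_in/map_f.
exists (phi a); first exact: flag_of_in.
by have [_ ->] := fp (cflag_lt ft at_).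
Qed.

Lemma automorphism_differ t u k : cflag t -> cflag u -> k < d.+2 ->
  differ_at t u k -> differ_at (map p t) (map p u) k.
Proof.
move=> ft fu kd; have fpt := automorphism_cflag ft.
have fpu := automorphism_cflag fu.
have nthE v i : cflag v -> i < d.+2 -> nth 0 (map p v) i = p (nth 0 v i).
  by move=> fv id; rewrite (nth_map 0) ?(cflag_size fv).
move=> /(differ_atP ft fu kd)[ntu tu].
apply/(differ_atP fpt fpu kd); split=> [|i id ik]; last first.
  by rewrite !nthE // tu.
rewrite !nthE // => /automorphism_codes_inj; rewrite !(cflag_nth_lt ft, cflag_nth_lt fu) //.
by move=> /(_ isT isT).
Qed.

(** An automorphism is determined by the image of one flag: fixing a flag, it
fixes the adjacent flags, hence all flags by connectedness. *)
Lemma automorphism_fixing_flag t : cflag t ->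
  (forall a, a < n -> exists2 u, cflag u & a \in u) ->
  f @` flag_of phi t = flag_of phi t -> forall F, f F = F.
Proof.
move=> ft inflag fft F; have [a an <-] := coding_surj COD F.
have ept : map p t = t.
  apply: (flag_of_inj TBL COD (automorphism_cflag ft) ft).
  by rewrite -automorphism_flag_of.
have [u fu au] := inflag a an.
have [r [tr ru fr _]] := tab_connected TBL ft fu.
have : map p u = u.
  elim: r t ft ept tr ru fr {fft} => [t ft ept _ /= <- //|w r IH t ft ept].
  move=> /= /andP[/hasP[k]]; rewrite mem_iota (cflag_size ft) add0n /= => kd tw.
  move=> wr wu /andP[fw fr]; apply: (IH w) => //.
  apply: (differ_unique ft (automorphism_cflag fw) fw kd _ tw).
  by rewrite -{1}ept; apply: automorphism_differ.
have [eau la] := cflag_memE fu au.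
move/(congr1 (nth 0 ^~ (lev a))); rewrite (nth_map 0) ?(cflag_size fu) // eau.
by have [_ ->] := fp an => ->.
Qed.

End OneAutomorphism.

(** Here the flags are listed, and adj i k is the index of the flag that differs
from the i-th one exactly in position k. *)
Section FlagList.
Variables (flags : seq (seq nat)) (adj : nat -> nat -> nat).
Local Notation fl := (nth [::] flags).
Hypothesis flagsP : forall t, cflag t <-> t \in flags.
Hypothesis flags_uniq : uniq flags.
Hypothesis adjP : forall i k, i < size flags -> 0 < k <= d ->
  adj i k < size flags /\ differ_at (fl i) (fl (adj i k)) k.

Lemma flag_nth i : i < size flags -> cflag (fl i).
Proof. by move=> il; apply/flagsP/mem_nth. Qed.

Lemma listed_flagP Phi : flag Phi <->
  exists2 i, i < size flags & Phi = flag_of phi (fl i).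
Proof.
split=> [/(flagP TBL COD)[t /flagsP tf ->]|[i il ->]].
  by exists (index t flags); rewrite ?index_mem // nth_index.
exact/(flag_of_flag TBL COD)/flag_nth.
Qed.

Lemma listed_flag_inj i j : i < size flags -> j < size flags ->
  flag_of phi (fl i) = flag_of phi (fl j) -> i = j.
Proof.
move=> il jl /(flag_of_inj TBL COD (flag_nth il) (flag_nth jl))/eqP.
by rewrite nth_uniq // => /eqP.
Qed.

Lemma listed_adjacent i j : i < size flags -> j < size flags ->
  adjacent (flag_of phi (fl i)) (flag_of phi (fl j)) ->
  exists2 k, 0 < k <= d & j = adj i k.
Proof.
move=> il jl; have fi := flag_nth il; have fj := flag_nth jl.
move=> /(adjacent_differ TBL COD fi fj)[k kd ij].
have kr := differ_range fi fj kd ij.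
exists k => //; have [al ia] := adjP il kr.
have := differ_unique fi fj (flag_nth al) kd ij ia.
by move=> /eqP; rewrite nth_uniq // => /eqP.
Qed.

(** An automorphism permutes the flags and commutes with the moves to adjacent
flags. *)
Lemma automorphism_index f : is_automorphism f -> exists q : nat -> nat,
  forall i, i < size flags ->
  [/\ q i < size flags, f @` flag_of phi (fl i) = flag_of phi (fl (q i))
    & forall k, 0 < k <= d -> q (adj i k) = adj (q i) k].
Proof.
move=> fA; have [p fp] := face_map_codes f.
pose q i := index (map p (fl i)) flags; exists q => i il.
have qP j : j < size flags -> q j < size flags /\ fl (q j) = map p (fl j).
  move=> /flag_nth/(automorphism_cflag fA fp)/flagsP jf.
  by rewrite /q index_mem nth_index.
have [qil eqi] := qP i il; split=> // [|k kr].
  by rewrite (automorphism_flag_of fp (flag_nth il)) eqi.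
have [ail ia] := adjP il kr; have [aqil qia] := adjP qil kr.
have kd : k < d.+2 by case/andP: kr => _ kd; rewrite ltnS ltnW.
have [qail eqai] := qP _ ail; apply/eqP; rewrite -(nth_uniq [::] qail aqil flags_uniq).
apply/eqP; apply: (differ_unique (flag_nth qil) (flag_nth qail) (flag_nth aqil) kd _ qia).
rewrite eqi eqai; apply: (automorphism_differ fA fp _ _ kd ia); exact: flag_nth.
Qed.

(** The walk from the i-th flag along the moves in w returns to that flag. This
property is invariant under automorphisms. *)
Definition closed_walk (w : seq nat) (i : nat) : bool := foldl adj i w == i.

Lemma walk_lt w i : all (fun k => 0 < k <= d) w -> i < size flags ->
  foldl adj i w < size flags.
Proof.
by elim: w i => //= k w IH i /andP[kr wr] il; apply: IH; case: (adjP il kr).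
Qed.

Lemma automorphism_closed_walk f w i j : is_automorphism f ->
  all (fun k => 0 < k <= d) w -> i < size flags -> j < size flags ->
  f @` flag_of phi (fl i) = flag_of phi (fl j) ->
  closed_walk w i = closed_walk w j.
Proof.
move=> fA wr il jl fij; have [q qP] := automorphism_index fA.
have qi : q i = j.
  have [qil e _] := qP i il; apply: (listed_flag_inj qil jl).
  by rewrite -e.
have qw u k : all (fun k => 0 < k <= d) u -> k < size flags ->
    q (foldl adj k u) = foldl adj (q k) u.
  elim: u k => //= m u IH k /andP[mr ur] kl; rewrite IH //.
    by have [_ _ ->] := qP k kl.
  by case: (adjP kl mr).
rewrite /closed_walk -qi -qw //; apply/eqP/eqP => [->//|e].
have wl := walk_lt wr il.
have [_ e1 _] := qP i il; have [_ e2 _] := qP _ wl.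
apply: (listed_flag_inj wl il).
have [[g fK _] _] := fA.
apply: (image_injective (can_inj fK)).
by rewrite e1 e2 e.
Qed.

End FlagList.
End CodedAutomorphisms.

(** * Realizations and their symmetries *)

Section RealizedFaces.
Variables (R : realType) (m : nat) (P : ranked_poset) (beta : P -> 'rV[R]_m).

Lemma rface_map_inj (f : 'rV[R]_m -> 'rV[R]_m) j :
  injective f -> injective (@rface_map R m f j).
Proof. by move=> fI; elim: j => //= j IH; exact: image_injective. Qed.

Lemma euclid_isometry_inj (f : 'rV[R]_m -> 'rV[R]_m) :
  euclid_isometry f -> injective f.
Proof.
move=> fiso x y e; have := fiso x y; rewrite e /euclid_dist.
have s0 z : (\sum_(i < m) ((z : 'rV[R]_m) 0 i - z 0 i) ^+ 2 = 0)%R.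
  by rewrite big1 // => i _; rewrite subrr expr0n.
rewrite s0 sqrtr0 => /esym/eqP; rewrite sqrtr_eq0 => h.
have sq0 : (\sum_(i < m) (x 0 i - y 0 i) ^+ 2 == 0)%R.
  by rewrite eq_le h sumr_ge0 // => i _; exact: sqr_ge0.
apply/rowP => i; apply/eqP; rewrite -subr_eq0 -(sqrf_eq0 (_ - _)%R).
move: sq0; rewrite psumr_eq0; last by move=> k _; exact: sqr_ge0.
by move/allP/(_ i); rewrite mem_index_enum => /(_ isT).
Qed.

Lemma realize_ple j F G : faithful_realization beta ->
  prank F = Posz j -> prank G = Posz j.+1 ->
  realize beta j.+1 G (realize beta j F) <-> ple F G.
Proof.
move=> fb rF rG; split=> [[H /= [rH HG] e]|FG]; last by exists F.
by rewrite -(fb j H F rH rF e).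
Qed.

(** A face map that is compatible with a map of the ambient space carries
realized families of faces to each other. *)
Lemma equivariant_maps_realized (f : 'rV[R]_m -> 'rV[R]_m) (h : P -> P)
    (A B : set P) :
  (forall F, prank (h F) = prank F) ->
  (forall j F, prank F = Posz j ->
     realize beta j (h F) = rface_map f (realize beta j F)) ->
  h @` A = B -> maps_realized beta f A B.
Proof.
move=> hr hf <- j; apply/seteqP; split=> [_ [_ [F [AF rF] <-] <-]|].
  exists (h F); last exact: hf.
  by split; [exists F | rewrite hr].
move=> _ [_ [[F AF <-] rF] <-]; rewrite hr in rF.
by rewrite hf //; exists (realize beta j F) => //; exists F.
Qed.

End RealizedFaces.

Section CodedRealization.
Variables (d n : nat) (le : rel nat) (lev : nat -> nat).
Hypothesis TBL : polytope_table d n le lev.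
Variables (P : ranked_poset) (phi : nat -> P).
Hypothesis COD : coding n le lev phi.
Variables (R : realType) (m : nat) (beta : P -> 'rV[R]_m).

Lemma prank_lev a j : a < n -> prank (phi a) = Posz j -> lev a = j.+1.
Proof. by move=> an; rewrite (coding_rank COD an); lia. Qed.

Lemma lev_prank a j : a < n -> lev a = j.+1 -> prank (phi a) = Posz j.
Proof. by move=> an; rewrite (coding_rank COD an); lia. Qed.

(** Faithfulness propagates from the vertices upwards when each face of positive
rank is determined by the faces of the next lower rank that it contains. *)
Lemma coded_faithful :
  (forall F G : P, prank F = Posz 0 -> prank G = Posz 0 -> beta F = beta G -> F = G) ->
  (forall a b, a < n -> b < n -> lev a = lev b -> 1 < lev a ->
     (forall c, c < n -> (lev c).+1 = lev a -> le c a = le c b) -> a = b) ->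
  faithful_realization beta.
Proof.
move=> b0 tabF; elim=> [|j IH] F G; first exact: b0.
have [a an <-] := coding_surj COD F; have [b bn <-] := coding_surj COD G.
have sub x y : x < n -> y < n -> lev x = j.+2 -> lev y = j.+2 ->
    realize beta j.+1 (phi x) = realize beta j.+1 (phi y) ->
    forall c, c < n -> (lev c).+1 = lev x -> le c x -> le c y.
  move=> xn yn lx ly e c cn; rewrite lx => -[lc] /(coding_le COD cn xn) cx.
  have rc := lev_prank cn lc.
  have : realize beta j.+1 (phi x) (realize beta j (phi c)) by exists (phi c).
  rewrite e => -[H /= [rH Hy]] /(IH H (phi c) rH rc) eH; rewrite eH in Hy.
  exact/(coding_le COD cn yn).
move=> /(prank_lev an) la /(prank_lev bn) lb e; congr phi.
apply: tabF => //; rewrite ?la ?lb // => c cn lc.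
by apply/idP/idP; apply: sub; rewrite ?la ?lb.
Qed.

(** Incidence is generated by incidence between consecutive ranks. *)
Lemma le_of_covers (r : rel nat) :
  (forall a, a < n -> r a a) ->
  (forall a b c, a < n -> b < n -> c < n -> r a b -> r b c -> r a c) ->
  (forall a b, a < n -> b < n -> lev b = (lev a).+1 -> le a b -> r a b) ->
  forall a b, a < n -> b < n -> le a b -> r a b.
Proof.
move=> rr rt rc a b an bn; have [k] := ubnP (lev b - lev a).
elim: k => // k IH in a an * => lk ab.
have := tab_lev_le TBL an bn ab; rewrite leq_eqVlt => /predU1P[eab|].
  by rewrite (tab_same_lev TBL an bn ab eab) rr.
rewrite leq_eqVlt => /predU1P[eab|lt]; first exact: rc.
have [c [cn lc ac cb]] := tab_dense TBL an bn ab lt.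
apply: (rt a c b) => //; first exact: rc.
by apply: IH => //; rewrite lc; lia.
Qed.

(** A symmetry permutes the realized faces of each rank. By faithfulness this
defines a bijection on faces of each rank; it preserves incidence between
consecutive ranks, which is membership of realized faces, and hence all
incidences. *)
Lemma symmetry_automorphism (f : 'rV[R]_m -> 'rV[R]_m) : injective f ->
  faithful_realization beta -> maps_realized beta f setT setT ->
  exists h : P -> P, [/\ is_automorphism h, forall F, prank (h F) = prank F &
    forall j F, prank F = Posz j ->
      realize beta j (h F) = rface_map f (realize beta j F)].
Proof.
move=> fI fb fM.
pose X F G := prank G = prank F /\ forall j, prank F = Posz j ->
  realize beta j G = rface_map f (realize beta j F).
have rankP (F : P) : prank F = (-1)%R \/ exists j, prank F = Posz j.
  have [a an <-] := coding_surj COD F; rewrite (coding_rank COD an).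
  by case: (lev a) => [|j]; [left|right; exists j; lia].
have bot (F G : P) : prank F = (-1)%R -> prank G = (-1)%R -> F = G.
  have [a an <-] := coding_surj COD F; have [b bn <-] := coding_surj COD G.
  have [x [xn lx lex]] := tab_bot TBL.
  rewrite (coding_rank COD an) (coding_rank COD bn) => ra rb; congr phi.
  have la : lev a = 0 by lia. have lb : lev b = 0 by lia.
  by rewrite -(tab_same_lev TBL xn an (lex _ an)) ?lx //
    -(tab_same_lev TBL xn bn (lex _ bn)) ?lx.
have [h hX] : {h : P -> P & forall F, X F (h F)}.
  apply: choice => F; have [r1|[j rF]] := rankP F.
    by exists F; split=> // j; rewrite r1.
  have : realized beta setT (rface_map f (realize beta j F)).
    by rewrite -(fM j); exists (realize beta j F) => //; exists F.
  case=> G [_ rG] e; exists G; split; first by rewrite rG rF.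
  by move=> i; rewrite rF => -[<-].
have hr F : prank (h F) = prank F by case: (hX F).
have hf j F : prank F = Posz j ->
    realize beta j (h F) = rface_map f (realize beta j F).
  by move=> rF; case: (hX F) => _; exact.
have hI : injective h.
  move=> F G e; have [r1|[j rF]] := rankP F.
    by apply: bot => //; rewrite -hr -e hr.
  have rG : prank G = Posz j by rewrite -hr -e hr.
  apply: (fb j) => //; apply: (rface_map_inj fI).
  by rewrite -!hf // e.
have hS G : exists F, h F = G.
  have [r1|[j rG]] := rankP G; first by exists G; apply: bot; rewrite ?hr.
  have : realized beta setT (realize beta j G) by exists G.
  rewrite -(fM j) => -[_ [F [_ rF] <-] e]; exists F.
  by apply: (fb j); rewrite ?hr ?hf.
exists h; split=> //; split.
  have [g gP] := choice hS; exists g => // F; exact: hI.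
have [p hp] := face_map_codes COD h.
(* On codes, h is a level-preserving bijection that respects covers both ways. *)
have plev a : a < n -> lev (p a) = lev a.
  move=> an; have [pan e] := hp a an; have := hr (phi a).
  by rewrite e !(coding_rank COD) //; lia.
have cov a b : a < n -> b < n -> lev b = (lev a).+1 -> le (p a) (p b) = le a b.
  move=> an bn lab; have [pan ea] := hp a an; have [pbn eb] := hp b bn.
  case ela: (lev a) => [|j].
    have [x [xn lx lex]] := tab_bot TBL.
    have xa : x = a by apply: (tab_same_lev TBL) (lex _ an) _; rewrite ?ela.
    have xpa : x = p a by apply: (tab_same_lev TBL) (lex _ pan) _; rewrite ?plev ?ela.
    by rewrite -xpa -xa !lex.
  rewrite ela in lab; have ra := lev_prank an ela; have rb := lev_prank bn lab.
  have E : ple (phi (p a)) (phi (p b)) <-> ple (phi a) (phi b).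
    have rha : prank (h (phi a)) = Posz j by rewrite hr.
    have rhb : prank (h (phi b)) = Posz j.+1 by rewrite hr.
    have : realize beta j.+1 (h (phi b)) (realize beta j (h (phi a))) =
           realize beta j.+1 (phi b) (realize beta j (phi a)).
      by rewrite (hf _ _ ra) (hf _ _ rb); exact: (image_inj (rface_map_inj fI)).
    rewrite -ea -eb => e; split.
      by move/(realize_ple fb rha rhb); rewrite e => /(realize_ple fb ra rb).
    by move/(realize_ple fb ra rb); rewrite -e => /(realize_ple fb rha rhb).
  apply/idP/idP => [/(coding_le COD pan pbn)/E|/(coding_le COD an bn)/E] hh.
    exact/(coding_le COD an bn).
  exact/(coding_le COD pan pbn).
have pn a : a < n -> p a < n by case/hp.
have ple_ a b : a < n -> b < n -> le (p a) (p b) <-> le a b.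
  move=> an bn; split; last first.
    move: a b an bn; apply: (le_of_covers (r := fun a b => le (p a) (p b))).
    - by move=> a an; apply/(tab_refl TBL)/pn.
    - move=> a b c an bn cn; apply: (tab_trans TBL); exact: pn.
    - by move=> a b an bn lab; rewrite cov.
  have [g gP] := choice hS; have [q gq] := face_map_codes COD g.
  have pq x : x < n -> q x < n /\ p (q x) = x.
    move=> xn; have [qxn e] := gq x xn; split=> //.
    have [pqn e'] := hp (q x) qxn; apply: (coding_inj TBL COD) => //.
    by rewrite -e' -e gP.
  have qp x : x < n -> q (p x) = x.
    move=> xn; have [qn e] := pq _ (pn _ xn); apply: (coding_inj TBL COD) => //.
    by apply: hI; have [_ ->] := hp _ qn; have [_ ->] := hp _ xn; rewrite e.
  have : forall a b, a < n -> b < n -> le a b -> le (q a) (q b).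
    apply: (le_of_covers (r := fun a b => le (q a) (q b))).
    - by move=> x xn; apply/(tab_refl TBL); case: (pq x xn).
    - move=> x y z /pq[xn _] /pq[yn _] /pq[zn _]; exact: (tab_trans TBL).
    - move=> x y xn yn lxy xy; have [qxn ex] := pq x xn.
      have [qyn ey] := pq y yn; have := cov _ _ qxn qyn.
      by rewrite -(plev _ qxn) -(plev _ qyn) ex ey => <-.
  by move=> /(_ _ _ (pn _ an) (pn _ bn)); rewrite !qp.
move=> F G; have [a an <-] := coding_surj COD F.
have [b bn <-] := coding_surj COD G.
have [pan ->] := hp a an; have [pbn ->] := hp b bn.
split=> [/(coding_le COD pan pbn)|/(coding_le COD an bn)] hh.
  exact/(coding_le COD an bn)/ple_.
exact/(coding_le COD pan pbn)/ple_.
Qed.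

Lemma automorphism_flag (Q : ranked_poset) (h : Q -> Q) (Phi : set Q) :
  is_automorphism h -> flag Phi -> flag (h @` Phi).
Proof.
move=> [[g hK gK] hle] [cPhi mPhi]; split=> [_ _ [F PF <-] [G PG <-]|Psi cPsi sub].
  by case: (cPhi F G PF PG) => /hle; [left|right].
apply/seteqP; split=> // F PsiF; exists (g F); last exact: gK.
rewrite -(mPhi (g @` Psi)); first by exists F.
  move=> _ _ [F' PF' <-] [G' PG' <-].
  by case: (cPsi F' G' PF' PG') => h'; [left|right]; apply/hle; rewrite !gK.
by move=> G PG; exists (h G); [apply: sub; exists G | exact: hK].
Qed.

(** A symmetry of a faithful realization acts on flags as an automorphism. *)
Lemma same_geometric_aut Phi Psi : faithful_realization beta ->
  flag Phi -> flag Psi ->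
  same_geometric_orbit beta Phi Psi -> same_aut_orbit Phi Psi.
Proof.
move=> fb fPhi fPsi [f [[fiso fM] fPP]].
have fI := euclid_isometry_inj fiso.
have [h [hA hr hf]] := symmetry_automorphism fI fb fM.
exists h; split=> //; have [_ mx] := automorphism_flag hA fPhi.
apply/esym/mx; first by case: fPsi.
move=> _ [F PF <-]; have [a an eF] := coding_surj COD F.
case la: (lev a) => [|j].
  have [b [bn lb Pb]] := flag_levels TBL COD fPsi (ltn0Sn d.+1).
  suff -> : h F = phi b by [].
  have [c cn ec] := coding_surj COD (h F); rewrite -ec; congr phi.
  have lc : lev c = 0.
    have := hr F; rewrite -ec -eF !(coding_rank COD) // la; lia.
  have [x [xn lx lex]] := tab_bot TBL.
  by rewrite -(tab_same_lev TBL xn cn (lex _ cn)) ?lx //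
    -(tab_same_lev TBL xn bn (lex _ bn)) ?lx.
have rF : prank F = Posz j by rewrite -eF; exact: lev_prank.
have : realized beta Psi (rface_map f (realize beta j F)).
  by rewrite -(fPP j); exists (realize beta j F) => //; exists F.
case=> G [PG rG]; rewrite -hf // => e.
by rewrite -(fb j G (h F) rG _ e) // hr.
Qed.

End CodedRealization.

(** * Polygons, saturated chains and connectedness of flags *)

Lemma card_eq_of_eq (T U : Type) (A B : set T) (C : set U) :
  B = A -> A #= C -> B #= C.
Proof. by move=> ->. Qed.

(** The Schlaefli type from a table: each face of rank 2 comes with the lists v
and e of its vertices and edges in cyclic order, the j-th edge joining the
vertices j and j + 1. *)
Lemma coded_schlafli (d n : nat) (le : rel nat) (lev : nat -> nat)
    (P : ranked_poset) (phi : nat -> P) (p q r : nat) :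
  polytope_table d n le lev -> coding n le lev phi ->
  (forall a, a < n -> lev a = 3 -> exists v e : seq nat,
     [/\ uniq v, uniq e, perm_eq v [seq c <- iota 0 n | (lev c == 1) && le c a],
         perm_eq e [seq c <- iota 0 n | (lev c == 2) && le c a]
       & [/\ size v = p, size e = p & forall i j, i < p -> j < p ->
         le (nth 0 v i) (nth 0 e j) = (i == j) || (i == j.+1 %% p)]]) ->
  (forall a b, a < n -> b < n -> lev a = 1 -> lev b = 4 -> le a b ->
     size [seq c <- iota 0 n | [&& lev c == 3, le a c & le c b]] = q) ->
  (forall a, a < n -> lev a = 2 ->
     size [seq c <- iota 0 n | (lev c == 4) && le a c] = r) ->
  schlafli_type P p q r.
Proof.
move=> TBL COD poly verts edges.
have filt (Q : pred nat) : [set F : P | exists c, [/\ c < n, Q c & phi c = F]] #=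
    `I_(size [seq c <- iota 0 n | Q c]).
  have -> : [set F : P | exists c, [/\ c < n, Q c & phi c = F]] =
      phi @` [set` [seq c <- iota 0 n | Q c]].
    apply/seteqP; split=> [_ [c [cn Qc <-]]|F [c /=]].
      by exists c; rewrite //= mem_filter Qc mem_iota.
    by rewrite mem_filter mem_iota => /andP[Qc cn] <-; exists c.
  apply: card_coded_set; first by rewrite filter_uniq ?iota_uniq.
  move=> a b; rewrite !mem_filter !mem_iota => /andP[_ an] /andP[_ bn] e.
  exact: (coding_inj TBL COD an bn e).
split.
- move=> F; have [a an <-] := coding_surj COD F => /(prank_lev COD an) la.
  have [v [e [uv ue pv pe [sv se inc]]]] := poly a an la.
  split; first exact: (lev_prank COD an).
  have faces (s : seq nat) k : size s = p -> uniq s ->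
      perm_eq s [seq c <- iota 0 n | (lev c == k.+1) && le c a] ->
      (forall i, i < p -> nth 0 s i < n) /\
      injective (fun i : 'I_p => phi (nth 0 s i)) /\
      range (fun i : 'I_p => phi (nth 0 s i)) =
        [set G | prank G = Posz k /\ ple G (phi a)].
    move=> ss us ps; have memE c : c \in s -> [/\ c < n, lev c = k.+1 & le c a].
      rewrite (perm_mem ps) mem_filter mem_iota.
      by case/andP=> /andP[/eqP-> ->].
    have nn i : i < p -> nth 0 s i < n.
      by move=> ip; case: (memE (nth 0 s i)); rewrite ?mem_nth ?ss.
    split=> //; split.
      move=> i j /(coding_inj TBL COD (nn _ (ltn_ord i)) (nn _ (ltn_ord j)))/eqP.
      by rewrite nth_uniq ?ss // => /eqP/val_inj.
    apply/seteqP; split=> [_ [i _ <-]|G [rG lG]].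
      have [cn lc ca] := memE (nth 0 s i) (mem_nth 0 (eq_ind_r (fun x => i < x) (ltn_ord i) ss)).
      by split; [exact: (lev_prank COD cn) | exact/(coding_le COD cn an)].
    have [c cn ec] := coding_surj COD G; rewrite -ec in rG lG *.
    have cs : c \in s.
      have lc := prank_lev COD cn rG.
      have ca : le c a by apply/(coding_le COD cn an).
      by rewrite (perm_mem ps) mem_filter mem_iota cn lc ca eqxx.
    have ip : index c s < p by rewrite -ss index_mem.
    by exists (Ordinal ip) => //=; rewrite nth_index.
  have [vn [vI vR]] := faces v 0 sv uv pv.
  have [en [eI eR]] := faces e 1 se ue pe.
  exists (fun i => phi (nth 0 v i)), (fun i => phi (nth 0 e i)); split=> // i j.
  split=> [/(coding_le COD (vn _ (ltn_ord i)) (en _ (ltn_ord j)))|h].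
    by rewrite inc // => /orP[]/eqP h; [left|right]; apply: val_inj.
  apply/(coding_le COD (vn _ (ltn_ord i)) (en _ (ltn_ord j))); rewrite inc //.
  by case: h => [->|->]; rewrite /= eqxx ?orbT.
- move=> V K; have [a an <-] := coding_surj COD V.
  have [b bn <-] := coding_surj COD K.
  move=> /(prank_lev COD an) la /(prank_lev COD bn) lb /(coding_le COD an bn) ab.
  rewrite -(verts a b an bn la lb ab).
  apply: (card_eq_of_eq _ (filt (fun c => [&& lev c == 3, le a c & le c b]))).
  apply/seteqP; split=> F; last first.
    case=> c [cn /and3P[/eqP lc ac cb] <-]; split.
    - exact: (lev_prank COD cn).
    - exact/(coding_le COD an cn).
    - exact/(coding_le COD cn bn).
  have [c cn <-] := coding_surj COD F => -[/(prank_lev COD cn) lc].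
  move=> /(coding_le COD an cn) ac /(coding_le COD cn bn) cb.
  by exists c; rewrite lc ac cb.
- move=> E; have [a an <-] := coding_surj COD E => /(prank_lev COD an) la.
  rewrite -(edges a an la).
  apply: (card_eq_of_eq _ (filt (fun c => (lev c == 4) && le a c))).
  apply/seteqP; split=> F; last first.
    case=> c [cn /andP[/eqP lc ac] <-]; split; first exact: (lev_prank COD cn).
    exact/(coding_le COD an cn).
  have [c cn <-] := coding_surj COD F => -[/(prank_lev COD cn) lc].
  by move=> /(coding_le COD an cn) ac; exists c; rewrite lc ac.
Qed.

Section Chains.
Variables (d n : nat) (le : rel nat) (lev : nat -> nat).
Local Notation cflag := (coded_flag d n le lev).

(** The face b covers a: it is incident with a and one level higher. *)
Definition cover_rel : rel nat :=
  fun a b => [&& b < n, le a b & lev b == (lev a).+1].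

(** The saturated chains with k steps above a. *)
Fixpoint chains_from (k a : nat) : seq (seq nat) :=
  if k is k'.+1 then
    flatten [seq [seq a :: s | s <- chains_from k' b]
            | b <- [seq b <- iota 0 n | cover_rel a b]]
  else [:: [:: a]].

Lemma chains_fromP k a t : reflect
  (exists s, [/\ t = a :: s, size s = k & path cover_rel a s])
  (t \in chains_from k a).
Proof.
elim: k a t => [|k IH] a t /=.
  rewrite inE; apply: (iffP eqP) => [->|[s [-> /size0nil -> _]] //].
  by exists [::].
apply: (iffP flatten_mapP) => [[b]|[s [-> ss]]].
  rewrite mem_filter => /andP[ab _] /mapP[s /IH[s' [-> ss ps]] ->].
  by exists (b :: s'); rewrite /= ss ab.
case: s ss => //= b s [ss] /andP[ab ps]; exists b.
  by rewrite mem_filter ab mem_iota; case/and3P: ab.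
by apply: map_f; apply/IH; exists s.
Qed.

(** The flags are the saturated chains of d + 1 steps from the least face, which
has the code 0. *)
Lemma coded_flagE :
  (forall a b c, a < n -> b < n -> c < n -> le a b -> le b c -> le a c) ->
  0 < n -> lev 0 = 0 -> (forall a, a < n -> lev a = 0 -> a = 0) ->
  forall t, cflag t <-> t \in chains_from d.+1 0.
Proof.
move=> letr n0 l0 l0u t.
have pathE a s : a < n -> path cover_rel a s = [&& all (gtn n) s,
    map lev s == iota (lev a).+1 (size s) & path le a s].
  elim: s a => //= b s IH a an; rewrite /cover_rel eqseq_cons /=.
  case bn: (b < n) => //=; rewrite IH //.
  case: (altP (lev b =P _)) => [->|_]; last by rewrite !(andbF, andFb).
  by rewrite andbT /=; case: (le a b); rewrite /= ?andbF.
have letr' : {in gtn n & &, transitive le}.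
  by move=> y x z; rewrite !inE => yn xn zn; exact: letr.
split=> [ft|/chains_fromP[s [-> ss ps]]].
  apply/chains_fromP; case/and3P: (ft) => an lt pt.
  case: t ft an lt pt => // a s ft /= /andP[an sn]; rewrite eqseq_cons.
  case/andP=> /eqP la ls /andP[as_ pw]; have ea := l0u a an la.
  exists s; rewrite -ea; split=> //.
    by rewrite -(size_map lev) (eqP ls) /= size_iota.
  rewrite pathE // sn la -{1}(size_map lev) (eqP ls) /= size_iota eqxx /=.
  have := sorted_pairwise_in letr' (s := a :: s); rewrite /= an sn => -> //.
  by rewrite as_.
move: ps; rewrite pathE // => /and3P[sn ls ps].
rewrite l0 in ls; rewrite /coded_flag -ss /= n0 sn l0 eqseq_cons /= ls.
have := sorted_pairwise_in letr' (s := 0 :: s); rewrite /= n0 sn => <- //.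
Qed.

End Chains.

Section Descent.
Variables (d n : nat) (le : rel nat) (lev : nat -> nat).
Variables (flags : seq (seq nat)) (adj : nat -> nat -> nat).
Local Notation cflag := (coded_flag d n le lev).
Local Notation fl := (nth [::] flags).
Hypothesis flagsP : forall t, cflag t <-> t \in flags.
Hypothesis adjP : forall i k, i < size flags -> 0 < k <= d ->
  adj i k < size flags /\ differ_at (fl i) (fl (adj i k)) k.
Hypothesis ends : forall t, cflag t -> nth 0 t 0 = 0 /\ nth 0 t d.+1 = n.-1.

(** A distance to a root that decreases along some move in K, where each class
of flags with the same faces outside K has only one root. *)
Definition descends (K : seq nat) (D : nat -> nat) : Prop :=
  (forall i, i < size flags ->
     D i = 0 \/ exists2 k, k \in K & D (adj i k) < D i) /\
  (forall i j, i < size flags -> j < size flags -> D i = 0 -> D j = 0 ->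
     (forall k, 0 < k <= d -> k \notin K -> nth 0 (fl i) k = nth 0 (fl j) k) ->
     i = j).

(** Two flags t and u are linked without leaving their common faces: with K the
positions where they differ, descend from both along moves in K; the two roots
agree off K and so coincide. *)
Lemma connected_by_descent :
  (forall K, subseq K (iota 1 d) -> exists D, descends K D) ->
  forall t u, cflag t -> cflag u ->
  exists p, [/\ path coded_adjacent t p, last t p = u,
    all cflag p & all (agree_where t u) p].
Proof.
move=> desc t u ft fu.
pose K := [seq k <- iota 1 d | nth 0 t k != nth 0 u k].
have KP k : k \in K -> 0 < k <= d.
  by rewrite mem_filter mem_iota add1n ltnS => /andP[].
have [D [Ddec Droot]] := desc K (filter_subseq _ _).
pose e : rel (seq nat) := fun x y =>
  [&& cflag x, cflag y & has (differ_at x y) K].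
have e_sym x y : e x y = e y x.
  have h z w : e z w -> e w z.
    case/and3P=> fz fw /hasP[k kK zw]; apply/and3P; split=> //.
    apply/hasP; exists k => //; move: zw; rewrite /differ_at.
    rewrite (cflag_size fz) (cflag_size fw) eq_sym => /andP[-> /allP h].
    by rewrite andTb; apply/allP=> i /h; rewrite [nth 0 z i == _]eq_sym.
  by apply/idP/idP; exact: h.
have off x y : e x y -> forall i, i < d.+2 -> i \notin K -> nth 0 x i = nth 0 y i.
  case/and3P=> fx _ /hasP[k kK /andP[_ /allP h]] i id iK.
  have := h i; rewrite (cflag_size fx) mem_iota id => /(_ isT)/orP[/eqP ik|/eqP//].
  by rewrite -ik (negPf iK) in kK.
have offp x p : path e x p -> forall y, y \in p ->
    cflag y /\ forall i, i < d.+2 -> i \notin K -> nth 0 x i = nth 0 y i.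
  elim: p x => //= z p IH x /andP[xz zp] y; rewrite inE => /predU1P[->|yp].
    by split; [case/and3P: xz | exact: off].
  have [fy h] := IH z zp y yp; split=> // i id iK.
  by rewrite (off x z) // h.
have down i : i < size flags -> exists j p, [/\ j < size flags, D j = 0,
    path e (fl i) p & last (fl i) p = fl j].
  have [m] := ubnP (D i); elim: m i => // m IH i Di il.
  have [D0|[k kK Dk]] := Ddec i il; first by exists i, [::].
  have [al ia] := adjP il (KP k kK).
  have [|j [p [jl Dj pp lp]]] := IH (adj i k) _ al.
    by apply: leq_trans Dk _.
  exists j, (fl (adj i k) :: p); split=> //=; rewrite pp andbT.
  apply/and3P; split; try exact/flagsP/mem_nth.
  by apply/hasP; exists k.
have [tl ul] : index t flags < size flags /\ index u flags < size flags.
  by rewrite !index_mem; split; apply/flagsP.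
have [j1 [p1 [j1l D1 pp1 lp1]]] := down _ tl.
have [j2 [p2 [j2l D2 pp2 lp2]]] := down _ ul.
rewrite (nth_index _ (proj1 (flagsP _) ft)) in pp1 lp1.
rewrite (nth_index _ (proj1 (flagsP _) fu)) in pp2 lp2.
have same x p y : cflag x -> path e x p -> last x p = y ->
    forall i, i < d.+2 -> i \notin K -> nth 0 x i = nth 0 y i.
  move=> fx xp <- i id iK; case: (lastP p) xp => [//|q z] xp.
  rewrite last_rcons; apply: (proj2 (offp x _ xp z _)) => //.
  by rewrite mem_rcons mem_head.
have tu i : i < d.+2 -> i \notin K -> nth 0 t i = nth 0 u i.
  move=> id; rewrite mem_filter mem_iota add1n ltnS.
  case: (posnP i) => [->|i0] /=.
    by have [-> _] := ends ft; have [-> _] := ends fu.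
  move: id; rewrite ltnS leq_eqVlt ltnS => /predU1P[->|->].
    by have [_ ->] := ends ft; have [_ ->] := ends fu.
  by rewrite andbT negbK => /eqP.
have j12 : j1 = j2.
  apply: Droot => // k /andP[_ kd] kK; have kd2 : k < d.+2 by rewrite ltnS ltnW.
  by rewrite -(same _ _ _ ft pp1 lp1) // -(same _ _ _ fu pp2 lp2) // tu.
pose p := p1 ++ rev (belast u p2).
have tp : path e t p.
  rewrite cat_path pp1 lp1 j12 -lp2 rev_path -(eq_path (e := e)).
    by rewrite pp2.
  by move=> x y; exact: e_sym.
exists p; split.
- apply: sub_path tp => x y /and3P[fx _ /hasP[k kK xy]].
  apply/hasP; exists k => //; rewrite mem_iota (cflag_size fx) /=.
  by case/andP: (KP k kK) => _ kd; rewrite ltnS ltnW.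
- rewrite last_cat; case: (p2) pp2 lp2 => [|z q] _ /=; last first.
    by rewrite rev_cons last_rcons.
  by rewrite lp1 j12.
- by apply/allP=> y /(offp _ _ tp)[].
- apply/allP=> y /(offp _ _ tp)[fy h]; apply/allP=> i.
  rewrite mem_iota (cflag_size ft) /= => id; apply/implyP => tui.
  rewrite eq_sym (h i) // mem_filter negb_and.
  by rewrite tui.
Qed.

End Descent.

(** * A combinatorial model of the cube *)

(** The elements of l in the order of U: a normal form for subsets of U. *)
Definition listing (T : eqType) (U l : seq T) : seq T := [seq x <- U | x \in l].

(** What is reached from x0 by at most m applications of the maps s k, k in
gens. *)
Definition closure_by (T : eqType) (s : nat -> T -> T) (gens : seq nat)
    (m : nat) (x0 : T) : seq T :=
  iter m (fun L => undup (L ++ [seq s k x | k <- gens, x <- L])) [:: x0].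

(** All lists of length m with entries in s. *)
Fixpoint words_over (T : Type) (s : seq T) (m : nat) : seq (seq T) :=
  if m is m'.+1 then [seq x :: w | x <- s, w <- words_over s m'] else [:: [::]].

Lemma mem_words_over (T : eqType) (s : seq T) m (w : seq T) :
  size w = m -> all (mem s) w -> w \in words_over s m.
Proof.
elim: m w => [|m IH] [|x w] // [sw] /andP[xs ws].
by apply: (@allpairs_f _ _ _ cons); [exact: xs | exact: IH].
Qed.

Definition bools : seq bool := [:: false; true].

(** A vertex is coded by four signs, where true stands for -1. An edge is coded
by the list of its two vertices, an octagon by the list of its edges, a facet
by the list of its octagons. Each list follows a fixed order, so that equal
sets have equal codes. All tables are stored in normal form. *)
Definition vertex_codes : seq (seq bool) := Eval vm_compute in words_over bools 4.

Definition base_vertex_code : seq bool := nseq 4 false.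

Definition flip (j : nat) (x : seq bool) : seq bool :=
  set_nth false x j (~~ nth false x j).

(** The action of sigma_(k+1) on vertices, and below on the other faces. *)
Definition turn_vertex (k : nat) (x : seq bool) : seq bool :=
  let b := nth false x in
  match k with
  | 0 => [:: b 1; b 2; b 3; ~~ b 0]
  | 1 => [:: b 3; b 0; b 2; b 1]
  | _ => [:: b 0; b 2; b 3; b 1]
  end.

Definition turn_edge k (e : seq (seq bool)) : seq (seq bool) :=
  listing vertex_codes (map (turn_vertex k) e).

Definition edge_codes : seq (seq (seq bool)) := Eval vm_compute in
  undup [seq listing vertex_codes [:: x; flip j x] | x <- vertex_codes, j <- iota 0 4].

Definition turn_octagon k (c : seq (seq (seq bool))) : seq (seq (seq bool)) :=
  listing edge_codes (map (turn_edge k) c).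

(** The images of the base vertex under the powers of sigma_1. *)
Definition petrie_code (k : nat) : seq bool :=
  iter k (turn_vertex 0) base_vertex_code.

Definition base_octagon_code : seq (seq (seq bool)) := Eval vm_compute in
  listing edge_codes
    [seq listing vertex_codes [:: petrie_code k; petrie_code k.+1] | k <- iota 0 8].

Definition octagon_codes : seq (seq (seq (seq bool))) := Eval vm_compute in
  closure_by turn_octagon [:: 0; 1; 2] 6 base_octagon_code.

Definition turn_facet k (f : seq (seq (seq (seq bool)))) :=
  listing octagon_codes (map (turn_octagon k) f).

(** The base facet consists of the images of the base octagon under sigma_1 and
sigma_2. *)
Definition base_facet_code : seq (seq (seq (seq bool))) := Eval vm_compute in
  listing octagon_codes (closure_by turn_octagon [:: 0; 1] 6 base_octagon_code).

Definition facet_codes : seq (seq (seq (seq (seq bool)))) := Eval vm_compute in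
  closure_by turn_facet [:: 0; 1; 2] 3 base_facet_code.

Inductive face_code : Type :=
| LeastCode
| VertexCode of seq bool
| EdgeCode of seq (seq bool)
| OctagonCode of seq (seq (seq bool))
| FacetCode of seq (seq (seq (seq bool)))
| GreatestCode.

Definition code_le (c d : face_code) : bool :=
  match c, d with
  | LeastCode, _ | _, GreatestCode => true
  | VertexCode x, VertexCode y => x == y
  | VertexCode x, EdgeCode e => x \in e
  | VertexCode x, OctagonCode c => x \in flatten c
  | VertexCode x, FacetCode f => x \in flatten (flatten f)
  | EdgeCode e, EdgeCode e' => e == e'
  | EdgeCode e, OctagonCode c => e \in c
  | EdgeCode e, FacetCode f => e \in flatten f
  | OctagonCode c, OctagonCode c' => c == c'
  | OctagonCode c, FacetCode f => c \in f
  | FacetCode f, FacetCode f' => f == f'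
  | _, _ => false
  end.

Definition turn_code (k : nat) (c : face_code) : face_code :=
  match c with
  | VertexCode x => VertexCode (turn_vertex k x)
  | EdgeCode e => EdgeCode (turn_edge k e)
  | OctagonCode o => OctagonCode (turn_octagon k o)
  | FacetCode f => FacetCode (turn_facet k f)
  | c => c
  end.

(** The 66 faces, listed by increasing rank: the least face has the index 0, the
vertices 1 to 16, the edges 17 to 48, the octagons 49 to 60, the facets 61 to
64, and the greatest face 65. *)
Definition face_codes : seq face_code :=
  LeastCode :: map VertexCode vertex_codes ++ map EdgeCode edge_codes ++
  map OctagonCode octagon_codes ++ map FacetCode facet_codes ++ [:: GreatestCode].

Definition nth_code (a : nat) : face_code := nth LeastCode face_codes a.

(** Row a lists the indices of the faces above the face of index a. *)
Definition roli_up : seq (seq nat) := Eval vm_compute in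
  [seq [seq b <- iota 0 66 | code_le c (nth_code b)] | c <- face_codes].

Definition roli_le : rel nat := fun a b => b \in nth [::] roli_up a.

Definition roli_lev (a : nat) : nat :=
  nth 0 (0 :: nseq 16 1 ++ nseq 32 2 ++ nseq 12 3 ++ nseq 4 4 ++ [:: 5]) a.

(** The permutations of the indices induced by the three generators. *)
Definition roli_turn : seq (seq nat) := Eval vm_compute in
  [seq [seq let c' := turn_code k c in
            find (fun d => code_le c' d && code_le d c') face_codes
       | c <- face_codes] | k <- iota 0 3].

Definition turn_index (k a : nat) : nat := nth 0 (nth [::] roli_turn k) a.

Definition roli_flags : seq (seq nat) := Eval vm_compute in
  chains_from 66 roli_le roli_lev 5 0.

(** Row i lists the indices of the four proper neighbours of the i-th flag; the
neighbour in position k, for k from 1 to 4, is stored in column k - 1. *)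
Definition roli_adj_table : seq (seq nat) := Eval vm_compute in
  [seq [seq find (fun u => differ_at t u k) roli_flags | k <- iota 1 4]
  | t <- roli_flags].

Definition roli_adj (i k : nat) : nat := nth 0 (nth [::] roli_adj_table i) k.-1.

(** The proper faces of the flag t in positions outside K. *)
Definition faces_off (K t : seq nat) : seq nat :=
  [seq nth 0 t k | k <- iota 1 4 & k \notin K].

(** The distance of each flag, along moves in K, to the first flag in the list
with the same faces outside K; 40 exceeds all of these distances, and 20 rounds
of relaxation reach them. *)
Definition flag_distances (K : seq nat) : seq nat :=
  let off := map (faces_off K) roli_flags in
  let root := [seq nth [::] off i \notin take i off | i <- iota 0 384] in
  iter 20 (fun D => [seq if nth false root i then 0 else
      foldr minn 40 [seq (nth 0 D (roli_adj i k)).+1 | k <- K] | i <- iota 0 384])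
    (nseq 384 40).

(** One row for each of the 16 sets of moves K. *)
Definition roli_distances : seq (seq nat) := Eval vm_compute in
  [seq flag_distances (mask b (iota 1 4)) | b <- words_over bools 4].

(** From a vertex v and an edge e at v in the octagon a: the other end of e, and
the other edge of a at that end. *)
Definition next_on (a : nat) (ve : nat * nat) : nat * nat :=
  let v := find (fun v => [&& roli_lev v == 1, v != ve.1 & roli_le v ve.2]) (iota 0 66) in
  let e := find (fun e => [&& roli_lev e == 2, e != ve.2, roli_le v e & roli_le e a])
             (iota 0 66) in (v, e).

(** A tour around each octagon, starting with the octagon of index 49. *)
Definition octagon_walks : seq (seq (nat * nat)) := Eval vm_compute in
  [seq let v := find (fun v => (roli_lev v == 1) && roli_le v a) (iota 0 66) in
       let e := find (fun e => [&& roli_lev e == 2, roli_le v e & roli_le e a]) (iota 0 66) in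
       traject (next_on a) (v, e) 8 | a <- iota 49 12].

(** Sixteen moves to adjacent flags, changing the faces of ranks 0, 1, 2, 3 in
turn. *)
Definition petrie_walk : seq nat := flatten (nseq 4 (iota 1 4)).

(** Whether this walk is closed: true on one orbit of flags under the rotations
and false on the other. *)
Definition roli_handed : seq bool := Eval vm_compute in
  [seq closed_walk roli_adj petrie_walk i | i <- iota 0 384].

Lemma all_iotaP (Q : pred nat) m : all Q (iota 0 m) -> forall a, a < m -> Q a.
Proof. by move=> /allP h a am; apply: h; rewrite mem_iota. Qed.

Lemma size_face_codes : size face_codes = 66. Proof. by vm_compute. Qed.

Lemma roli_up_codes :
  [seq [seq b <- iota 0 66 | code_le c (nth_code b)] | c <- face_codes] = roli_up.
Proof. by vm_compute. Qed.

Lemma roli_leE a b : a < 66 -> b < 66 ->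
  roli_le a b = code_le (nth_code a) (nth_code b).
Proof.
move=> an bn; rewrite /roli_le -roli_up_codes (nth_map LeastCode) ?size_face_codes //.
rewrite mem_filter mem_iota leq0n add0n bn; exact: andbT.
Qed.

(** Two tables that agree as a whole agree entry by entry. *)
Lemma nested_tableE (T : Type) (x0 : T) (f : nat -> T) (g : nat -> T -> T)
    (s : seq T) (tab : seq (seq nat)) m :
  [seq map f r | r <- tab] = [seq map (g k) s | k <- iota 0 m] ->
  forall k a, k < m -> a < size s ->
  f (nth 0 (nth [::] tab k) a) = g k (nth x0 s a).
Proof.
move=> e k a km as_; have st : size tab = m.
  by rewrite -(size_map (map f)) e size_map size_iota.
have er : map f (nth [::] tab k) = map (g k) s.
  rewrite -(nth_map [::] [::] (map f)) ?st // e (nth_map 0) ?size_iota //.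
  by rewrite nth_iota.
have sr : size (nth [::] tab k) = size s by rewrite -(size_map f) er size_map.
by rewrite -(nth_map 0 x0 f) ?sr // er (nth_map x0).
Qed.

Lemma nested_table_lt (tab : seq (seq nat)) m : 0 < m ->
  all (all (gtn m)) tab -> forall k a, nth 0 (nth [::] tab k) a < m.
Proof.
move=> m0 h k a; have [kt|kt] := ltnP k (size tab); last first.
  by rewrite [nth [::] tab k]nth_default // nth_nil.
have [at_|at_] := ltnP a (size (nth [::] tab k)); last by rewrite nth_default.
by have /allP/(_ _ (mem_nth [::] kt))/allP := h; apply; apply: mem_nth.
Qed.

Lemma roli_turnE k a : k < 3 -> a < 66 ->
  turn_index k a < 66 /\ nth_code (turn_index k a) = turn_code k (nth_code a).
Proof.
move=> k3 an; split; first by apply: nested_table_lt => //; vm_compute.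
have e : [seq map nth_code r | r <- roli_turn] =
  [seq map (turn_code k) face_codes | k <- iota 0 3] by vm_compute.
by apply: (nested_tableE LeastCode e k3); rewrite size_face_codes.
Qed.

Lemma roli_flagsE : chains_from 66 roli_le roli_lev 5 0 = roli_flags.
Proof. by vm_compute. Qed.

Lemma roli_le_lt a b : roli_le a b -> a < 66 /\ b < 66.
Proof.
move=> ab; have an : a < 66.
  by rewrite ltnNge; apply/negP => an; move: ab; rewrite /roli_le nth_default.
split=> //; have h : all (all (gtn 66)) roli_up by vm_compute.
have au : a < size roli_up by apply: leq_trans an _; vm_compute.
by have /allP/(_ _ (mem_nth [::] au))/allP := h; apply.
Qed.

Lemma roli_le_refl a : a < 66 -> roli_le a a.
Proof.
have h : all (fun a => roli_le a a) (iota 0 66) by vm_compute.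
exact: (all_iotaP h).
Qed.

Lemma roli_lev_lt a b : roli_le a b -> a != b -> roli_lev a < roli_lev b.
Proof.
move=> ab; have [an _] := roli_le_lt ab.
have : all (fun a => all (fun b => (a == b) || (roli_lev a < roli_lev b))
  (nth [::] roli_up a)) (iota 0 66) by vm_compute.
by move/all_iotaP/(_ a an)/allP/(_ b ab)/orP => -[->|].
Qed.

Lemma roli_le_trans a b c : roli_le a b -> roli_le b c -> roli_le a c.
Proof.
move=> ab; have [an _] := roli_le_lt ab; move: c.
have : all (fun a => all (fun b => all (roli_le a) (nth [::] roli_up b))
  (nth [::] roli_up a)) (iota 0 66) by vm_compute.
by move/all_iotaP/(_ a an)/allP/(_ b ab)/allP.
Qed.

Lemma roli_bot a : a < 66 -> roli_le 0 a.
Proof.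
have h : all (roli_le 0) (iota 0 66) by vm_compute.
exact: (all_iotaP h).
Qed.

Lemma roli_top a : a < 66 -> roli_le a 65.
Proof.
have h : all (roli_le^~ 65) (iota 0 66) by vm_compute.
exact: (all_iotaP h).
Qed.

Local Notation cflag := (coded_flag 4 66 roli_le roli_lev).

Lemma roli_flagsP t : cflag t <-> t \in roli_flags.
Proof.
rewrite -roli_flagsE; apply: coded_flagE => //.
  by move=> a b c _ _ _; exact: roli_le_trans.
move=> a an; have : all (fun a => (roli_lev a == 0) ==> (a == 0)) (iota 0 66) by vm_compute.
by move/all_iotaP/(_ a an)/implyP => h /eqP/h/eqP.
Qed.

Lemma roli_flags_uniq : uniq roli_flags. Proof. by vm_compute. Qed.

Lemma size_roli_flags : size roli_flags = 384. Proof. by vm_compute. Qed.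

Lemma roli_adjP i k : i < size roli_flags -> 0 < k <= 4 ->
  roli_adj i k < size roli_flags /\
  differ_at (nth [::] roli_flags i) (nth [::] roli_flags (roli_adj i k)) k.
Proof.
rewrite size_roli_flags => il kr.
have : all (fun i => all (fun k => (roli_adj i k < 384) &&
    differ_at (nth [::] roli_flags i) (nth [::] roli_flags (roli_adj i k)) k)
  (iota 1 4)) (iota 0 384) by vm_compute.
by move/all_iotaP/(_ i il)/allP/(_ k); rewrite mem_iota => /(_ kr)/andP[].
Qed.

Lemma uniq_map_inj_in (T U : eqType) (f : T -> U) (s : seq T) :
  uniq (map f s) -> {in s &, injective f}.
Proof.
move=> uf x y xs ys e; have := uf; rewrite -(nth_index x xs) -(nth_index x ys).
have ix : index x s < size (map f s) by rewrite size_map index_mem.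
have iy : index y s < size (map f s) by rewrite size_map index_mem.
move=> _; congr (nth x s _); apply/eqP; rewrite -(nth_uniq (f x) ix iy uf).
by rewrite !(nth_map x) -?(size_map f) // !nth_index // e.
Qed.

Lemma roli_descends K : subseq K (iota 1 4) ->
  exists D, descends 4 roli_flags roli_adj K D.
Proof.
case/subseqP=> b; rewrite size_iota => sb ->.
pose Kb b := mask b (iota 1 4).
have chk : all2 (fun b D => all2 (fun x r => (x == 0) ||
      has (fun k => nth 0 D (nth 0 r k.-1) < x) (Kb b)) D roli_adj_table &&
    uniq [seq faces_off (Kb b) u.1 | u <- zip roli_flags D & u.2 == 0])
  (words_over bools 4) roli_distances by vm_compute.
have bm : b \in words_over bools 4.
  by apply: mem_words_over sb _; apply/allP=> -[].
move: chk; rewrite all2E => /andP[/eqP szd] /(all_nthP ([::], [::])).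
move=> /(_ (index b (words_over bools 4))).
have bi : index b (words_over bools 4) < size (words_over bools 4) by rewrite index_mem.
rewrite size_zip -szd minnn nth_zip // nth_index // => /(_ bi).
set D := nth [::] roli_distances _ => /= /andP[].
rewrite all2E => /andP[/eqP sD] /(all_nthP (0, [::])) dec root.
have sa : size roli_adj_table = 384 by vm_compute.
exists (nth 0 D); split=> [i|i j]; rewrite size_roli_flags => il.
  have := dec i; rewrite size_zip sD minnn sa nth_zip // => /(_ il)/=.
  case/orP=> [/eqP->|/hasP[k kK lt]]; [by left|right].
  by exists k => //; apply: leq_trans lt _.
move=> jl Di Dj agree; set F := fun u : seq nat * nat => faces_off (Kb b) u.1.
pose x i := (nth [::] roli_flags i, nth 0 D i).
have sD' : size D = 384 by rewrite sD.
have zx i' : i' < 384 -> nth ([::], 0) (zip roli_flags D) i' = x i'.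
  by move=> _; rewrite nth_zip // sD' size_roli_flags.
have xin i' : i' < 384 -> nth 0 D i' = 0 ->
    x i' \in [seq u <- zip roli_flags D | u.2 == 0].
  move=> i'l Di'; rewrite mem_filter /= Di' eqxx -zx // mem_nth //.
  by rewrite size_zip sD' size_roli_flags minnn.
have inj := @uniq_map_inj_in _ _ F _ root.
have /inj : F (x i) = F (x j).
  rewrite /F /= /faces_off; apply/eq_in_map => k.
  rewrite mem_filter mem_iota => /andP[kK kr]; exact: agree.
move=> /(_ (xin _ il Di) (xin _ jl Dj)) [/eqP].
by rewrite nth_uniq ?roli_flags_uniq ?size_roli_flags // => /eqP.
Qed.

Lemma roli_table : polytope_table 4 66 roli_le roli_lev.
Proof.
split.
- exact: roli_le_refl.
- by move=> a b _ _; exact: roli_lev_lt.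
- by move=> a b c _ _ _; exact: roli_le_trans.
- by exists 0; split=> // b; exact: roli_bot.
- by exists 65; split=> // b; exact: roli_top.
- move=> a b an bn ab lab.
  have h : all (fun a => all (fun b => ((roli_lev a).+1 < roli_lev b) ==>
      has (fun c => (roli_lev c == (roli_lev a).+1) && roli_le c b)
        (nth [::] roli_up a)) (nth [::] roli_up a)) (iota 0 66) by vm_compute.
  have /allP/(_ b ab)/implyP/(_ lab)/hasP[c ac /andP[/eqP lc cb]] := all_iotaP h an.
  have [cn _] := roli_le_lt cb.
  by exists c; split; [exact: cn | exact: lc | exact: ac | exact: cb].
- move=> a b an bn ab lab.
  have h : all (fun a => all (fun b => (roli_lev b == (roli_lev a).+2) ==>
      (size [seq c <- iota 0 66 | [&& roli_lev c == (roli_lev a).+1,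
        roli_le a c & roli_le c b]] == 2)) (nth [::] roli_up a)) (iota 0 66).
    by vm_compute.
  have /allP/(_ b ab)/implyP := all_iotaP h an.
  by rewrite lab eqxx => /(_ isT)/eqP.
- apply: (connected_by_descent (n := 66) roli_flagsP roli_adjP _ roli_descends).
  have h : all (fun t => (nth 0 t 0 == 0) && (nth 0 t 5 == 65)) roli_flags.
    by vm_compute.
  by move=> t /roli_flagsP tf; have /andP[/eqP -> /eqP ->] := allP h t tf.
Qed.

Lemma roli_octagon_walks a : a < 66 -> roli_lev a = 3 -> exists v e : seq nat,
  [/\ uniq v, uniq e,
      perm_eq v [seq c <- iota 0 66 | (roli_lev c == 1) && roli_le c a],
      perm_eq e [seq c <- iota 0 66 | (roli_lev c == 2) && roli_le c a]
    & [/\ size v = 8, size e = 8 & forall i j, i < 8 -> j < 8 ->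
         roli_le (nth 0 v i) (nth 0 e j) = (i == j) || (i == j.+1 %% 8)]].
Proof.
move=> an la.
pose good a w := [&& uniq (unzip1 w), uniq (unzip2 w),
  perm_eq (unzip1 w) [seq c <- iota 0 66 | (roli_lev c == 1) && roli_le c a],
  perm_eq (unzip2 w) [seq c <- iota 0 66 | (roli_lev c == 2) && roli_le c a],
  size w == 8 & all (fun i => all (fun j =>
    roli_le (nth 0 (unzip1 w) i) (nth 0 (unzip2 w) j) ==
    (i == j) || (i == j.+1 %% 8)) (iota 0 8)) (iota 0 8)].
have h : all (fun a => (roli_lev a == 3) ==>
    good a (nth [::] octagon_walks (a - 49))) (iota 0 66) by vm_compute.
have := all_iotaP h an; rewrite la eqxx.
move: (nth _ _ _) => w /and3P[uv ue /and4P[pv pe /eqP sw inc]].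
exists (unzip1 w), (unzip2 w); split; [exact: uv | exact: ue | exact: pv | exact: pe | ].
split; [by rewrite size_map sw | by rewrite size_map sw | ].
by move=> i j i8 j8; apply/eqP; exact: (all_iotaP (all_iotaP inc i8) j8).
Qed.

Lemma roli_schlafli (P : ranked_poset) (phi : nat -> P) :
  coding 66 roli_le roli_lev phi -> schlafli_type P 8 3 3.
Proof.
move=> COD; apply: (coded_schlafli roli_table COD).
- exact: roli_octagon_walks.
- move=> a b an bn la lb ab.
  have h : all (fun a => all (fun b => (roli_lev a == 1) && (roli_lev b == 4) ==>
      (size [seq c <- iota 0 66 | [&& roli_lev c == 3, roli_le a c & roli_le c b]]
       == 3)) (nth [::] roli_up a)) (iota 0 66) by vm_compute.
  have /allP/(_ b ab) := all_iotaP h an.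
  by rewrite la lb !eqxx => /eqP.
- move=> a an la.
  have h : all (fun a => (roli_lev a == 2) ==>
      (size [seq c <- iota 0 66 | (roli_lev c == 4) && roli_le a c] == 3))
    (iota 0 66) by vm_compute.
  by have := all_iotaP h an; rewrite la eqxx => /eqP.
Qed.

Lemma level_injective (T : eqType) (n m : nat) (lev : nat -> nat) (f : nat -> T) :
  all (fun l => uniq [seq f a | a <- iota 0 n & lev a == l]) (iota 2 m) ->
  forall a b, a < n -> b < n -> lev a = lev b -> 1 < lev a -> lev a < m.+2 ->
  f a = f b -> a = b.
Proof.
move=> h a b an bn lab la1 lam.
have /(allP h)/uniq_map_inj_in : lev a \in iota 2 m by rewrite mem_iota la1 add2n.
by apply; rewrite mem_filter mem_iota ?an ?bn ?lab eqxx.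
Qed.

(** A face of positive rank is determined by its facets. *)
Lemma roli_determined_by_facets a b : a < 66 -> b < 66 ->
  roli_lev a = roli_lev b -> 1 < roli_lev a ->
  (forall c, c < 66 -> (roli_lev c).+1 = roli_lev a -> roli_le c a = roli_le c b) ->
  a = b.
Proof.
move=> an bn lab la1 ab.
pose down a := [seq c <- iota 0 66 | ((roli_lev c).+1 == roli_lev a) && roli_le c a].
have h : all (fun l => uniq [seq down a | a <- iota 0 66 & roli_lev a == l])
  (iota 2 4) by vm_compute.
have h' : all (fun a => roli_lev a < 6) (iota 0 66) by vm_compute.
apply: (level_injective h an bn lab la1 (all_iotaP h' an)).
rewrite /down -lab; apply: eq_in_filter => c; rewrite mem_iota => /andP[_ cn].
by apply: andb_id2l => /eqP lc; exact: ab.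
Qed.

Lemma roli_every_face_in_flag a : a < 66 ->
  exists2 t, coded_flag 4 66 roli_le roli_lev t & a \in t.
Proof.
move=> an; have h : all (fun a => has (fun t => a \in t) roli_flags) (iota 0 66).
  by vm_compute.
by have /hasP[t /roli_flagsP ft at_] := all_iotaP h an; exists t.
Qed.

Lemma nth_tabulated (T : Type) (x0 : T) (f : nat -> T) (s : seq T) m :
  [seq f i | i <- iota 0 m] = s -> forall j, j < m -> f j = nth x0 s j.
Proof. by move=> <- j jm; rewrite (nth_map 0) ?size_iota // nth_iota. Qed.

Lemma petrie_walk_range : all (fun k => 0 < k <= 4) petrie_walk.
Proof. by []. Qed.

(** Adjacent flags have opposite handedness; this is what makes the cube
chiral. *)
Lemma roli_handed_adj i k : i < 384 -> 0 < k <= 4 ->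
  closed_walk roli_adj petrie_walk (roli_adj i k) =
  ~~ closed_walk roli_adj petrie_walk i.
Proof.
move=> il kr.
have e : [seq closed_walk roli_adj petrie_walk i | i <- iota 0 384] = roli_handed.
  by vm_compute.
have hE j : j < 384 -> closed_walk roli_adj petrie_walk j = nth false roli_handed j.
  by move=> jl; exact: (nth_tabulated false e jl).
have [al _] := roli_adjP (eq_ind_r (fun m => i < m) il size_roli_flags) kr.
rewrite size_roli_flags in al; rewrite (hE _ al) (hE _ il).
have h : all (fun i => all (fun k => nth false roli_handed (roli_adj i k) ==
    ~~ nth false roli_handed i) (iota 1 4)) (iota 0 384) by vm_compute.
have k4 : k \in iota 1 4 by rewrite mem_iota.
by apply/eqP; exact: (allP (all_iotaP h il) k k4).
Qed.

(** * Orbits of generated subgroups *)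

Lemma gen_subgroup1 (G : groupType) (S : set G) : gen_subgroup S 1%g.
Proof. by move=> H [[]]. Qed.

Lemma gen_subgroupM (G : groupType) (S : set G) x y :
  gen_subgroup S x -> gen_subgroup S y -> gen_subgroup S (x * y)%g.
Proof.
move=> Sx Sy H [sH SH]; have [H1 HV] := sH.
have Hx := Sx H (conj sH SH); have Hy := Sy H (conj sH SH).
have Hy' := HV _ _ H1 Hy; rewrite mul1g in Hy'.
by rewrite -[y]invgK; exact: HV Hx Hy'.
Qed.

Lemma gen_subgroup_gen (G : groupType) (S : set G) x : S x -> gen_subgroup S x.
Proof. by move=> Sx H [_ SH]; exact: SH. Qed.

(** A group acts on X, and the generators gen k act on the elements c x, with x
in the list L, as the maps s k permuting L. The orbit of c x0 under the
generated subgroup then consists of the c x with x in L, provided that L is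
reached from x0 by the maps s k. *)
Section Orbit.
Variables (G : groupType) (X : Type) (act : G -> X -> X).
Hypothesis act1 : forall x, act 1%g x = x.
Hypothesis actM : forall g h x, act (g * h)%g x = act h (act g x).
Variables (S : set G) (gen : nat -> G) (ks : seq nat).
Hypothesis S_gen : S = [set gen k | k in [set` ks]].
Variables (T : eqType) (c : T -> X) (s : nat -> T -> T) (L : seq T).
Hypothesis s_act : forall k x, k \in ks -> x \in L -> act (gen k) (c x) = c (s k x).
Hypothesis s_closed : forall k x, k \in ks -> x \in L -> s k x \in L.

Lemma orbit_word w x : all (mem ks) w -> x \in L ->
  exists2 g, gen_subgroup S g & act g (c x) = c (foldl (fun y k => s k y) x w).
Proof.
elim: w x => [|k w IH] x /= => [_ _|/andP[kk wk] xL].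
  by exists 1%g; [exact: gen_subgroup1 | rewrite act1].
have [g Sg e] := IH (s k x) wk (s_closed kk xL).
exists (gen k * g)%g; last by rewrite actM s_act.
by apply: gen_subgroupM Sg; apply: gen_subgroup_gen; rewrite S_gen; exists k.
Qed.

Lemma closure_word m x0 x : x \in closure_by s ks m x0 ->
  exists2 w, all (mem ks) w & x = foldl (fun y k => s k y) x0 w.
Proof.
elim: m x => [|m IH] x /=; first by rewrite inE => /eqP->; exists [::].
rewrite mem_undup mem_cat => /orP[/IH //|/allpairsP[[k y] /= [kk /IH[w wk ->] ->]]].
by exists (rcons w k); rewrite ?all_rcons ?foldl_rcons //=; apply/andP.
Qed.

Hypothesis s_onto : forall k x, k \in ks -> x \in L -> x \in map (s k) L.

(** The elements of the group that map c(L) onto itself form a subgroup. *)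
Lemma orbit_sub g x : gen_subgroup S g -> x \in L ->
  exists2 y, y \in L & act g (c x) = c y.
Proof.
pose K : set G := [set g | act g @` (c @` [set` L]) = c @` [set` L]].
have KS : gen_subgroup S `<=` K.
  apply: smallest_sub.
    split=> [|u0 v0 Ku0 Kv0].
      by rewrite /K /= -[RHS]image_id; apply: eq_imagel => y _; exact: act1.
    have KM u v : K u -> K v -> K (u * v)%g.
      rewrite /K /= => Ku Kv; rewrite -[RHS]Kv -[in RHS]Ku [in RHS]image_comp.
      by apply: eq_imagel => y _; rewrite /= actM.
    have KV u : K u -> K (u^-1)%g.
      rewrite /K /= => Ku; rewrite -[in LHS]Ku [in LHS]image_comp -[RHS]image_id.
      by apply: eq_imagel => y _; rewrite /= -actM mulgV act1.
    exact: KM Ku0 (KV _ Kv0).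
  rewrite S_gen => _ [k /= kk <-]; apply/seteqP; split=> [_ [_ [y /= yL <-] <-]|].
    by exists (s k y); [exact: s_closed | rewrite s_act].
  move=> _ [y /= yL <-]; have /mapP[z zL ->] := s_onto kk yL.
  by exists (c z); [exists z | rewrite s_act].
move=> /KS Kg xL; have : (act g @` (c @` [set` L])) (act g (c x)).
  by exists (c x) => //; exists x.
by rewrite Kg => -[y yL e]; exists y.
Qed.

Lemma orbit_eq m x0 : x0 \in L -> {subset L <= closure_by s ks m x0} ->
  [set act g (c x0) | g in gen_subgroup S] = c @` [set` L].
Proof.
move=> x0L sub; apply/seteqP; split=> [_ [g Sg <-]|_ [x /= xL <-]].
  by have [y yL ->] := orbit_sub Sg x0L; exists y.
have [w wk ->] := closure_word (sub x xL).
by have [g Sg <-] := orbit_word wk x0L; exists g.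
Qed.

End Orbit.

(** * The rotation group as signed permutations of the axes *)

Local Open Scope ring_scope.

(** A signed basis vector: (i, b) stands for (-1)^b times the basis vector of
index i, counted from 0. A frame lists the images of the basis vectors under a
signed permutation; frame_mul g h applies g first. *)
Definition axis : Type := (nat * bool)%type.

Definition frame_nth (g : seq axis) (i : nat) : axis := nth (0%N, false) g i.

Definition frame_mul (g h : seq axis) : seq axis :=
  [seq ((frame_nth h a.1).1, a.2 (+) (frame_nth h a.1).2) | a <- g].

Definition is_frame (g : seq axis) : bool :=
  (size g == 4%N) && all (fun a => (a.1 < 4)%N) g.

Definition frame_one : seq axis := [seq (i, false) | i <- iota 0 4].

(** The frames of the generators sigma_1, sigma_2, sigma_3 and, below, of their
inverses. *)
Definition frame_gen (k : nat) : seq axis :=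
  nth [::] [:: [:: (3, true); (0, false); (1, false); (2, false)];
               [:: (1, false); (3, false); (2, false); (0, false)];
               [:: (0, false); (3, false); (1, false); (2, false)]]%N k.

Definition frame_gen_inv (k : nat) : seq axis :=
  nth [::] [:: [:: (1, false); (2, false); (3, false); (0, true)];
               [:: (3, false); (0, false); (2, false); (1, false)];
               [:: (0, false); (2, false); (3, false); (1, false)]]%N k.

Definition letter_frame (l : letter 3) : seq axis :=
  if l.2 then frame_gen_inv l.1 else frame_gen l.1.

Definition word_frame (w : word 3) : seq axis :=
  foldl (fun g l => frame_mul g (letter_frame l)) frame_one w.

(** The k-th generator, counted from 0; the value for k > 2 is irrelevant. *)
Definition generator (k : nat) : 'I_3 :=
  nth (@Ordinal 3 0 isT) [:: @Ordinal 3 0 isT; @Ordinal 3 1 isT; @Ordinal 3 2 isT] k.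

Definition positive_word (w : seq nat) : word 3 :=
  [seq (generator k, false) | k <- w].

(** Positive words for the elements of the group, in breadth-first order. *)
Definition word_codes : seq (seq nat) := Eval vm_compute in
  unzip1 (iter 12 (fun L => foldl (fun acc u =>
      if u.2 \in unzip2 acc then acc else rcons acc u) L
    [seq (rcons u.1 k, frame_mul u.2 (frame_gen k)) | u <- L, k <- iota 0 3])
  [:: ([::], frame_one)]).

(** The frames of these 192 words, which are pairwise distinct. *)
Definition group_frames : seq (seq axis) := Eval vm_compute in
  [seq word_frame (positive_word w) | w <- word_codes].

Lemma group_framesE :
  [seq word_frame (positive_word w) | w <- word_codes] = group_frames.
Proof. by vm_compute. Qed.

Lemma size_word_codes : size word_codes = 192%N. Proof. by vm_compute. Qed.

Lemma size_group_frames : size group_frames = 192%N. Proof. by vm_compute. Qed.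

Lemma group_frames_uniq : uniq group_frames. Proof. by vm_compute. Qed.

(** The reflection in the first coordinate. *)
Definition reflection_frame : seq axis :=
  [:: (0, true); (1, false); (2, false); (3, false)]%N.

Lemma mem_axes (a : axis) : (a.1 < 4)%N ->
  a \in [seq (i, b) | i <- iota 0 4, b <- bools].
Proof.
case: a => i b i4; apply/allpairsP; exists (i, b).
by split; [rewrite mem_iota | case: (b) | ].
Qed.

(** The 384 signed permutations are the 192 listed ones and their products with
one reflection. *)
Lemma frame_in_group (g : seq axis) : is_frame g -> uniq (unzip1 g) ->
  (g \in group_frames) || (frame_mul reflection_frame g \in group_frames).
Proof.
have h : all (fun g : seq axis => uniq (unzip1 g) ==>
    ((g \in group_frames) || (frame_mul reflection_frame g \in group_frames)))
  (words_over [seq (i, b) | i <- iota 0 4, b <- bools] 4) by vm_compute.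
move=> /andP[/eqP sg gl]; apply/implyP; apply: (allP h).
apply: mem_words_over sg _; apply/allP=> a /(allP gl) a4; exact: mem_axes.
Qed.

Section Frames.
Variable R : realType.

(** Row i of the matrix is the i-th vector of the frame. *)
Definition frame_mx (g : seq axis) : 'M[R]_4 :=
  \matrix_(i, j) ((-1) ^+ (frame_nth g i).2 *+ (j == (frame_nth g i).1 :> nat)).

Lemma frame_nth_lt g (i : 'I_4) : is_frame g -> ((frame_nth g i).1 < 4)%N.
Proof. by case/andP=> /eqP sg /allP; apply; rewrite mem_nth ?sg. Qed.

Lemma frame_mxM g h : is_frame g ->
  frame_mx g *m frame_mx h = frame_mx (frame_mul g h).
Proof.
move=> fg; apply/matrixP => i j; rewrite !mxE.
have sg : size g = 4%N by case/andP: fg => /eqP.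
have -> : frame_nth (frame_mul g h) i = ((frame_nth h (frame_nth g i).1).1,
    (frame_nth g i).2 (+) (frame_nth h (frame_nth g i).1).2).
  by rewrite /frame_nth (nth_map (0%N, false)) ?sg.
rewrite (bigD1 (Ordinal (frame_nth_lt i fg))) //= big1 => [|k ki].
  by rewrite !mxE /= eqxx mulr1n addr0 mulrnAr -signr_addb.
rewrite !mxE; case: eqP => [e|_]; last by rewrite mulr0n mul0r.
by case/eqP: ki; apply: val_inj.
Qed.

Lemma frame_mul_frame g h : is_frame g -> is_frame h -> is_frame (frame_mul g h).
Proof.
move=> /andP[/eqP sg gl] fh; rewrite /is_frame size_map sg eqxx.
apply/allP=> _ /mapP[a ag ->] /=.
exact: (@frame_nth_lt h (Ordinal (allP gl a ag)) fh).
Qed.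

Lemma frame_mx_inj g h : is_frame g -> is_frame h ->
  frame_mx g = frame_mx h -> g = h.
Proof.
move=> fg fh /matrixP e; have sg : size g = 4%N by case/andP: fg => /eqP.
have sh : size h = 4%N by case/andP: fh => /eqP.
apply: (@eq_from_nth _ (0%N, false)); rewrite ?sg ?sh // => i i4.
have := e (Ordinal i4) (Ordinal (frame_nth_lt (Ordinal i4) fg)).
rewrite !mxE /= eqxx /frame_nth.
case: eqP => [ab|_]; last by rewrite mulr0n => /eqP; rewrite mulr1n signr_eq0.
rewrite !mulr1n => /signr_inj e2.
by apply/eqP; rewrite -pair_eqE /pair_eq ab e2 !eqxx.
Qed.

Lemma frame_mx1 : frame_mx frame_one = 1%:M.
Proof.
apply/matrixP => i j; rewrite !mxE /frame_nth (nth_map 0%N) ?size_iota //.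
by rewrite nth_iota // add0n expr0 eq_sym.
Qed.

Lemma frame_genE k : (k < 3)%N -> frame_mx (frame_gen k) = val (sigma R (generator k)).
Proof.
move=> k3; apply/matrixP => i j; rewrite /sigma (tnth_nth (sigma1 R)).
by case: k k3 => [|[|[|//]]] _ /=; rewrite ?sigma1_mxE ?sigma2_mxE ?sigma3_mxE !mxE;
  case: i => -[|[|[|[|]]]] //= ?; rewrite ?expr0.
Qed.

Lemma letter_frameE (l : letter 3) : frame_mx (letter_frame l) =
  val (if l.2 then (sigma R l.1)^-1 else sigma R l.1)%g.
Proof.
case: l => i b /=; have gi : i = generator i.
  by apply: val_inj; case: i => -[|[|[|]]].
have E : frame_mx (frame_gen i) = val (sigma R i) by rewrite frame_genE -?gi.
rewrite /letter_frame /=; case: b => //=.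
have h : frame_mul (frame_gen i) (frame_gen_inv i) = frame_one.
  by case: (i) => -[|[|[|]]].
have fi : is_frame (frame_gen i) by case: (i) => -[|[|[|]]].
rewrite -[RHS]mulmx1 -frame_mx1 -h -frame_mxM // E mulKmx //.
exact: rotation_unit.
Qed.

Lemma letter_frame_frame l : is_frame (letter_frame l).
Proof. by case: l => -[[|[|[|]]] ?] []. Qed.

Lemma word_frame_rcons w l :
  word_frame (rcons w l) = frame_mul (word_frame w) (letter_frame l).
Proof. by rewrite /word_frame foldl_rcons. Qed.

Lemma word_frame_frame w : is_frame (word_frame w).
Proof.
elim/last_ind: w => // w l IH; rewrite word_frame_rcons.
exact/frame_mul_frame/letter_frame_frame.
Qed.

Lemma word_evalE w : val (word_eval (sigma R) w) = frame_mx (word_frame w).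
Proof.
elim/last_ind: w => [|w l IH]; first by rewrite /word_eval big_nil frame_mx1.
rewrite word_frame_rcons -frame_mxM ?word_frame_frame // -IH letter_frameE.
by rewrite /word_eval -cats1 big_cat big_seq1.
Qed.

Lemma det_reflection : \det (frame_mx reflection_frame) = -1.
Proof.
have -> : frame_mx reflection_frame = diag_mx (\row_i (if i == 0 then -1 else 1)).
  apply/matrixP => i j; rewrite !mxE.
  by case: i => -[|[|[|[|]]]] //= ?; case: j => -[|[|[|[|]]]] //= ?;
    rewrite ?expr0 ?expr1.
by rewrite det_diag !big_ord_recl big_ord0 !mxE /= !mulr1.
Qed.

Lemma signed_perm_frame (t : 'S_4) (e : 'I_4 -> bool) :
  signed_perm_mx R t e = frame_mx [seq (val (t i), e i) | i <- enum 'I_4].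
Proof.
apply/matrixP => i j; rewrite !mxE /frame_nth (nth_map ord0) ?size_enum_ord //.
by rewrite nth_ord_enum.
Qed.

(** A signed permutation matrix of determinant 1 is a product of generators: else
its product with the reflection, of determinant -1, would be one. *)
Lemma rotation_frame (g : rotation R) :
  exists2 w, w \in word_codes & g = word_eval (sigma R) (positive_word w).
Proof.
have [[t [e ge]] gd] := rotationP g.
pose f : seq axis := [seq (val (t i), e i) | i <- enum 'I_4].
have gf : val g = frame_mx f by rewrite ge signed_perm_frame.
have ff : is_frame f.
  rewrite /is_frame size_map size_enum_ord eqxx.
  by apply/allP=> _ /mapP[i _ ->] /=.
have uf : uniq (unzip1 f).
  rewrite /unzip1 -map_comp map_inj_uniq ?enum_uniq // => i j.
  by move=> /val_inj/perm_inj.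
have det1 h : h \in group_frames -> exists2 w, w \in word_codes &
    frame_mx h = val (word_eval (sigma R) (positive_word w)).
  rewrite -group_framesE => /mapP[w wc ->]; exists w => //.
  by rewrite word_evalE.
case/orP: (frame_in_group ff uf) => [/det1[w wc e']|/det1[w wc e']].
  by exists w => //; apply: val_inj; rewrite gf.
have [_ d1] := rotationP (word_eval (sigma R) (positive_word w)).
move: d1; rewrite -e' -frame_mxM // det_mulmx det_reflection -gf gd mulr1.
move/eqP; rewrite -subr_eq0 -opprD oppr_eq0 -[1 + 1]/(2%:R) pnatr_eq0.
by [].
Qed.

Lemma rotation_generated :
  gen_subgroup [set sigma1 R; sigma2 R; sigma3 R] = setT.
Proof.
apply/seteqP; split=> // g _; have [w _ ->] := rotation_frame g.
rewrite /word_eval; elim: w => [|k w IH].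
  by rewrite big_nil; exact: gen_subgroup1.
rewrite /= big_cons; apply: gen_subgroupM IH; apply: gen_subgroup_gen => /=.
rewrite /generator /sigma (tnth_nth (sigma1 R)).
by case: k => [|[|[|k]]] /=; [left; left|left; right|right|rewrite nth_nil; left; left].
Qed.

Lemma rotation_card : [set: rotation R] #= `I_192.
Proof.
pose f i : rotation R := word_eval (sigma R) (positive_word (nth [::] word_codes i)).
have -> : [set: rotation R] = f @` [set` iota 0 192].
  apply/seteqP; split=> // g _; have [w wc ->] := rotation_frame g.
  have wi : index w word_codes \in iota 0 192.
    by rewrite mem_iota -size_word_codes index_mem.
  by exists (index w word_codes); [exact: wi | rewrite /f nth_index].
have := @card_coded_set _ f (iota 0 192) (iota_uniq _ _); rewrite size_iota.
apply=> i j; rewrite !mem_iota => il jl e.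
have FE k : (k < 192)%N -> word_frame (positive_word (nth [::] word_codes k)) =
    nth [::] group_frames k.
  by move=> kl; rewrite -group_framesE (nth_map [::]) ?size_word_codes.
have : frame_mx (nth [::] group_frames i) = frame_mx (nth [::] group_frames j).
  by rewrite -!FE // -!word_evalE -[LHS]/(val (f i)) e.
have fr k : (k < 192)%N -> is_frame (nth [::] group_frames k).
  by move=> kl; rewrite -FE // word_frame_frame.
move/(frame_mx_inj (fr _ il) (fr _ jl))/eqP.
by rewrite nth_uniq ?size_group_frames ?group_frames_uniq // => /eqP.
Qed.

End Frames.

(** * The rotations acting on the faces *)

Section RotationActions.
Variable R : realType.
Implicit Types (g h : rotation R) (x y : 'rV[R]_4).

Lemma rot_point1 x : rot_point 1%g x = x.
Proof. exact: mulmx1. Qed.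

Lemma rot_pointM g h x : rot_point (g * h)%g x = rot_point h (rot_point g x).
Proof. exact: mulmxA. Qed.

Lemma rot_pointK g : cancel (rot_point g) (rot_point g^-1%g).
Proof. by move=> x; rewrite -rot_pointM mulgV rot_point1. Qed.

Lemma rot_point_inj g : injective (rot_point g).
Proof. exact: can_inj (rot_pointK g). Qed.

Lemma rot_segment1 e : rot_segment (1%g : rotation R) e = e.
Proof.
by rewrite /rot_segment -[RHS]image_id; apply: eq_imagel => x _; exact: rot_point1.
Qed.

Lemma rot_segmentM g h e :
  rot_segment (g * h)%g e = rot_segment h (rot_segment g e).
Proof.
by rewrite /rot_segment image_comp; apply: eq_imagel => x _; exact: rot_pointM.
Qed.

Lemma rot_segment_inj g : injective (rot_segment g).
Proof. exact/image_injective/rot_point_inj. Qed.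

Lemma rot_polygon1 (c : polygon R) : rot_polygon 1%g c = c.
Proof.
case: c => v e; congr Polygon; rewrite -[RHS]image_id; apply: eq_imagel => x _.
  exact: rot_point1.
exact: rot_segment1.
Qed.

Lemma rot_polygonM g h (c : polygon R) :
  rot_polygon (g * h)%g c = rot_polygon h (rot_polygon g c).
Proof.
case: c => v e; congr Polygon; rewrite /= image_comp; apply: eq_imagel => x _.
  exact: rot_pointM.
exact: rot_segmentM.
Qed.

Lemma rot_polygonK g : cancel (@rot_polygon R g) (rot_polygon g^-1%g).
Proof. by move=> c; rewrite -rot_polygonM mulgV rot_polygon1. Qed.

Lemma rot_polygon_inj g : injective (@rot_polygon R g).
Proof. exact: can_inj (rot_polygonK g). Qed.

Lemma rot_cell1 (m : cell R) : rot_cell 1%g m = m.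
Proof.
case: m => v e c; congr Cell; rewrite -[RHS]image_id; apply: eq_imagel => x _.
- exact: rot_point1.
- exact: rot_segment1.
- exact: rot_polygon1.
Qed.

Lemma rot_cellM g h (m : cell R) :
  rot_cell (g * h)%g m = rot_cell h (rot_cell g m).
Proof.
case: m => v e c; congr Cell; rewrite /= image_comp; apply: eq_imagel => x _.
- exact: rot_pointM.
- exact: rot_segmentM.
- exact: rot_polygonM.
Qed.

(** A rotation permutes the coordinates up to signs. *)
Lemma rot_pointE g : exists (t : 'S_4) (e : 'I_4 -> bool),
  forall x j, rot_point g x 0 (t j) = (-1) ^+ e j * x 0 j.
Proof.
have [[t [e ge]] _] := rotationP g; exists t, e => x j.
rewrite /rot_point ge !mxE (bigD1 j) //= big1 => [|i ij].
  by rewrite !mxE eqxx mulr1n addr0 mulrC.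
have /negPf tij : t j != t i by apply: contraNneq ij => /perm_inj ->.
by rewrite !mxE tij mulr0n mulr0.
Qed.

Lemma rot_point_cube g x : cube_vertices x -> cube_vertices (rot_point g x).
Proof.
move=> xc j; have [t [e h]] := rot_pointE g.
rewrite -[j](permKV t) h; case: (e _); case: (xc (t^-1 j)%g) => ->;
  rewrite ?expr0 ?expr1 ?mul1r ?mulN1r ?opprK; first [by left | by right].
Qed.

Lemma rot_segment_cube g e : cube_edges e -> cube_edges (rot_segment g e).
Proof.
case=> x [y [xc yc [j [xj uj]] ->]].
have [t [s h]] := rot_pointE g.
exists (rot_point g x), (rot_point g y); split; try exact: rot_point_cube.
  exists (t j); split=> [|k].
    by rewrite !h => e'; apply: xj; apply: (mulfI _ e'); rewrite signr_eq0.
  rewrite -[k](permKV t) !h => nk; rewrite (uj (t^-1 k)%g) // => e'.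
  by apply: nk; rewrite e'.
by rewrite /rot_segment image_setU !image_set1.
Qed.

Lemma rot_polygon_roli g c : roli_octagons c -> roli_octagons (rot_polygon (R := R) g c).
Proof. by case=> h _ <-; exists (h * g)%g => //; rewrite rot_polygonM. Qed.

Lemma rot_cell_roli g m : roli_facets m -> roli_facets (rot_cell (R := R) g m).
Proof. by case=> h _ <-; exists (h * g)%g => //; rewrite rot_cellM. Qed.

(** The action of a rotation on the faces of the cube. *)
Definition rot_face g (F : roli_cube R) : roli_cube R :=
  match F with
  | RoliLeast => RoliLeast R
  | RoliVertex x => RoliVertex (SigSub (mem_set (rot_point_cube g (set_valP x))))
  | RoliEdge e => RoliEdge (SigSub (mem_set (rot_segment_cube g (set_valP e))))
  | RoliOctagon c => RoliOctagon (SigSub (mem_set (rot_polygon_roli g (set_valP c))))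
  | RoliFacet m => RoliFacet (SigSub (mem_set (rot_cell_roli g (set_valP m))))
  | RoliGreatest => RoliGreatest R
  end.

Lemma rot_face1 F : rot_face 1%g F = F.
Proof.
case: F => [|x|e|c|m|] //=; congr (_ _); apply: val_inj => /=.
- exact: rot_point1.
- exact: rot_segment1.
- exact: rot_polygon1.
- exact: rot_cell1.
Qed.

Lemma rot_faceM g h F : rot_face (g * h)%g F = rot_face h (rot_face g F).
Proof.
case: F => [|x|e|c|m|] //=; congr (_ _); apply: val_inj => /=.
- exact: rot_pointM.
- exact: rot_segmentM.
- exact: rot_polygonM.
- exact: rot_cellM.
Qed.

Lemma rot_faceK g : cancel (rot_face g) (rot_face g^-1%g).
Proof. by move=> F; rewrite -rot_faceM mulgV rot_face1. Qed.

Lemma rot_face_automorphism g : is_automorphism (rot_face g).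
Proof.
split.
  exists (rot_face g^-1%g); first exact: rot_faceK.
  by move=> F; rewrite -rot_faceM mulVg rot_face1.
have fI := can_inj (rot_faceK g).
have inj F G : (rot_face g F = rot_face g G) <-> (F = G).
  by split=> [/fI|->].
have piff (A B : Prop) : A = B -> (A <-> B) by move=> ->.
case=> [|x|e|c|m|] [|x'|e'|c'|m'|]; first [exact: inj | by [] | apply: piff].
- exact: (image_inj (@rot_point_inj g)).
- exact: (image_inj (@rot_point_inj g)).
- exact: (image_inj (@rot_point_inj g)).
- exact: (image_inj (@rot_segment_inj g)).
- exact: (image_inj (@rot_segment_inj g)).
- exact: (image_inj (@rot_polygon_inj g)).
Qed.

Lemma rot_face_rank g F : prank (rot_face g F) = prank F.
Proof. by case: F. Qed.

Lemma roli_point_rot g F : prank F = 0 ->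
  roli_point (rot_face g F) = rot_point g (roli_point F).
Proof. by case: F. Qed.

(** Realizing a face commutes with rotating it. *)
Lemma realize_rot g j F : prank F = j%:Z ->
  realize (@roli_point R) j (rot_face g F) =
  rface_map (rot_point g) (realize (@roli_point R) j F).
Proof.
elim: j F => [|j IH] F rF; first exact: roli_point_rot.
have [_ hle] := rot_face_automorphism g.
apply/seteqP; split=> [_ [G [/= rG GF] <-]|_ [_ [G [/= rG GF] <-] <-]].
  pose G' := rot_face g^-1%g G.
  have GE : rot_face g G' = G by rewrite -rot_faceM mulVg rot_face1.
  have rG' : prank G' = j%:Z by rewrite rot_face_rank.
  exists (realize (@roli_point R) j G'); last by rewrite -IH // GE.
  by exists G' => //; split=> //; apply/hle; rewrite GE.
by exists (rot_face g G); [split; [exact: etrans (rot_face_rank g G) rG | exact/hle]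
  | exact: IH].
Qed.

Lemma rot_point_isometry g : euclid_isometry (rot_point g).
Proof.
move=> x y; congr Num.sqrt; have [t [e h]] := rot_pointE g.
rewrite (reindex_inj (@perm_inj _ t)) /=; apply: eq_bigr => j _.
by rewrite !h -mulrBr exprMn sqrr_sign mul1r.
Qed.

Lemma rot_same_geometric g Phi Psi : rot_face g @` Phi = Psi ->
  same_geometric_orbit (@roli_point R) Phi Psi.
Proof.
move=> e; have em := equivariant_maps_realized (rot_face_rank g) (realize_rot g).
exists (rot_point g); split; last exact: em.
split; first exact: rot_point_isometry.
apply: em; apply/seteqP; split=> // F _; exists (rot_face g^-1%g F) => //.
by rewrite -rot_faceM mulVg rot_face1.
Qed.

End RotationActions.

(** * Coordinates of the coded faces *)

(** Sets of the form c(l), where l is a sublist of a list D on which the map c is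
injective, are compared through their codes. *)
Section CodedSets.
Variables (T : eqType) (X : Type) (D : seq T) (c : T -> X).
Hypothesis c_inj : {in D &, injective c}.
Implicit Types (l : seq T) (x : T).

Lemma coded_mem l x : {subset l <= D} -> x \in D ->
  (c @` [set` l]) (c x) <-> x \in l.
Proof.
move=> lD xD; split=> [[y /= yl e]|xl]; last by exists x.
by rewrite -(c_inj (lD _ yl) xD e).
Qed.

Lemma coded_set_eq l l' : {subset l <= D} -> {subset l' <= D} ->
  c @` [set` l] = c @` [set` l'] -> l =i l'.
Proof.
have h (s s' : seq T) : {subset s <= D} -> {subset s' <= D} ->
    c @` [set` s] = c @` [set` s'] -> {subset s <= s'}.
  move=> sD s'D e x xs; apply/(coded_mem s'D (sD _ xs)); rewrite -e.
  by apply/(coded_mem sD (sD _ xs)).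
by move=> lD l'D e x; apply/idP/idP; apply: h.
Qed.

End CodedSets.

Lemma eq_coded_set (T : eqType) (X : Type) (c : T -> X) (l l' : seq T) :
  l =i l' -> c @` [set` l] = c @` [set` l'].
Proof.
move=> e; apply/seteqP; split=> _ [x /= xl <-]; exists x => //=.
  by rewrite -e.
by rewrite e.
Qed.

Lemma listing_mem (T : eqType) (U l : seq T) : {subset l <= U} -> listing U l =i l.
Proof.
move=> lU x; rewrite mem_filter; case xl: (x \in l) => //=; exact: lU.
Qed.

Lemma listing_eq (T : eqType) (U l l' : seq T) :
  listing U l = l -> listing U l' = l' -> l =i l' -> l = l'.
Proof. by move=> {2}<- {2}<- e; apply: eq_filter => x; rewrite e. Qed.

Section Coordinates.
Variable R : realType.

Local Notation sig k := (sigma R (generator k)).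

(** The vertex, edge, octagon and facet with a given code. *)
Definition point_of (x : seq bool) : 'rV[R]_4 := \row_j (-1) ^+ nth false x j.

Lemma vecE x i j : point_of x i j = (-1) ^+ nth false x j.
Proof. exact: mxE. Qed.

Definition segment_of (e : seq (seq bool)) : set 'rV[R]_4 := point_of @` [set` e].

Definition octagon_of (c : seq (seq (seq bool))) : polygon R :=
  Polygon (point_of @` [set` flatten c]) (segment_of @` [set` c]).

Definition cell_of (f : seq (seq (seq (seq bool)))) : cell R :=
  Cell (point_of @` [set` flatten (flatten f)]) (segment_of @` [set` flatten f])
       (octagon_of @` [set` f]).

Lemma vertex_code_size x : x \in vertex_codes -> size x = 4%N.
Proof.
have h : all (fun x => size x == 4%N) vertex_codes by vm_compute.
by move/(allP h)/eqP.
Qed.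

Lemma mem_vertex_codes x : size x = 4%N -> x \in vertex_codes.
Proof. by case: x => [|[] [|[] [|[] [|[] [|]]]]]. Qed.

Lemma point_of_inj : {in vertex_codes &, injective point_of}.
Proof.
move=> x y /vertex_code_size sx /vertex_code_size sy /rowP e.
apply: (@eq_from_nth _ false) => [|i]; rewrite sx ?sy // => i4.
by have := e (Ordinal i4); rewrite !mxE => /signr_inj.
Qed.

Lemma vec_cube x : cube_vertices (point_of x).
Proof.
move=> j; rewrite mxE; case: (nth _ _ _); [right | left].
  by rewrite expr1.
by rewrite expr0.
Qed.

Lemma cube_vec y : cube_vertices y -> exists2 x, x \in vertex_codes & y = point_of x.
Proof.
move=> yc; exists [seq y 0 i == -1 | i <- enum 'I_4].
  by apply: mem_vertex_codes; rewrite size_map size_enum_ord.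
apply/rowP => j; rewrite mxE (nth_map ord0) ?size_enum_ord // nth_ord_enum.
have n1 : (1 == -1 :> R) = false.
  by apply/negbTE; rewrite -subr_eq0 opprK -[1 + 1]/(2%:R) pnatr_eq0.
by case: (yc j) => ->; rewrite ?eqxx ?n1 ?expr0 ?expr1.
Qed.

Lemma rot_vec k x : (k < 3)%N -> rot_point (sig k) (point_of x) = point_of (turn_vertex k x).
Proof.
move=> k3; rewrite /rot_point -frame_genE //; apply/rowP => j.
rewrite !mxE !big_ord_recl big_ord0 !mxE /frame_nth.
case: k k3 => [|[|[|//]]] _; case: j => -[|[|[|[|//]]]] ? /=;
  rewrite ?mulr0n ?mulr1n ?mulr0 ?expr0 ?mulr1 ?addr0 ?add0r //.
by rewrite expr1 mulrN1; case: (nth _ _ _); rewrite ?expr0 ?expr1 ?opprK.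
Qed.

Lemma turn_vertex_codes k x : x \in vertex_codes -> turn_vertex k x \in vertex_codes.
Proof. by move=> _; apply: mem_vertex_codes; case: k => [|[|k]]. Qed.

Lemma edge_code_sub e : e \in edge_codes -> {subset e <= vertex_codes}.
Proof.
have h : all (all (mem vertex_codes)) edge_codes by vm_compute.
by move/(allP h)/allP.
Qed.

Lemma edge_code_listing e : e \in edge_codes -> listing vertex_codes e = e.
Proof.
have h : all (fun e => listing vertex_codes e == e) edge_codes by vm_compute.
by move/(allP h)/eqP.
Qed.

Lemma segment_of_inj : {in edge_codes &, injective segment_of}.
Proof.
move=> e e' ee ee' h; apply: (listing_eq (edge_code_listing ee) (edge_code_listing ee')).
exact: (coded_set_eq point_of_inj (edge_code_sub ee) (edge_code_sub ee') h).
Qed.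

Lemma seg_pair x y : segment_of [:: x; y] = [set point_of x; point_of y].
Proof.
apply/seteqP; split=> [_ [z /= zxy <-]|_ [->|->]].
- by move: zxy; rewrite !inE => /orP[]/eqP->; [left | right].
- by exists x; rewrite //= !inE eqxx.
- by exists y; rewrite //= !inE eqxx orbT.
Qed.

Lemma seg_listing l : {subset l <= vertex_codes} ->
  segment_of (listing vertex_codes l) = segment_of l.
Proof. by move=> h; exact/eq_coded_set/listing_mem. Qed.

Lemma pair_sub x y : x \in vertex_codes -> y \in vertex_codes ->
  {subset [:: x; y] <= vertex_codes}.
Proof. by move=> xv yv z; rewrite in_cons mem_seq1 => /orP[]/eqP->. Qed.

Lemma flip_codes j x : (j < 4)%N -> x \in vertex_codes -> flip j x \in vertex_codes.
Proof.
move=> j4 /vertex_code_size sx; apply: mem_vertex_codes.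
by rewrite size_set_nth sx; apply/maxn_idPr.
Qed.

Lemma seg_cube e : e \in edge_codes -> cube_edges (segment_of e).
Proof.
have h : all (fun e => has (fun x => has (fun j =>
    e == listing vertex_codes [:: x; flip j x]) (iota 0 4)) vertex_codes) edge_codes.
  by vm_compute.
move=> /(allP h)/hasP[x xv /hasP[j]]; rewrite mem_iota => /andP[_ j4] /eqP ->.
rewrite seg_listing; last exact: pair_sub (flip_codes j4 xv).
rewrite seg_pair; exists (point_of x), (point_of (flip j x)).
split; [exact: vec_cube | exact: vec_cube | | by []].
exists (Ordinal j4); split=> [|i]; rewrite !vecE /flip nth_set_nth /=.
  by rewrite eqxx => /signr_inj; case: (nth _ _ _).
by case: eqP => [e' _|//]; exact: val_inj.
Qed.

Lemma cube_seg E : cube_edges E -> exists2 e, e \in edge_codes & E = segment_of e.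
Proof.
case=> _ [_ [/cube_vec[x xv ->] /cube_vec[y yv ->] [j [xj uj]] ->]].
have ey : y = flip j x.
  have sx := vertex_code_size xv; have sy := vertex_code_size yv.
  apply: (@eq_from_nth _ false) => [|i]; rewrite sy.
    by rewrite vertex_code_size // flip_codes.
  move=> i4; rewrite /flip nth_set_nth /=; case: eqP => [->|ij].
    by move: xj; rewrite !vecE; do 2 case: (nth _ _ _).
  apply/eqP; apply: contraT => nxy; case: ij.
  rewrite -[i]/(val (Ordinal i4)) (uj (Ordinal i4)) // !vecE => /signr_inj /= h.
  by rewrite h eqxx in nxy.
have j4 : val j \in iota 0 4 by rewrite mem_iota ltn_ord.
have h : all (fun x => all (fun j =>
    listing vertex_codes [:: x; flip j x] \in edge_codes) (iota 0 4)) vertex_codes.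
  by vm_compute.
exists (listing vertex_codes [:: x; y]).
  by rewrite ey; exact: (allP (allP h x xv) _ j4).
by rewrite seg_listing ?seg_pair //; exact: pair_sub.
Qed.

Lemma map_turn_sub k e : {subset e <= vertex_codes} ->
  {subset map (turn_vertex k) e <= vertex_codes}.
Proof. by move=> h _ /mapP[x /h xv ->]; exact: turn_vertex_codes. Qed.

Lemma rot_seg k e : (k < 3)%N -> e \in edge_codes ->
  rot_segment (sig k) (segment_of e) = segment_of (turn_edge k e).
Proof.
move=> k3 ee; have es := edge_code_sub ee.
rewrite /turn_edge seg_listing; last exact: map_turn_sub.
apply/seteqP; split=> [_ [_ [x /= xe <-] <-]|_ [_ /= /mapP[x xe ->] <-]].
  by rewrite rot_vec //; exists (turn_vertex k x) => //; exact: map_f.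
by rewrite -rot_vec //; exists (point_of x) => //; exists x.
Qed.

Lemma turn_edge_codes k e : (k < 3)%N -> e \in edge_codes -> turn_edge k e \in edge_codes.
Proof.
have h : all (fun k => all (fun e => turn_edge k e \in edge_codes) edge_codes) (iota 0 3).
  by vm_compute.
by move=> k3 ee; exact: (allP (all_iotaP h k3)).
Qed.

Lemma octagon_code_sub c : c \in octagon_codes -> {subset c <= edge_codes}.
Proof.
have h : all (all (mem edge_codes)) octagon_codes by vm_compute.
by move/(allP h)/allP.
Qed.

Lemma octagon_code_listing c : c \in octagon_codes -> listing edge_codes c = c.
Proof.
have h : all (fun c => listing edge_codes c == c) octagon_codes by vm_compute.
by move/(allP h)/eqP.
Qed.

Lemma octagon_code_vertices c : {subset c <= edge_codes} ->
  {subset flatten c <= vertex_codes}.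
Proof. by move=> h x /flattenP[e /h/edge_code_sub]; exact. Qed.

Lemma octagon_of_inj : {in octagon_codes &, injective octagon_of}.
Proof.
move=> c c' cc cc' h.
apply: (listing_eq (octagon_code_listing cc) (octagon_code_listing cc')).
apply: (coded_set_eq segment_of_inj (octagon_code_sub cc) (octagon_code_sub cc')).
exact: (congr1 (@polygon_edges R) h).
Qed.

Lemma rot_poly k c : (k < 3)%N -> c \in octagon_codes ->
  rot_polygon (sig k) (octagon_of c) = octagon_of (turn_octagon k c).
Proof.
move=> k3 cc; have cs := octagon_code_sub cc.
have te : {subset map (turn_edge k) c <= edge_codes}.
  by move=> _ /mapP[e /cs ee ->]; exact: turn_edge_codes.
have me : turn_octagon k c =i map (turn_edge k) c := listing_mem te.
congr Polygon; apply/seteqP; split.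
- move=> _ [_ [x /= /flattenP[e ec xe] <-] <-]; rewrite rot_vec //.
  exists (turn_vertex k x) => //=; apply/flattenP; exists (turn_edge k e).
    by rewrite me map_f.
  by rewrite listing_mem ?map_f //; exact/map_turn_sub/edge_code_sub/cs.
- move=> _ [y /= /flattenP[e' + ye] <-]; rewrite me => /mapP[e ec ee'].
  move: ye; rewrite ee' listing_mem; last exact/map_turn_sub/edge_code_sub/cs.
  move=> /mapP[x xe ->]; rewrite -rot_vec //; exists (point_of x) => //.
  by exists x => //=; apply/flattenP; exists e.
- move=> _ [_ [e /= ec <-] <-]; rewrite rot_seg //; last exact: cs.
  by exists (turn_edge k e) => //=; rewrite me map_f.
- move=> _ [e' /= + <-]; rewrite me => /mapP[e ec ->].
  by rewrite -rot_seg //; [exists (segment_of e) => //; exists e | exact: cs].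
Qed.

Lemma turn_octagon_codes k c : (k < 3)%N -> c \in octagon_codes ->
  turn_octagon k c \in octagon_codes.
Proof.
have h : all (fun k => all (fun c => turn_octagon k c \in octagon_codes) octagon_codes)
  (iota 0 3) by vm_compute.
by move=> k3 cc; exact: (allP (all_iotaP h k3)).
Qed.

Lemma petrie_vec (k : 'I_8) : petrie_vertex R k = point_of (petrie_code k).
Proof.
rewrite /petrie_vertex; move: (val k) => {}k; elim: k => [|k IH].
  rewrite expg0 rot_point1; apply/rowP => j; rewrite !mxE.
  by case: j => -[|[|[|[|]]]].
by rewrite expgSr rot_pointM IH (rot_vec (k := 0)).
Qed.

Lemma petrie_codeP k : petrie_code k \in vertex_codes.
Proof. by case: k => [|k] //; exact: mem_vertex_codes. Qed.

Lemma base_octagonE : base_octagon R = octagon_of base_octagon_code.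
Proof.
pose edge k := listing vertex_codes [:: petrie_code k; petrie_code k.+1].
have be : base_octagon_code =i map edge (iota 0 8).
  by apply/perm_mem; vm_compute.
have bv : flatten base_octagon_code =i map petrie_code (iota 0 8).
  have h : perm_eq (undup (flatten base_octagon_code)) (map petrie_code (iota 0 8)).
    by vm_compute.
  by move=> x; rewrite -mem_undup (perm_mem h).
have pS (k : 'I_8) : [set petrie_vertex R k; petrie_vertex R (ordS k)] = segment_of (edge k).
  rewrite /edge seg_listing; last exact: pair_sub (petrie_codeP _) (petrie_codeP _).
  rewrite seg_pair !petrie_vec; congr [set _; point_of _].
  by case: k => -[|[|[|[|[|[|[|[|]]]]]]]].
congr Polygon; apply/seteqP; split.
- move=> _ [k _ <-]; rewrite petrie_vec; exists (petrie_code k) => //=.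
  by rewrite bv map_f // mem_iota ltn_ord.
- move=> _ [x /= + <-]; rewrite bv => /mapP[k + ->]; rewrite mem_iota => /andP[_ k8].
  by exists (Ordinal k8) => //; rewrite petrie_vec.
- move=> _ [k _ <-]; rewrite pS; exists (edge k) => //=.
  by rewrite be map_f // mem_iota ltn_ord.
- move=> _ [e /= + <-]; rewrite be => /mapP[k + ->]; rewrite mem_iota => /andP[_ k8].
  by exists (Ordinal k8) => //; rewrite pS.
Qed.

End Coordinates.

Section FaceCoding.
Variable R : realType.

Local Notation sig k := (sigma R (generator k)).

Lemma gens3 : [set sigma1 R; sigma2 R; sigma3 R] =
  [set sig k | k in [set` [:: 0; 1; 2]%N]].
Proof.
apply/seteqP; split=> [_ [[->|->]|->]|_ [k /= + <-]].
- by exists 0%N.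
- by exists 1%N.
- by exists 2%N.
- by rewrite !inE => /or3P[]/eqP->; [left; left | left; right | right].
Qed.

Lemma gens2 : [set sigma1 R; sigma2 R] = [set sig k | k in [set` [:: 0; 1]%N]].
Proof.
apply/seteqP; split=> [_ [->|->]|_ [k /= + <-]].
- by exists 0%N.
- by exists 1%N.
- by rewrite !inE => /orP[]/eqP->; [left | right].
Qed.

Lemma ks3_lt k : k \in [:: 0; 1; 2]%N -> (k < 3)%N.
Proof. by rewrite !inE => /or3P[]/eqP->. Qed.

Lemma ks2_lt k : k \in [:: 0; 1]%N -> (k < 3)%N.
Proof. by rewrite !inE => /orP[]/eqP->. Qed.

(** The octagons are those with a code in the list; likewise for the facets. *)
Lemma roli_octagonsE : @roli_octagons R = octagon_of R @` [set` octagon_codes].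
Proof.
have onto : all (fun k => all (fun c => c \in map (turn_octagon k) octagon_codes)
  octagon_codes) (iota 0 3) by vm_compute.
have sub : all (mem (closure_by turn_octagon [:: 0; 1; 2]%N 6 base_octagon_code))
  octagon_codes by vm_compute.
rewrite /roli_octagons base_octagonE -rotation_generated.
apply: (@orbit_eq _ _ (@rot_polygon R) (@rot_polygon1 R) (@rot_polygonM R) _ _ _
  gens3 _ (octagon_of R) turn_octagon octagon_codes _ _ _ 6).
- by move=> k c /ks3_lt; exact: rot_poly.
- by move=> k c /ks3_lt; exact: turn_octagon_codes.
- by move=> k c /ks3_lt k3 cc; exact: (allP (all_iotaP onto k3)).
- by vm_compute.
- exact/allP.
Qed.

Definition base_edge_code : seq (seq bool) :=
  listing vertex_codes [:: base_vertex_code; flip 0 base_vertex_code].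

(** The second end of the base edge is recognised by its image under sigma_1,
which is the base vertex. *)
Lemma base_edgeE : @base_edge R = @segment_of R base_edge_code.
Proof.
rewrite /base_edge_code seg_listing; last exact: pair_sub.
have bE : base_vertex R = point_of R base_vertex_code.
  by apply/rowP => j; rewrite vecE mxE; case: j => -[|[|[|[|]]]].
rewrite seg_pair -bE; congr [set _; _].
apply: (@rot_point_inj R (sig 0)); rewrite rot_vec // -rot_pointM mulVg.
by rewrite rot_point1 bE.
Qed.

Lemma facet_code_sub f : f \in facet_codes -> {subset f <= octagon_codes}.
Proof.
have h : all (all (mem octagon_codes)) facet_codes by vm_compute.
by move/(allP h)/allP.
Qed.

Lemma base_facet_in : base_facet_code \in facet_codes.
Proof. by vm_compute. Qed.

Lemma base_facetE : base_facet R = cell_of R base_facet_code.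
Proof.
have bs := facet_code_sub base_facet_in.
rewrite /base_facet base_edgeE base_octagonE; congr Cell.
- have h : perm_eq (undup (flatten (flatten base_facet_code))) vertex_codes.
    by vm_compute.
  apply/seteqP; split=> [y /cube_vec[x xv ->]|_ [x _ <-]]; last exact: vec_cube.
  by exists x => //=; rewrite -mem_undup (perm_mem h).
- have u := @eq_coded_set _ _ (@segment_of R) _ _ (mem_undup (flatten base_facet_code)).
  rewrite -u.
  have fe : all (fun e => e \in edge_codes) (undup (flatten base_facet_code)).
    by vm_compute.
  have cl : all (fun k => all (fun e => (turn_edge k e \in undup (flatten base_facet_code))
      && (e \in map (turn_edge k) (undup (flatten base_facet_code))))
    (undup (flatten base_facet_code))) [:: 0; 1]%N by vm_compute.
  have sub : all (mem (closure_by turn_edge [:: 0; 1]%N 12 base_edge_code))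
    (undup (flatten base_facet_code)) by vm_compute.
  apply: (@orbit_eq _ _ (@rot_segment R) (@rot_segment1 R) (@rot_segmentM R) _ _ _
    gens2 _ (@segment_of R) turn_edge (undup (flatten base_facet_code)) _ _ _ 12).
  + by move=> k e /ks2_lt k3 /(allP fe); exact: rot_seg.
  + by move=> k e kk ee; have /andP[] := allP (allP cl k kk) e ee.
  + by move=> k e kk ee; have /andP[] := allP (allP cl k kk) e ee.
  + by vm_compute.
  + exact/allP.
- have cl : all (fun k => all (fun e => (turn_octagon k e \in base_facet_code)
      && (e \in map (turn_octagon k) base_facet_code)) base_facet_code) [:: 0; 1]%N.
    by vm_compute.
  have sub : all (mem (closure_by turn_octagon [:: 0; 1]%N 6 base_octagon_code))
    base_facet_code by vm_compute.
  apply: (@orbit_eq _ _ (@rot_polygon R) (@rot_polygon1 R) (@rot_polygonM R) _ _ _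
    gens2 _ (octagon_of R) turn_octagon base_facet_code _ _ _ 6).
  + by move=> k c /ks2_lt k3 /bs; exact: rot_poly.
  + by move=> k e kk ee; have /andP[] := allP (allP cl k kk) e ee.
  + by move=> k e kk ee; have /andP[] := allP (allP cl k kk) e ee.
  + by vm_compute.
  + exact/allP.
Qed.

Lemma facet_code_listing f : f \in facet_codes -> listing octagon_codes f = f.
Proof.
have h : all (fun f => listing octagon_codes f == f) facet_codes by vm_compute.
by move/(allP h)/eqP.
Qed.

Lemma cell_inj : {in facet_codes &, injective (cell_of R)}.
Proof.
move=> f f' ff ff' h.
apply: (listing_eq (facet_code_listing ff) (facet_code_listing ff')).
apply: (coded_set_eq (@octagon_of_inj R) (facet_code_sub ff) (facet_code_sub ff')).
exact: (congr1 (@cell_polygons R) h).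
Qed.

Lemma octagons_sub f : {subset f <= octagon_codes} -> {subset flatten f <= edge_codes}.
Proof. by move=> h e /flattenP[c /h/octagon_code_sub]; exact. Qed.

Lemma rot_facet k f : (k < 3)%N -> f \in facet_codes ->
  rot_cell (sig k) (cell_of R f) = cell_of R (turn_facet k f).
Proof.
move=> k3 ff; have fs := facet_code_sub ff.
have tf : {subset map (turn_octagon k) f <= octagon_codes}.
  by move=> _ /mapP[c /fs cc ->]; exact: turn_octagon_codes.
have me : turn_facet k f =i map (turn_octagon k) f := listing_mem tf.
have rp c : c \in f -> rot_polygon (sig k) (octagon_of R c) = octagon_of R (turn_octagon k c).
  by move=> /fs; exact: rot_poly.
have parts (Y : Type) (part : polygon R -> set Y) (rot : Y -> Y) (T : eqType)
    (cd : T -> Y) (sub : seq (seq (seq bool)) -> seq T) :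
    (forall c, part (octagon_of R c) = cd @` [set` sub c]) ->
    (forall c, part (rot_polygon (sig k) c) = rot @` part c) ->
    rot @` (cd @` [set` flatten (map sub f)]) =
    cd @` [set` flatten (map sub (turn_facet k f))].
  move=> pE rE; have step c : c \in f ->
      rot @` (cd @` [set` sub c]) = cd @` [set` sub (turn_octagon k c)].
    by move=> cf; rewrite -!pE -rE rp.
  apply/seteqP; split=> [_ [_ [x /= /flatten_mapP[c cf xc] <-] <-]|].
    have : (rot @` (cd @` [set` sub c])) (rot (cd x)) by exists (cd x) => //; exists x.
    rewrite step // => -[y /= yc <-]; exists y => //=.
    by apply/flatten_mapP; exists (turn_octagon k c); rewrite // me map_f.
  move=> _ [y /= /flatten_mapP[c' + yc] <-]; rewrite me => /mapP[c cf ec].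
  have : (cd @` [set` sub (turn_octagon k c)]) (cd y) by exists y; rewrite //= -ec.
  rewrite -step // => -[_ [x /= xc <-] <-]; exists (cd x) => //.
  by exists x => //=; apply/flatten_mapP; exists c.
have ffm (T : eqType) (s : seq (seq (seq T))) : flatten (flatten s) = flatten (map flatten s).
  by elim: s => //= a s IH; rewrite flatten_cat IH.
congr Cell.
- rewrite /= !ffm; apply: (parts _ (@polygon_vertices R) _ _ (point_of R) flatten) => //.
- have := parts _ (@polygon_edges R) (rot_segment (sig k)) _ (@segment_of R) id.
  by rewrite !map_id; apply.
- apply/seteqP; split=> [_ [_ [c /= cf <-] <-]|_ [c' /= + <-]].
    by exists (turn_octagon k c); rewrite /= ?me ?map_f // rp.
  by rewrite me => /mapP[c cf ->]; rewrite -rp //; exists (octagon_of R c) => //; exists c.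
Qed.

Lemma turn_facet_codes k f : (k < 3)%N -> f \in facet_codes ->
  turn_facet k f \in facet_codes.
Proof.
have h : all (fun k => all (fun f => turn_facet k f \in facet_codes) facet_codes)
  (iota 0 3) by vm_compute.
by move=> k3 ff; exact: (allP (all_iotaP h k3)).
Qed.

Lemma roli_facetsE : @roli_facets R = cell_of R @` [set` facet_codes].
Proof.
have cl : all (fun k => all (fun f => (turn_facet k f \in facet_codes) &&
    (f \in map (turn_facet k) facet_codes)) facet_codes) [:: 0; 1; 2]%N.
  by vm_compute.
have sub : all (mem (closure_by turn_facet [:: 0; 1; 2]%N 3 base_facet_code))
  facet_codes by vm_compute.
rewrite /roli_facets base_facetE -rotation_generated.
apply: (@orbit_eq _ _ (@rot_cell R) (@rot_cell1 R) (@rot_cellM R) _ _ _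
  gens3 _ (cell_of R) turn_facet facet_codes _ _ _ 3).
- by move=> k c /ks3_lt; exact: rot_facet.
- by move=> k f kk ff; have /andP[] := allP (allP cl k kk) f ff.
- by move=> k f kk ff; have /andP[] := allP (allP cl k kk) f ff.
- exact: base_facet_in.
- exact/allP.
Qed.

(** The face with a given code; the value on codes that do not belong to the cube
is irrelevant. *)
Definition face_of (c : face_code) : roli_cube R :=
  match c with
  | LeastCode => RoliLeast R
  | VertexCode x => oapp (@RoliVertex R) (RoliLeast R) (insub (point_of R x))
  | EdgeCode e => oapp (@RoliEdge R) (RoliLeast R) (insub (@segment_of R e))
  | OctagonCode o => oapp (@RoliOctagon R) (RoliLeast R) (insub (octagon_of R o))
  | FacetCode f => oapp (@RoliFacet R) (RoliLeast R) (insub (cell_of R f))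
  | GreatestCode => RoliGreatest R
  end.

Definition valid_code (c : face_code) : bool :=
  match c with
  | VertexCode x => x \in vertex_codes
  | EdgeCode e => e \in edge_codes
  | OctagonCode o => o \in octagon_codes
  | FacetCode f => f \in facet_codes
  | _ => true
  end.

Definition code_lev (c : face_code) : nat :=
  match c with
  | LeastCode => 0
  | VertexCode _ => 1
  | EdgeCode _ => 2
  | OctagonCode _ => 3
  | FacetCode _ => 4
  | GreatestCode => 5
  end.

Lemma face_of_vertex x : exists2 u : @cube_vertices R,
  val u = point_of R x & face_of (VertexCode x) = RoliVertex u.
Proof.
exists (SigSub (mem_set (vec_cube R x))) => //=.
by rewrite (insubT (fun y => y \in @cube_vertices R) (mem_set (vec_cube R x))).
Qed.

Lemma face_of_edge e : e \in edge_codes -> exists2 u : @cube_edges R,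
  val u = @segment_of R e & face_of (EdgeCode e) = RoliEdge u.
Proof.
move=> ee; exists (SigSub (mem_set (seg_cube R ee))) => //=.
by rewrite (insubT (fun y => y \in @cube_edges R) (mem_set (seg_cube R ee))).
Qed.

Lemma face_of_octagon c : c \in octagon_codes -> exists2 u : @roli_octagons R,
  val u = octagon_of R c & face_of (OctagonCode c) = RoliOctagon u.
Proof.
move=> cc; have h : @roli_octagons R (octagon_of R c) by rewrite roli_octagonsE; exists c.
exists (SigSub (mem_set h)) => //=.
by rewrite (insubT (fun y => y \in @roli_octagons R) (mem_set h)).
Qed.

Lemma face_of_facet f : f \in facet_codes -> exists2 u : @roli_facets R,
  val u = cell_of R f & face_of (FacetCode f) = RoliFacet u.
Proof.
move=> ff; have h : @roli_facets R (cell_of R f) by rewrite roli_facetsE; exists f.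
exists (SigSub (mem_set h)) => //=.
by rewrite (insubT (fun y => y \in @roli_facets R) (mem_set h)).
Qed.

End FaceCoding.

(** * The incidence table of the cube *)

Lemma code_le_anti c d : code_le c d -> code_le d c -> c = d.
Proof.
case: c => [|x|e|o|f|]; case: d => [|x'|e'|o'|f'|] //=;
  by move=> /eqP->.
Qed.

Lemma nth_code_valid a : (a < 66)%N ->
  valid_code (nth_code a) /\ code_lev (nth_code a) = roli_lev a.
Proof.
have h : all (fun a => valid_code (nth_code a) &&
    (code_lev (nth_code a) == roli_lev a)) (iota 0 66) by vm_compute.
by move/(all_iotaP h)/andP=> [-> /eqP].
Qed.

Lemma valid_code_nth c : valid_code c -> exists2 a, (a < 66)%N & nth_code a = c.
Proof.
pose found c := has (fun a => code_le c (nth_code a) && code_le (nth_code a) c) (iota 0 66).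
have fE d : found d -> exists2 a, (a < 66)%N & nth_code a = d.
  move=> /hasP[a]; rewrite mem_iota => /andP[_ an] /andP[h1 h2].
  by exists a => //; exact: code_le_anti.
have hV : all (fun x => found (VertexCode x)) vertex_codes by vm_compute.
have hE : all (fun x => found (EdgeCode x)) edge_codes by vm_compute.
have hO : all (fun x => found (OctagonCode x)) octagon_codes by vm_compute.
have hF : all (fun x => found (FacetCode x)) facet_codes by vm_compute.
case: c => [_|x|e|o|f|_].
- by exists 0%N.
- by move/(allP hV)/fE.
- by move/(allP hE)/fE.
- by move/(allP hO)/fE.
- by move/(allP hF)/fE.
- by exists 65%N.
Qed.

Section Coding.
Variable R : realType.

(** The face of index a. *)
Definition roli_phi (a : nat) : roli_cube R := face_of R (nth_code a).

Lemma face_of_rank c : valid_code c ->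
  prank (face_of R c) = (code_lev c)%:Z - 1.
Proof.
case: c => [|x|e|o|f|] // v.
- by have [u _ ->] := face_of_vertex R x.
- by have [u _ ->] := face_of_edge R v.
- by have [u _ ->] := face_of_octagon R v.
- by have [u _ ->] := face_of_facet R v.
Qed.

Lemma face_of_le c d : valid_code c -> valid_code d ->
  ple (face_of R c) (face_of R d) <-> code_le c d.
Proof.
have octv c' : c' \in octagon_codes -> {subset flatten c' <= vertex_codes}.
  by move=> cc; apply: octagon_code_vertices; exact: octagon_code_sub.
have face_e f : f \in facet_codes -> {subset flatten f <= edge_codes}.
  by move=> ff; apply: octagons_sub; exact: facet_code_sub.
case: c => [|x|e|o|f|] vc.
- by split=> _; [exact: isT | exact: I].
- have [u eu ->] := face_of_vertex R x.
  case: d => [|x'|e'|o'|f'|] vd.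
  + by split=> h; discriminate h.
  + have [w ew ->] := face_of_vertex R x'.
    split=> [[uw]|/eqP xx]; last by congr RoliVertex; apply: val_inj; rewrite eu ew xx.
    by apply/eqP; apply: (@point_of_inj R _ _ vc vd); rewrite -eu -ew uw.
  + have [w ew ->] := face_of_edge R vd.
    rewrite /= eu ew; exact: (coded_mem (@point_of_inj R) (edge_code_sub vd) vc).
  + have [w ew ->] := face_of_octagon R vd.
    rewrite /= eu ew; exact: (coded_mem (@point_of_inj R) (octv _ vd) vc).
  + have [w ew ->] := face_of_facet R vd.
    rewrite /= eu ew; exact: (coded_mem (@point_of_inj R) (octagon_code_vertices (face_e _ vd)) vc).
  + by split=> _; [exact: isT | exact: I].
- have [u eu ->] := face_of_edge R vc.
  case: d => [|x'|e'|o'|f'|] vd.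
  + by split=> h; discriminate h.
  + have [w ew ->] := face_of_vertex R x'.
    by split=> h; discriminate h.
  + have [w ew ->] := face_of_edge R vd.
    split=> [[uw]|/eqP xx]; last by congr RoliEdge; apply: val_inj; rewrite eu ew xx.
    by apply/eqP; apply: (@segment_of_inj R _ _ vc vd); rewrite -eu -ew uw.
  + have [w ew ->] := face_of_octagon R vd.
    rewrite /= eu ew; exact: (coded_mem (@segment_of_inj R) (octagon_code_sub vd) vc).
  + have [w ew ->] := face_of_facet R vd.
    rewrite /= eu ew; exact: (coded_mem (@segment_of_inj R) (face_e _ vd) vc).
  + by split=> _; [exact: isT | exact: I].
- have [u eu ->] := face_of_octagon R vc.
  case: d => [|x'|e'|o'|f'|] vd.
  + by split=> h; discriminate h.
  + have [w ew ->] := face_of_vertex R x'.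
    by split=> h; discriminate h.
  + have [w ew ->] := face_of_edge R vd.
    by split=> h; discriminate h.
  + have [w ew ->] := face_of_octagon R vd.
    split=> [[uw]|/eqP xx]; last by congr RoliOctagon; apply: val_inj; rewrite eu ew xx.
    by apply/eqP; apply: (@octagon_of_inj R _ _ vc vd); rewrite -eu -ew uw.
  + have [w ew ->] := face_of_facet R vd.
    rewrite /= eu ew; exact: (coded_mem (@octagon_of_inj R) (facet_code_sub vd) vc).
  + by split=> _; [exact: isT | exact: I].
- have [u eu ->] := face_of_facet R vc.
  case: d => [|x'|e'|o'|f'|] vd.
  + by split=> h; discriminate h.
  + have [w ew ->] := face_of_vertex R x'.
    by split=> h; discriminate h.
  + have [w ew ->] := face_of_edge R vd.
    by split=> h; discriminate h.
  + have [w ew ->] := face_of_octagon R vd.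
    by split=> h; discriminate h.
  + have [w ew ->] := face_of_facet R vd.
    split=> [[uw]|/eqP xx]; last by congr RoliFacet; apply: val_inj; rewrite eu ew xx.
    by apply/eqP; apply: (@cell_inj R _ _ vc vd); rewrite -eu -ew uw.
  + by split=> _; [exact: isT | exact: I].
- case: d => [|x'|e'|o'|f'|] vd.
  + by split=> h; discriminate h.
  + have [w _ ->] := face_of_vertex R x'; by split=> h; discriminate h.
  + have [w _ ->] := face_of_edge R vd; by split=> h; discriminate h.
  + have [w _ ->] := face_of_octagon R vd; by split=> h; discriminate h.
  + have [w _ ->] := face_of_facet R vd; by split=> h; discriminate h.
  + by split=> _; [exact: isT | exact: I].
Qed.

Lemma face_of_surj F : exists2 c, valid_code c & face_of R c = F.
Proof.
case: F => [|u|u|u|u|]; first by exists LeastCode.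
- have [x xv e] := cube_vec (set_valP u).
  exists (VertexCode x) => //; have [w ew ->] := face_of_vertex R x.
  by congr RoliVertex; apply: val_inj; rewrite ew.
- have [x xv e] := cube_seg (set_valP u).
  exists (EdgeCode x) => //; have [w ew ->] := face_of_edge R xv.
  by congr RoliEdge; apply: val_inj; rewrite ew.
- have coded y : @roli_octagons R y -> (octagon_of R @` [set` octagon_codes]) y by rewrite roli_octagonsE.
  have [x /= xv e] := coded _ (set_valP u).
  exists (OctagonCode x) => //; have [w ew ->] := face_of_octagon R xv.
  by congr RoliOctagon; apply: val_inj; rewrite ew.
- have coded y : @roli_facets R y -> (cell_of R @` [set` facet_codes]) y by rewrite roli_facetsE.
  have [x /= xv e] := coded _ (set_valP u).
  exists (FacetCode x) => //; have [w ew ->] := face_of_facet R xv.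
  by congr RoliFacet; apply: val_inj; rewrite ew.
- by exists GreatestCode.
Qed.

Lemma roli_coding : coding 66 roli_le roli_lev roli_phi.
Proof.
split=> [F|a b an bn|a an].
- by have [c /valid_code_nth[a an <-] <-] := face_of_surj F; exists a.
- have [va _] := nth_code_valid an; have [vb _] := nth_code_valid bn.
  by rewrite roli_leE //; exact: face_of_le.
- have [va <-] := nth_code_valid an; exact: face_of_rank.
Qed.

Lemma rot_face_of k c : (k < 3)%N -> valid_code c ->
  rot_face (sigma R (generator k)) (face_of R c) = face_of R (turn_code k c).
Proof.
move=> k3; case: c => [|x|e|o|f|] v; rewrite [turn_code _ _]/=.
- by [].
- have [u eu ->] := face_of_vertex R x; have [w ew ->] := face_of_vertex R (turn_vertex k x).
  by congr RoliVertex; apply: val_inj; rewrite /= eu ew rot_vec.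
- have [u eu ->] := face_of_edge R v.
  have [w ew ->] := face_of_edge R (turn_edge_codes k3 v).
  by congr RoliEdge; apply: val_inj; rewrite /= eu ew rot_seg.
- have [u eu ->] := face_of_octagon R v.
  have [w ew ->] := face_of_octagon R (turn_octagon_codes k3 v).
  by congr RoliOctagon; apply: val_inj; rewrite /= eu ew rot_poly.
- have [u eu ->] := face_of_facet R v.
  have [w ew ->] := face_of_facet R (turn_facet_codes k3 v).
  by congr RoliFacet; apply: val_inj; rewrite /= eu ew rot_facet.
- by [].
Qed.

Lemma rot_phi k a : (k < 3)%N -> (a < 66)%N ->
  (turn_index k a < 66)%N /\
  rot_face (sigma R (generator k)) (roli_phi a) = roli_phi (turn_index k a).
Proof.
move=> k3 an; have [tn te] := roli_turnE k3 an; split=> //.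
have [va _] := nth_code_valid an.
by rewrite /roli_phi te; exact: rot_face_of.
Qed.

End Coding.

(** * Flag orbits, automorphisms and chirality *)

(** The permutations of the flags induced by the three generators. *)
Definition flag_turn_table : seq (seq nat) := Eval vm_compute in
  [seq [seq index (map (turn_index k) t) roli_flags | t <- roli_flags]
  | k <- iota 0 3].

Definition flag_turn (k i : nat) : nat := nth 0%N (nth [::] flag_turn_table k) i.

(** Representatives of the two orbits of flags: the first flag and its neighbour
with another vertex. *)
Definition two_flags : seq nat := [:: 0%N; roli_adj 0 1].

(** For each flag, the representative of its orbit and the position of a word
that moves the representative to the flag. *)
Definition flag_place : seq (nat * nat) := Eval vm_compute in
  let orb := [seq [seq foldl (fun i k => flag_turn k i) b w | w <- word_codes]
             | b <- two_flags] in
  [seq if i \in nth [::] orb 0 then (0%N, index i (nth [::] orb 0))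
       else (1%N, index i (nth [::] orb 1)) | i <- iota 0 384].

Lemma flag_turnE k i : (k < 3)%N -> (i < 384)%N ->
  (flag_turn k i < 384)%N /\
  nth [::] roli_flags (flag_turn k i) = map (turn_index k) (nth [::] roli_flags i).
Proof.
move=> k3 il; split; first by apply: nested_table_lt; [by [] | vm_compute].
have e : [seq map (nth [::] roli_flags) r | r <- flag_turn_table] =
    [seq map (map (turn_index k)) roli_flags | k <- iota 0 3] by vm_compute.
by apply: (nested_tableE [::] e k3); rewrite size_roli_flags.
Qed.

Lemma flag_reached i : (i < 384)%N -> exists b w,
  [/\ b \in two_flags, all (mem [:: 0; 1; 2]%N) w
    & foldl (fun i k => flag_turn k i) b w = i].
Proof.
have h : all (fun i => let u := nth (0, 0)%N flag_place i in
    let b := nth 0%N two_flags u.1 in let w := nth [::] word_codes u.2 in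
    [&& b \in two_flags, all (mem [:: 0; 1; 2]%N) w &
      foldl (fun i k => flag_turn k i) b w == i]) (iota 0 384) by vm_compute.
move=> il; have /and3P[bt wk /eqP e] := all_iotaP h il.
by do 2 eexists; split; [exact: bt | exact: wk | exact: e].
Qed.

Section RoliAutomorphisms.
Variable R : realType.

Local Notation sig k := (sigma R (generator k)).
Local Notation P := (roli_cube R).

(** The i-th flag as a set of faces. *)
Definition roli_flag (i : nat) : set P :=
  flag_of (roli_phi R) (nth [::] roli_flags i).

Definition rot_flag (g : rotation R) (Phi : set P) : set P := rot_face g @` Phi.

Lemma rot_flag1 Phi : rot_flag 1%g Phi = Phi.
Proof. by rewrite /rot_flag -[RHS]image_id; apply: eq_imagel => F _; exact: rot_face1. Qed.

Lemma rot_flagM g h Phi : rot_flag (g * h)%g Phi = rot_flag h (rot_flag g Phi).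
Proof. by rewrite /rot_flag image_comp; apply: eq_imagel => F _; exact: rot_faceM. Qed.

Lemma rot_roli_flag k i : (k < 3)%N -> (i < 384)%N ->
  rot_flag (sig k) (roli_flag i) = roli_flag (flag_turn k i).
Proof.
move=> k3 il; have [_ e] := flag_turnE k3 il.
rewrite /rot_flag /roli_flag e; apply: automorphism_flag_of.
  by move=> a an; exact: rot_phi.
by apply/roli_flagsP/mem_nth; rewrite size_roli_flags.
Qed.

Lemma two_flagsP b : b \in two_flags -> b = 0%N \/ b = roli_adj 0 1.
Proof. by rewrite /two_flags in_cons mem_seq1 => /orP[]/eqP->; [left | right]. Qed.

Lemma two_flags_lt b : b \in two_flags -> (b < 384)%N.
Proof.
by rewrite /two_flags in_cons mem_seq1 => /orP[]/eqP->; [ | vm_compute].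
Qed.

Lemma roli_flag_orbits i : (i < 384)%N ->
  exists b g, b \in two_flags /\ rot_flag g (roli_flag b) = roli_flag i.
Proof.
move=> /flag_reached[b [w [bt wk <-]]].
have bL : b \in iota 0 384 by rewrite mem_iota two_flags_lt.
have turned k x : k \in [:: 0; 1; 2]%N -> x \in iota 0 384 ->
    rot_flag (sig k) (roli_flag x) = roli_flag (flag_turn k x).
  by rewrite mem_iota => /ks3_lt k3 /andP[_ xl]; exact: rot_roli_flag.
have closed k x : k \in [:: 0; 1; 2]%N -> x \in iota 0 384 ->
    flag_turn k x \in iota 0 384.
  rewrite !mem_iota => /ks3_lt k3 /andP[_ xl].
  by have [yl _] := flag_turnE k3 xl.
have [g _ e] := orbit_word rot_flag1 rot_flagM (gens3 R) turned closed wk bL.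
by exists b, g.
Qed.

Lemma roli_flagP Phi : flag Phi <-> exists2 i, (i < 384)%N & Phi = roli_flag i.
Proof.
have := listed_flagP roli_table (roli_coding R) roli_flagsP Phi.
by rewrite size_roli_flags.
Qed.

Local Notation handed := (closed_walk roli_adj petrie_walk).

(** Handedness is invariant under automorphisms. *)
Lemma same_aut_handed i j : (i < 384)%N -> (j < 384)%N ->
  same_aut_orbit (roli_flag i) (roli_flag j) -> handed i = handed j.
Proof.
move=> il jl [f [fA fij]].
by apply: (automorphism_closed_walk roli_table (roli_coding R) roli_flagsP
  roli_flags_uniq roli_adjP fA petrie_walk_range _ _ fij); rewrite size_roli_flags.
Qed.

(** Chirality with respect to any orbit relation between that of the rotations
and that of the automorphisms: by handedness there are exactly the two orbits
of the rotations, and adjacent flags lie in different ones. *)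
Lemma roli_chiral_for (same : set P -> set P -> Prop) :
  (forall Phi Psi, flag Phi -> flag Psi -> same Phi Psi -> same_aut_orbit Phi Psi) ->
  (forall g Phi, flag Phi -> same Phi (rot_flag g Phi)) ->
  chiral_for same.
Proof.
move=> sa sr; have flagi i : (i < 384)%N -> flag (roli_flag i).
  by move=> il; apply/roli_flagP; exists i.
have adj_lt i k : (i < 384)%N -> (0 < k <= 4)%N -> (roli_adj i k < 384)%N.
  move=> il kr; rewrite -size_roli_flags in il *.
  by have [] := roli_adjP il kr.
(* Adjacent flags differ in handedness. *)
have nadj i k : (i < 384)%N -> (0 < k <= 4)%N ->
    ~ same (roli_flag i) (roli_flag (roli_adj i k)).
  move=> il kr /(sa _ _ (flagi _ il) (flagi _ (adj_lt _ _ il kr))).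
  move/(same_aut_handed il (adj_lt _ _ il kr)); rewrite (roli_handed_adj il kr).
  by case: (handed i).
split.
  exists (roli_flag 0), (roli_flag (roli_adj 0 1)); split.
  - exact: flagi.
  - exact/flagi/adj_lt.
  - exact: nadj.
  - move=> Phi /roli_flagP[i il ->].
    have [b [g [bt <-]]] := roli_flag_orbits il.
    case: (two_flagsP bt) => ->.
      by left; apply: sr; exact: flagi.
    by right; apply: sr; exact/flagi/adj_lt.
move=> Phi Psi /roli_flagP[i il ->] /roli_flagP[j jl ->] aij.
have [k kr ->] : exists2 k, (0 < k <= 4)%N & j = roli_adj i k.
  by apply: (listed_adjacent roli_table (roli_coding R) roli_flagsP
    roli_flags_uniq roli_adjP _ _ aij); rewrite size_roli_flags.
exact: nadj.
Qed.

Lemma roli_abstractly_chiral : abstractly_chiral P.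
Proof.
apply: roli_chiral_for => // g Phi _; exists (rot_face g).
by split=> //; exact: rot_face_automorphism.
Qed.

Lemma roli_faithful : faithful_realization (@roli_point R).
Proof.
apply: (coded_faithful (roli_coding R)).
- case=> [|u|u|u|u|] // [|w|w|w|w|] // _ _ /= e.
  by congr RoliVertex; apply: val_inj.
- exact: roli_determined_by_facets.
Qed.

Lemma roli_geometrically_chiral : geometrically_chiral (@roli_point R).
Proof.
apply: roli_chiral_for => [Phi Psi fPhi fPsi|g Phi _].
  exact: (same_geometric_aut roli_table (roli_coding R) roli_faithful fPhi fPsi).
exact: rot_same_geometric.
Qed.

(** The vertices span the space, so a rotation is determined by its action on
the faces. *)
Lemma rot_face_inj (g h : rotation R) : rot_face g = rot_face h -> g = h.
Proof.
move=> e; apply: val_inj; apply/row_matrixP => i.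
have vert x : rot_point g (point_of R x) = rot_point h (point_of R x).
  have [u eu _] := face_of_vertex R x.
  have := congr1 (fun f => f (RoliVertex u)) e; rewrite /= => -[].
  by rewrite eu.
(* Twice the i-th basis vector is a difference of two vertices. *)
have two : point_of R base_vertex_code - point_of R (flip i base_vertex_code) =
    2%:R *: delta_mx 0 i.
  apply/rowP => j; rewrite mxE [X in _ + X]mxE !vecE !mxE.
  case: i => -[|[|[|[|//]]]] ?; case: j => -[|[|[|[|//]]]] ? /=;
    by rewrite ?expr0 ?expr1 ?opprK ?subrr ?mulr0 ?mulr1.
have two0 : (2%:R : R) != 0 by rewrite pnatr_eq0.
apply: (scalerI two0); rewrite !rowE !scalemxAl -two !mulmxBl.
by congr (_ - _); exact: vert.
Qed.

(** The automorphism induced by a rotation. *)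
Definition rot_aut (g : rotation R) : automorphism P :=
  SigSub (mem_set (rot_face_automorphism g)).

Lemma rot_aut_inj : injective rot_aut.
Proof. by move=> g h /(congr1 val) /= e; exact: rot_face_inj. Qed.

Lemma rot_autM : {morph rot_aut : g h / (g * h)%g}.
Proof. by move=> g h; apply: val_inj; apply/funext => F; exact: rot_faceM. Qed.

(** Every automorphism preserves handedness, hence maps the first flag as some
rotation does, and so is that rotation. *)
Lemma rot_aut_surj f : exists g, rot_aut g = f.
Proof.
have fA := autP f; have z0 : (0 < size roli_flags)%N by rewrite size_roli_flags.
have [q qP] := automorphism_index roli_table (roli_coding R) roli_flagsP
  roli_flags_uniq roli_adjP fA.
have [ql fq _] := qP 0%N z0; rewrite size_roli_flags in ql.
have same : handed 0%N = handed (q 0%N).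
  by apply: (same_aut_handed (isT : (0 < 384)%N) ql); exists (val f).
have [b [g [bt gb]]] := roli_flag_orbits ql.
have bl := two_flags_lt bt.
have hb : handed b = handed (q 0%N).
  apply: (same_aut_handed bl ql); exists (rot_face g).
  by split; [exact: rot_face_automorphism | exact: gb].
have b0 : b = 0%N.
  case: (two_flagsP bt) => eb; first exact: eb.
  move: hb; rewrite eb (@roli_handed_adj 0 1 isT isT) -same.
  by case: (closed_walk _ _ 0).
(* The rotation g maps the first flag as f does. *)
exists g; apply: val_inj; apply/funext => F /=.
pose h : automorphism P := (f * rot_aut g^-1)%g.
have fixed : val h @` roli_flag 0 = roli_flag 0.
  rewrite -[LHS](image_comp (val f) (rot_face g^-1%g)).
  have -> : val f @` roli_flag 0 = rot_flag g (roli_flag 0).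
    by rewrite b0 in gb; exact: etrans fq (esym gb).
  by rewrite -/(rot_flag _ _) -rot_flagM mulgV rot_flag1.
have flag0 : coded_flag 4 66 roli_le roli_lev (nth [::] roli_flags 0).
  exact/roli_flagsP/mem_nth.
have [p hp] := face_map_codes (roli_coding R) (val h).
have h1 := automorphism_fixing_flag roli_table (roli_coding R) (autP h) hp flag0
  roli_every_face_in_flag fixed.
have hF : rot_face g^-1%g (val f F) = F := h1 F.
by rewrite -[in LHS]hF -rot_faceM mulVg rot_face1.
Qed.

End RoliAutomorphisms.

(** * The presentation *)

Section WordCalculus.
Variables (n : nat) (rels : seq (word n)).
Implicit Types u v w c : word n.
Local Notation "u == v" := (word_eq rels u v).

(** Equality of words in the presented group is a congruence. *)
Lemma word_eq_cong u v w1 w2 : w1 == w2 -> u ++ w1 ++ v == u ++ w2 ++ v.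
Proof.
elim=> [w|w w' _|w w' w'' _ + _|s t x|s t r rr].
- exact: word_eq_refl.
- exact: word_eq_sym.
- exact: word_eq_trans.
- have := word_eq_cancel rels (u ++ s) (t ++ v) x.
  by rewrite -!catA.
- have := word_eq_rel (u ++ s) (t ++ v) rr.
  by rewrite -!catA.
Qed.

Lemma word_eq_catl u w1 w2 : w1 == w2 -> u ++ w1 == u ++ w2.
Proof. by move/(word_eq_cong u [::]); rewrite !cats0. Qed.

Lemma word_eq_catr v w1 w2 : w1 == w2 -> w1 ++ v == w2 ++ v.
Proof. exact: (@word_eq_cong [::] v). Qed.

Lemma letter_invK (x : letter n) : letter_inv (letter_inv x) = x.
Proof. by case: x => i b; rewrite /letter_inv /= negbK. Qed.

Lemma word_inv_cons x w : word_inv (x :: w) = word_inv w ++ [:: letter_inv x].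
Proof. by rewrite /word_inv /= rev_cons cats1. Qed.

Lemma word_eq_invr w : w ++ word_inv w == [::].
Proof.
elim: w => [|x w IH]; first exact: word_eq_refl.
rewrite word_inv_cons -cat1s -catA (catA w).
apply: word_eq_trans (word_eq_cong [:: x] [:: letter_inv x] IH) _.
exact: (word_eq_cancel rels [::] [::] x).
Qed.

Lemma word_eq_rot u v : u ++ v == [::] -> v ++ u == [::].
Proof.
move=> uv; apply: word_eq_trans (word_eq_invr v).
apply: word_eq_catl; rewrite -[word_inv v]cat0s -[X in X == _]cats0.
apply: word_eq_trans (word_eq_catl u (word_eq_sym (word_eq_invr v))) _.
by rewrite catA; exact: word_eq_catr.
Qed.

Lemma word_eq_inv1 w : w == [::] -> word_inv w == [::].
Proof.
move=> w1; have := word_eq_catr (word_inv w) w1; rewrite cat0s => h.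
exact: word_eq_trans (word_eq_sym h) (word_eq_invr w).
Qed.

(** All cyclic rearrangements of the relators and their inverses. *)
Definition relator_cycles : seq (word n) :=
  flatten [seq [seq rot k s | k <- iota 0 (size s)]
          | s <- rels ++ map (@word_inv n) rels].

Lemma relator_cyclesP c : c \in relator_cycles -> c == [::].
Proof.
case/flatten_mapP=> s; rewrite mem_cat => srel /mapP[k _ ->].
have s1 : s == [::].
  case/orP: srel => [sr|/mapP[r rr ->]].
    by have := word_eq_rel [::] [::] sr; rewrite cats0.
  apply: word_eq_inv1.
  by have := word_eq_rel [::] [::] rr; rewrite cats0.
by rewrite /rot; apply: word_eq_rot; rewrite cat_take_drop.
Qed.

Lemma word_eval_cat (G : groupType) (s : 'I_n -> G) u v :
  word_eval s (u ++ v) = (word_eval s u * word_eval s v)%g.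
Proof. exact: big_cat. Qed.

Lemma word_eq_eval (G : groupType) (s : 'I_n -> G) :
  (forall r, r \in rels -> word_eval s r = 1%g) ->
  forall u v, u == v -> word_eval s u = word_eval s v.
Proof.
move=> r1 u v; elim=> [//|//|w w' w'' _ -> _ -> //|a b x|a b r rr].
  rewrite !word_eval_cat; congr (_ * _)%g; rewrite -[RHS]mul1g; congr (_ * _)%g.
  rewrite /word_eval big_cons big_seq1; case: x => i [] /=.
    exact: mulVg.
  exact: mulgV.
by rewrite !word_eval_cat (r1 r rr) mul1g.
Qed.

End WordCalculus.

(** Coset enumeration over the trivial subgroup. The word rep i represents the
i-th element, and step i l is the element reached from it by the letter l. The
edges (i, l) of this graph are shown to be consequences of the relators, in the
order of their times: an edge of the spanning tree holds by the choice of the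
representatives, and any other edge closes a relator cycle all of whose other
edges have smaller times. *)
Section CosetEnumeration.
Variables (n : nat) (rels : seq (word n)) (N : nat).
Variables (rep : nat -> word n) (step : nat -> letter n -> nat).
Variable (time : nat -> letter n -> nat).

(** The end of the path w from i, if all of its edges satisfy ok. *)
Fixpoint follow (ok : nat -> letter n -> bool) (i : nat) (w : word n) : option nat :=
  if w is l :: w' then if ok i l then follow ok (step i l) w' else None else Some i.

(** One end of the edge has the representative of the other, extended by one
letter. *)
Definition tree_edge (i : nat) (l : letter n) : bool :=
  (rep (step i l) == rcons (rep i) l) ||
  (rep i == rcons (rep (step i l)) (letter_inv l)).

(** The cycle c deduces the edge (i, l) from earlier edges. *)
Definition deduces (i : nat) (l : letter n) (c : word n) : bool :=
  if c is l' :: b then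
    (l' == l) && (follow (fun j m => time j m < time i l)%N i (word_inv b)
                  == Some (step i l))
  else false.

Hypothesis step_lt : forall i l, (i < N)%N -> (step i l < N)%N.
Hypothesis deduced : forall i l, (i < N)%N ->
  tree_edge i l \/ exists2 c, c \in relator_cycles rels & deduces i l c.

(** Each edge is a consequence of the relators: multiplication by the letter l
and by the inverse of b have the same effect when l b is a relator cycle. *)
Lemma edge_word_eq i l : (i < N)%N ->
  word_eq rels (rcons (rep i) l) (rep (step i l)).
Proof.
have [m] := ubnP (time i l); elim: m i l => // m IH i l ti il.
have [/orP[/eqP->|/eqP ri]|[c cc]] := deduced l il.
- exact: word_eq_refl.
- rewrite ri -!cats1 -catA.
  have := word_eq_cancel rels (rep (step i l)) [::] (letter_inv l).
  by rewrite letter_invK !cats0.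
case: c cc => [//|l' b] cc /= /andP[/eqP el /eqP fo]; rewrite el in cc.
have fol (ok : nat -> letter n -> bool) j w k : (forall j x, ok j x -> (time j x < time i l)%N) -> (j < N)%N ->
    follow ok j w = Some k -> word_eq rels (rep j ++ w) (rep k).
  move=> okt; elim: w j => [|x w IHw] j jl /=.
    by case=> <-; rewrite cats0; exact: word_eq_refl.
  case okx: (ok j x) => // /(IHw _ (step_lt x jl)) h.
  apply: word_eq_trans h; rewrite -cat_rcons; apply: word_eq_catr.
  by apply: IH jl; apply: leq_trans (okt _ _ okx) _.
have h := fol _ _ _ _ (fun j m h => h) il fo.
apply: word_eq_trans h; rewrite -cats1.
have := relator_cyclesP cc; rewrite -cat1s => lb.
apply: word_eq_catl; rewrite -[word_inv b]cat0s -[X in word_eq _ X _]cats0.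
apply: word_eq_trans (word_eq_catl _ (word_eq_sym (word_eq_invr rels b))) _.
by rewrite catA; exact: word_eq_catr.
Qed.

Lemma word_eq_rep w : (0 < N)%N -> rep 0 = [::] ->
  (foldl step 0%N w < N)%N /\ word_eq rels w (rep (foldl step 0%N w)).
Proof.
move=> N0 r0; elim/last_ind: w => [|w l [IHl IH]].
  by rewrite /= r0; split=> //; exact: word_eq_refl.
rewrite foldl_rcons; split; first exact: step_lt.
apply: word_eq_trans (edge_word_eq l IHl); rewrite -!cats1.
exact: word_eq_catr.
Qed.

End CosetEnumeration.

Definition all_letters : seq (letter 3) :=
  [seq (generator k, b) | k <- iota 0 3, b <- bools].

(** Rows of tables are indexed by the letters, each generator followed by its
inverse. *)
Definition letter_index (l : letter 3) : nat := (l.1).*2 + l.2.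

Definition letter_table (T : seq (seq nat)) (i : nat) (l : letter 3) : nat :=
  nth 0%N (nth [::] T i) (letter_index l).

(** The Cayley table of the group for the six letters. *)
Definition cayley_table : seq (seq nat) := Eval vm_compute in
  [seq [seq index (frame_mul g (letter_frame l)) group_frames | l <- all_letters]
  | g <- group_frames].

Definition cayley (i : nat) (l : letter 3) : nat := letter_table cayley_table i l.

Definition rep_word (i : nat) : word 3 := positive_word (nth [::] word_codes i).

Definition roli_cycles : seq (word 3) := Eval vm_compute in
  relator_cycles roli_relators.

(** Round r deduces the edges that close a cycle of edges found before; the value
14 marks the edges not found so far, and 13 rounds find all of them. *)
Definition edge_round (r : nat) (T : seq (seq nat)) : seq (seq nat) :=
  [seq [seq let t := letter_table T i l in
       if t < 14 then t else
       if has (fun c => if c is l' :: b then (l' == l) &&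
           isSome (follow cayley (fun j m => letter_table T j m < 14) i (word_inv b))
         else false) roli_cycles then r else 14 | l <- all_letters] | i <- iota 0 192]%N.

(** The round in which each edge is deduced, 0 for the edges of the spanning
tree. *)
Definition edge_times : seq (seq nat) := Eval vm_compute in
  foldl (fun T r => edge_round r T)
    [seq [seq if tree_edge rep_word cayley i l then 0 else 14 | l <- all_letters]
    | i <- iota 0 192]%N (iota 1 13).

Definition edge_time (i : nat) (l : letter 3) : nat := letter_table edge_times i l.

(** The position of a cycle that deduces the edge. *)
Definition edge_cycles : seq (seq nat) := Eval vm_compute in
  [seq [seq find (deduces cayley edge_time i l) roli_cycles | l <- all_letters]
  | i <- iota 0 192].

Lemma mem_all_letters l : l \in all_letters.
Proof.
case: l => i b; have -> : i = generator i by apply: val_inj; case: i => -[|[|[|]]].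
apply/allpairsP; exists (val i, b); split; [by rewrite mem_iota ltn_ord | by case: (b) | by []].
Qed.

Lemma roli_edges_deduced i l : (i < 192)%N -> tree_edge rep_word cayley i l \/
  exists2 c, c \in relator_cycles roli_relators & deduces cayley edge_time i l c.
Proof.
move=> il; have h : all (fun i => all (fun l => tree_edge rep_word cayley i l ||
    let k := letter_table edge_cycles i l in (k < size roli_cycles)%N &&
    deduces cayley edge_time i l (nth [::] roli_cycles k)) all_letters) (iota 0 192).
  by vm_compute.
have e : relator_cycles roli_relators = roli_cycles by vm_compute.
have /orP[t|/andP[kl d]] := allP (all_iotaP h il) l (mem_all_letters l); first by left.
right; rewrite e; exists (nth [::] roli_cycles (letter_table edge_cycles i l)).
  exact: mem_nth kl.
exact: d.
Qed.

Lemma cayley_lt i l : (i < 192)%N -> (cayley i l < 192)%N.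
Proof. by move=> _; apply: nested_table_lt; [by [] | vm_compute]. Qed.

Lemma rep_word_frame i : (i < 192)%N ->
  word_frame (rep_word i) = nth [::] group_frames i.
Proof.
by move=> il; rewrite -group_framesE (nth_map [::]) ?size_word_codes.
Qed.

Lemma roli_relators_trivial (R : realType) r :
  r \in roli_relators -> word_eval (sigma R) r = 1%g.
Proof.
have h : all (fun r => word_frame r == frame_one) roli_relators by vm_compute.
move=> /(allP h)/eqP rf; apply: val_inj.
by rewrite word_evalE rf frame_mx1.
Qed.

(** Every word equals one of the 192 representatives in the presented group, and
these have distinct values in the rotation group. *)
Lemma roli_presentation (R : realType) : has_presentation (@sigma R) roli_relators.
Proof.
split=> [g|w1 w2].
  by have [w _ ->] := rotation_frame g; exists (positive_word w).
split; last exact: word_eq_eval (@roli_relators_trivial R) _ _.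
move=> e; have rep0 : rep_word 0 = [::] by vm_compute.
have [l1 e1] := word_eq_rep cayley_lt roli_edges_deduced w1 isT rep0.
have [l2 e2] := word_eq_rep cayley_lt roli_edges_deduced w2 isT rep0.
set i := foldl _ _ w1 in l1 e1; set j := foldl _ _ w2 in l2 e2.
suff ij : i = j by rewrite ij in e1; exact: word_eq_trans e1 (word_eq_sym e2).
have ev := word_eq_eval (@roli_relators_trivial R).
have : val (word_eval (sigma R) (rep_word i)) = val (word_eval (sigma R) (rep_word j)).
  by rewrite -(ev _ _ e1) -(ev _ _ e2) e.
rewrite !word_evalE.
move/(frame_mx_inj (word_frame_frame _) (word_frame_frame _)).
rewrite !rep_word_frame // => /eqP.
by rewrite nth_uniq ?size_group_frames ?group_frames_uniq // => /eqP.
Qed.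

(** * The theorem *)

Section AutomorphismGroup.
Variable R : realType.
Local Notation P := (roli_cube R).

Lemma roli_automorphisms_rotations : isomorphic (automorphism P) (rotation R).
Proof.
have [phi phiK] := choice (@rot_aut_surj R).
exists phi; split.
  by exists (@rot_aut R) => // g; apply: rot_aut_inj; rewrite phiK.
by move=> f1 f2; apply: rot_aut_inj; rewrite rot_autM !phiK.
Qed.

Lemma roli_automorphism_card : [set: automorphism P] #= `I_192.
Proof.
have -> : [set: automorphism P] = @rot_aut R @` setT.
  by apply/seteqP; split=> // f _; have [g <-] := rot_aut_surj f; exists g.
rewrite (card_eql (inj_card_eq _)); first exact: rotation_card.
by move=> g h _ _; exact: rot_aut_inj.
Qed.

End AutomorphismGroup.

Local Close Scope ring_scope.

Theorem theorem6p1 (R : realType) :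
  [/\ is_polytope (roli_cube R) 4,
      abstractly_chiral (roli_cube R)
    & schlafli_type (roli_cube R) 8 3 3] /\
  [/\ isomorphic (automorphism (roli_cube R)) (rotation R),
      gen_subgroup [set sigma1 R; sigma2 R; sigma3 R] = setT,
      [set: automorphism (roli_cube R)] #= `I_192,
      [set: rotation R] #= `I_192
    & has_presentation (@sigma R) roli_relators] /\
  faithful_realization (@roli_point R) /\
  geometrically_chiral (@roli_point R).
Proof.
split; last split; last split.
- split.
  + exact: (coded_is_polytope roli_table (roli_coding R)).
  + exact: roli_abstractly_chiral.
  + exact: (roli_schlafli (roli_coding R)).
- split.
  + exact: roli_automorphisms_rotations.
  + exact: rotation_generated.
  + exact: roli_automorphism_card.
  + exact: rotation_card.
  + exact: roli_presentation.
- exact: roli_faithful.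
- exact: roli_geometrically_chiral.
Qed.
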